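(* Suppose that, as $n\to\infty$, (i) $p=O(n)$; (ii) $M=O(n^{1/8})$; (iii) $\operatorname{tr}\big(\Gamma(a)\Gamma(b)\Gamma(c)\Gamma(d)\big)=o\big(\operatorname{tr}^2(\Omega_n^2)\big)$ uniformly over all $-M\le a,b,c,d\le M$; and (iv) the mean satisfies the local alternative condition $\mu'[\Gamma(a)\Gamma(-a)]^{1/2}\mu=o\big(n^{-1}\operatorname{tr}(\Omega_n^2)\big)$ for $-M\le a\le M$ (uniformly in $a$). Then $$\widehat{\operatorname{Var}(\mathcal M_n)}=2\sum_{a=-M}^M\sum_{b=-M}^M\xi_n(a,b)\,\widehat{\operatorname{tr}(\Gamma(a)\Gamma(b))}$$ is ratio consistent for $\operatorname{Var}(\mathcal M_n)=2\sum_{a,b=-M}^M\xi_n(a,b)\operatorname{tr}(\Gamma(a)\Gamma(b))$, i.e. $$\frac{\widehat{\operatorname{Var}(\mathcal M_n)}}{\operatorname{Var}(\mathcal M_n)}\xrightarrow{\ p\ }1 \quad\text{as } n\to\infty.$$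
   Context: Primes denote transposes and $\operatorname{tr}^2(A)=(\operatorname{tr}A)^2$. For each $n$, with $p=p_n$ and $M=M_n$ allowed to depend on $n$, the observations $X_1,\dots,X_n\in\mathbb R^p$ come from an $M$-dependent strictly stationary Gaussian process with mean $\mu$ and autocovariance matrices $\Gamma(h)=E[(X_t-\mu)(X_{t+h}-\mu)']$; thus $\Gamma(-h)=\Gamma(h)'$ and $\Gamma(h)=0$ for $|h|>M$. All these quantities may depend on $n$. Let $\overline X_n=\frac1n\sum_{t=1}^nX_t$ and $$\Omega_n=n\operatorname{Cov}(\overline X_n)=\sum_{h=-M}^M\Big(1-\frac{|h|}{n}\Big)\Gamma(h).$$ It is implicit that $\operatorname{tr}(\Omega_n^2)>0$ and $\operatorname{Var}(\mathcal M_n)>0$. Unbiased estimator of $\operatorname{tr}(\Omega_n)$: let $\widehat\Gamma(h)=\frac1n\sum_{t=1}^{n-h}(X_t-\overline X_n)(X_{t+h}-\overline X_n)'$ for $0\le h\le M$, $\gamma=(\operatorname{tr}\Gamma(h))_{0\le h\le M}$, $\widehat\gamma_n=(\operatorname{tr}\widehat\Gamma(h))_{0\le h\le M}$. Then $E(\widehat\gamma_n)=\Theta_n\gamma$, where $\Theta_n$ is the $(M+1)\times(M+1)$ (full-rank) matrix with entries, for $0\le h,k\le M$, $$\Theta_n(h,k)=\Big(1-\frac hn\Big)1_{\{h=k\}}+\Big(1-\frac hn\Big)\Big(1-\frac kn\Big)\frac{2-1_{\{k=0\}}}{n}-\frac1{n^2}\sum_{t=1}^{n-h}\sum_{s=1}^n\big(1_{\{|t-s|=k\}}+1_{\{|t+h-s|=k\}}\big).$$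 Let $b=(b_h)_{0\le h\le M}$ with $b_0=1$ and $b_h=2(1-\frac hn)$ for $h\ge1$, so that $\operatorname{tr}(\Omega_n)=b'\gamma$. Put $\widehat{\operatorname{tr}(\Omega_n)}=b'\Theta_n^{-1}\widehat\gamma_n$ (exactly unbiased) and $\mathcal M_n=\overline X_n'\overline X_n-\frac1n\widehat{\operatorname{tr}(\Omega_n)}$. Coefficients $\xi_n$: $\mathcal M_n$ is a quadratic form $\mathcal M_n=\sum_{t,s=1}^n\pi_n(t,s)X_t'X_s$ with a unique deterministic symmetric coefficient matrix $(\pi_n(t,s))$, and for $-M\le h,k\le M$ $$\xi_n(h,k)=\sum_{i,j=1}^n\pi_n(i,j)\,\pi_n(j-h,i+k),$$ with $\pi_n=0$ when an index lies outside $\{1,\dots,n\}$. Here $\operatorname{Var}(\mathcal M_n)$ denotes the variance of $\mathcal M_n$ under $\mu=0$, which equals $2\sum_{h,k=-M}^M\xi_n(h,k)\operatorname{tr}(\Gamma(h)\Gamma(k))$. Trace estimators: for $-M\le a,b\le M$, $$\widehat{\operatorname{tr}(\Gamma(a)\Gamma(b))}=\frac1{n_{a,b}}\sum_{(t,s)\in\mathcal A(a,b)}(X_{t+a}-\overline X_n^* )'X_s\,(X_{s+b}-\overline X_n^* )'X_t,$$ where $\mathcal A(a,b)$ is the set of pairs $(t,s)$ with $t,s,t+a,s+b\in\{1,\dots,n\}$, $|t+a-s-b|>M$ and $|t-s|>M$; $n_{a,b}$ is its cardinality; and $\overline X_n^*=\overline X_n^*(t,s)$ is the average of $X_w$ over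 $w\in\mathcal B(t,s)=\{1\le i\le n:\min\{|i-t|,|i-s|,|i-t-a|,|i-s-b|\}>M\}$. *)

(* Defs.v *)
From HB Require Import structures.
From mathcomp Require Import all_boot all_order all_algebra.
From mathcomp Require Import all_classical all_reals all_analysis.
From mathcomp Require Import ring zify.

Set Implicit Arguments.
Unset Strict Implicit.
Unset Printing Implicit Defensive.

Import Order.TTheory GRing.Theory Num.Theory.
Import numFieldNormedType.Exports.

Local Open Scope classical_set_scope.
Local Open Scope ring_scope.

Definition dotv (R : realType) (p : nat) (x y : 'cV[R]_p) : R :=
  (x^T *m y) 0 0.

Lemma dotvC (R : realType) (p : nat) (x y : 'cV[R]_p) : dotv x y = dotv y x.
Proof. by rewrite /dotv !mxE; apply: eq_bigr => i _; rewrite !mxE mulrC. Qed.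

(* \sum_(-M <= h <= M) F h *)
Definition lagsum (V : nmodType) (M : nat) (F : int -> V) : V :=
  \sum_(i < M.*2.+1) F (i%:Z - M%:Z).

Section Statistics.
Variable R : realType.
(* A sample path is a function of all integer times; the statistics below only
   read it at the observation times 1, ..., n. *)
Variables (n M : nat).

Definition obs_time (t : int) : bool := (1 <= t) && (t <= n%:Z).

Definition sample_mean p (x : int -> 'cV[R]_p) : 'cV[R]_p :=
  n%:R^-1 *: \sum_(1 <= t < n.+1) x t.

Definition sample_autocov p (x : int -> 'cV[R]_p) (h : nat) : 'M[R]_p :=
  n%:R^-1 *: \sum_(1 <= t < (n - h).+1)
    (x t - sample_mean x) *m (x (t%:Z + h%:Z) - sample_mean x)^T.

Definition gamma_hat p (x : int -> 'cV[R]_p) : 'cV[R]_M.+1 :=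
  \col_h \tr (sample_autocov x h).

Definition Theta : 'M[R]_M.+1 :=
  \matrix_(h < M.+1, k < M.+1)
    ((1 - h%:R / n%:R) * (h == k)%:R
     + (1 - h%:R / n%:R) * (1 - k%:R / n%:R)
       * ((2 - (k == 0 :> nat)%:R) / n%:R)
     - (n%:R ^+ 2)^-1 *
       \sum_(1 <= t < (n - h).+1) \sum_(1 <= s < n.+1)
         ((`|t%:Z - s%:Z| == k%:Z)%:R + (`|t%:Z + h%:Z - s%:Z| == k%:Z)%:R)).

Definition bvec : 'cV[R]_M.+1 :=
  \col_h (if h == 0 :> nat then 1 else 2 * (1 - h%:R / n%:R)).

Definition trOmega_hat p (x : int -> 'cV[R]_p) : R :=
  (bvec^T *m invmx Theta *m gamma_hat x) 0 0.

Definition Mstat p (x : int -> 'cV[R]_p) : R :=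
  dotv (sample_mean x) (sample_mean x) - n%:R^-1 * trOmega_hat x.

(* pin is the symmetric coefficient matrix of the quadratic form Mstat, extended
   by 0 outside {1, ..., n}^2; it does not depend on the dimension p. *)
Definition Mstat_coef (pin : int -> int -> R) : Prop :=
  [/\ forall t s, pin t s = pin s t,
      forall t s, ~~ (obs_time t && obs_time s) -> pin t s = 0
    & forall p (x : int -> 'cV[R]_p),
        Mstat x = \sum_(1 <= t < n.+1) \sum_(1 <= s < n.+1)
                    pin t s * dotv (x t) (x s)].

Let qform (q : int -> int -> R) p (x : int -> 'cV[R]_p) :=
  \sum_(1 <= t < n.+1) \sum_(1 <= s < n.+1) q t s * dotv (x t) (x s).

Let isq (f : forall p, (int -> 'cV[R]_p) -> R) :=
  exists q, forall p (x : int -> 'cV[R]_p), f p x = qform q x.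

Let isl (f : forall p, (int -> 'cV[R]_p) -> 'cV[R]_p) :=
  exists a : nat -> R, forall p (x : int -> 'cV[R]_p),
    f p x = \sum_(1 <= t < n.+1) a t *: x t.

Let isqD f g : isq f -> isq g -> isq (fun p x => f p x + g p x).
Proof.
move=> [q hq] [r hr]; exists (fun t s => q t s + r t s) => p x.
rewrite hq hr -big_split; apply: eq_bigr => t _ /=; rewrite -big_split.
by apply: eq_bigr => s _ /=; rewrite mulrDl.
Qed.

Let isqZ c f : isq f -> isq (fun p x => c * f p x).
Proof.
move=> [q hq]; exists (fun t s => c * q t s) => p x.
rewrite hq mulr_sumr; apply: eq_bigr => t _; rewrite mulr_sumr.
by apply: eq_bigr => s _; rewrite mulrA.
Qed.

Let isq_sum (I : eqType) (r : seq I) (F : I -> forall p, (int -> 'cV[R]_p) -> R) :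
  (forall i, i \in r -> isq (F i)) -> isq (fun p x => \sum_(i <- r) F i p x).
Proof.
elim: r => [|i r IH] h.
  exists (fun _ _ => 0) => p x; rewrite big_nil /qform big1// => t _.
  by rewrite big1// => s _; rewrite mul0r.
have [q hq] : isq (fun p x => F i p x + \sum_(i <- r) F i p x).
  apply: isqD; first by apply: h; rewrite inE eqxx.
  by apply: IH => j jr; apply: h; rewrite inE jr orbT.
by exists q => p x; rewrite big_cons hq.
Qed.

Let isq_dot f g : isl f -> isl g -> isq (fun p x => dotv (f p x) (g p x)).
Proof.
move=> [a ha] [b hb]; exists (fun t s => a `|t|%N * b `|s|%N) => p x.
rewrite ha hb /dotv /qform [(\sum_(_ <= t < _) _)^T]raddf_sum/=.
rewrite mulmx_suml summxE; apply: eq_bigr => t _.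
rewrite mulmx_sumr summxE; apply: eq_bigr => s _.
have -> : (a t *: x t)^T = a t *: (x t)^T by rewrite linearZ.
by rewrite -scalemxAl -scalemxAr /= 2!mxE mulrA.
Qed.

Let isl_mean : isl (fun p x => sample_mean x).
Proof.
by exists (fun=> n%:R^-1) => p x; rewrite /sample_mean scaler_sumr.
Qed.

Let isl_sub f g : isl f -> isl g -> isl (fun p x => f p x - g p x).
Proof.
move=> [a ha] [b hb]; exists (fun t => a t - b t) => p x.
by rewrite ha hb -sumrB; apply: eq_bigr => t _; rewrite scalerBl.
Qed.

Let isl_obs (t : nat) : (1 <= t <= n)%N -> isl (fun p x => x t%:Z).
Proof.
move=> ht; exists (fun s => (s == t)%:R) => p x.
rewrite (big_rem t)/=; last by rewrite mem_index_iota ltnS.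
rewrite eqxx scale1r big_seq big1 ?addr0// => s.
rewrite mem_rem_uniq ?iota_uniq// inE => /andP[/= /negbTE -> _].
by rewrite scale0r.
Qed.

Let isq_Mstat : isq (fun p x => Mstat x).
Proof.
have qc h : (1 <= n)%N -> isq (fun p x => \tr (sample_autocov x h)).
  move=> n1.
  have [q hq] : isq (fun p x => n%:R^-1 * \sum_(1 <= t < (n - h).+1)
      dotv (x (t%:Z + h%:Z) - sample_mean x) (x t%:Z - sample_mean x)).
    apply: isqZ; apply: isq_sum => t; rewrite mem_index_iota => ht.
    by apply: isq_dot; apply: isl_sub (isl_mean); apply: isl_obs; lia.
  exists q => p x; rewrite -hq /sample_autocov mxtraceZ raddf_sum; congr (_ * _).
  apply: eq_bigr => t _ /=; rewrite mxtrace_mulC /dotv trace_mx11//.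
have [q hq] : isq (fun p x => dotv (sample_mean x) (sample_mean x) +
   (- n%:R^-1) * \sum_(h <- enum 'I_M.+1) ((bvec^T *m invmx Theta) 0 h
      * \tr (sample_autocov x h))).
  apply: isqD; first exact: isq_dot isl_mean isl_mean.
  case: (posnP n) => [n0|n1].
    exists (fun _ _ => 0) => p x.
    by rewrite /qform n0 invr0 oppr0 mul0r big_geq.
  by apply: isqZ; apply: isq_sum => h _; apply: isqZ; apply: qc.
exists q => p x; rewrite -hq /Mstat /trOmega_hat mxE big_enum/= mulNr.
by congr (_ - _ * _); apply: eq_bigr => h _; rewrite [gamma_hat _ _ _]mxE.
Qed.

Lemma Mstat_coef_exists : exists pin, Mstat_coef pin.
Proof.
have [q hq] := isq_Mstat.
exists (fun t s => if obs_time t && obs_time s then (q t s + q s t) / 2 else 0).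
split=> [t s|t s /negbTE -> //|p x].
  by rewrite andbC addrC.
rewrite hq; set S := qform q x.
have S' : S = \sum_(1 <= t < n.+1) \sum_(1 <= s < n.+1) q s t * dotv (x t) (x s).
  rewrite /S /qform exchange_big_nat/=; apply: eq_bigr => t _.
  by apply: eq_bigr => s _; rewrite dotvC.
have -> : S = (S + S) / 2 by field.
rewrite {2}S' /S /qform -big_split/= mulr_suml.
rewrite !big_nat; apply: eq_bigr => t ht; rewrite -big_split mulr_suml/=.
rewrite !big_nat; apply: eq_bigr => s hs.
have -> : obs_time t && obs_time s by rewrite /obs_time; lia.
by ring.
Qed.

Lemma Mstat_coef_unique pin pin' :
  Mstat_coef pin -> Mstat_coef pin' -> forall t s, pin t s = pin' t s.
Proof.
move=> [sy ou eq] [sy' ou' eq'].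
have E (u v : int) : obs_time u -> obs_time v ->
   let x c t := (((t == u)%:R + c * (t == v)%:R)%:M : 'cV[R]_1) in
   forall q : int -> int -> R, (forall t s, q t s = q s t) ->
   forall c, qform q (x c) = q u u + 2 * c * q u v + c ^+ 2 * q v v.
  move=> hu hv x q qs c.
  have pt (w : int) (F : int -> R) : obs_time w ->
     \sum_(1 <= s < n.+1) F s * (s%:Z == w)%:R = F w.
    rewrite /obs_time; case: w => [w|w]; last by lia.
    move=> hw; rewrite (big_rem w)/=; last by rewrite mem_index_iota; lia.
    rewrite eqxx mulr1 big_seq big1 ?addr0// => s.
    rewrite mem_rem_uniq ?iota_uniq// inE => /andP[/= sw _].
    by rewrite eqz_nat (negbTE sw) mulr0.
  transitivity (\sum_(1 <= t < n.+1) (q t u + c * q t v) * ((t%:Z == u)%:R + c * (t%:Z == v)%:R)).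
    apply: eq_bigr => t _; rewrite -(pt u (fun s => q t s))// -(pt v (fun s => q t s))//.
    rewrite mulr_sumr -big_split mulr_suml; apply: eq_bigr => s _ /=.
    by rewrite /dotv /x tr_scalar_mx -scalar_mxM !mxE/= mulr1n; ring.
  under eq_bigr do rewrite mulrDr mulrCA.
  rewrite big_split/= -mulr_sumr (pt u (fun t => q t u + c * q t v))//.
  by rewrite (pt v (fun t => q t u + c * q t v))// (qs v u); ring.
move=> t s; have [/andP[ht hs]|h] := boolP (obs_time t && obs_time s); last first.
  by rewrite ou ?ou'.
pose x c w := (((w == t)%:R + c * (w == s)%:R)%:M : 'cV[R]_1).
have H c : qform pin (x c) = qform pin' (x c) by rewrite /qform -eq -eq'.
have := H 1; have := H (-1); have := H 0.
rewrite !(E _ _ ht hs _ sy) !(E _ _ ht hs _ sy').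
rewrite !mulr0 !mul0r expr0n/= !mul0r !addr0 sqrrN expr1n !mul1r => e0 e1 e2.
have : 4 * pin t s = 4 * pin' t s.
  transitivity ((pin t t + 2 * 1 * pin t s + pin s s) - (pin t t + 2 * -1 * pin t s + pin s s)); first by ring.
  by rewrite mulr1 mulrN mulr1 in e2 e1 *; rewrite e1 e2; ring.
by apply: mulfI; rewrite pnatr_eq0.
Qed.

Definition pi_n : int -> int -> R := sval (cid Mstat_coef_exists).

Lemma pi_nP : Mstat_coef pi_n.
Proof. exact: svalP. Qed.

Definition xi (h k : int) : R :=
  \sum_(1 <= i < n.+1) \sum_(1 <= j < n.+1)
    pi_n i j * pi_n (j%:Z - h) (i%:Z + k).

Definition in_A (a b t s : int) : bool :=
  [&& obs_time t, obs_time s, obs_time (t + a), obs_time (s + b),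
      M%:Z < `|t + a - s - b| & M%:Z < `|t - s|].

Definition card_A (a b : int) : nat :=
  (\sum_(1 <= t < n.+1) \sum_(1 <= s < n.+1) in_A a b t s)%N.

Definition in_B (a b t s i : int) : bool :=
  [&& obs_time i, M%:Z < `|i - t|, M%:Z < `|i - s|,
      M%:Z < `|i - t - a| & M%:Z < `|i - s - b|].

Definition card_B (a b t s : int) : nat :=
  (\sum_(1 <= w < n.+1) in_B a b t s w)%N.

Definition mean_star p (x : int -> 'cV[R]_p) (a b t s : int) : 'cV[R]_p :=
  (card_B a b t s)%:R^-1 *: \sum_(1 <= w < n.+1 | in_B a b t s w) x w.

Definition tr_hat p (x : int -> 'cV[R]_p) (a b : int) : R :=
  (card_A a b)%:R^-1 *
  \sum_(1 <= t < n.+1) \sum_(1 <= s < n.+1 | in_A a b t s)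
    dotv (x (t%:Z + a) - mean_star x a b t s) (x s)
    * dotv (x (s%:Z + b) - mean_star x a b t s) (x t).

Definition varM_hat p (x : int -> 'cV[R]_p) : R :=
  2 * lagsum M (fun a => lagsum M (fun b => xi a b * tr_hat x a b)).

Definition Omega p (Gamma : int -> 'M[R]_p) : 'M[R]_p :=
  lagsum M (fun h => (1 - `|h|%:~R / n%:R) *: Gamma h).

End Statistics.

(* S = A^{1/2}, the positive semidefinite square root of A. *)
Definition is_psd_sqrt (R : realType) (p : nat) (A S : 'M[R]_p) : Prop :=
  [/\ S^T = S, forall v : 'cV[R]_p, 0 <= dotv v (S *m v) & S *m S = A].

Section Processes.
Variables (R : realType) (d : measure_display) (T : measurableType d).
Variable P : probability T R.

(* The point mass (s = 0) has to be singled out: normal_prob m 0 is the uniform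
   law on [0, 1]. *)
Definition normal_rv (Y : T -> R) : Prop :=
  exists m s : R, forall A : set R, measurable A ->
    P (Y @^-1` A) = if s == 0 then \d_m A else normal_prob m s A.

Variables (p : nat) (X : int -> T -> 'cV[R]_p).

Definition process_measurable : Prop :=
  forall t i, measurable_fun [set: T] (fun w => X t w i 0).

Definition gaussian_process : Prop :=
  forall (m : nat) (t : 'I_m -> int) (c : 'I_m -> 'cV[R]_p),
    normal_rv (fun w => \sum_(k < m) dotv (c k) (X (t k) w)).

(* Joint law of any finite family of coordinates X_(t_k, i_k). *)
Definition strictly_stationary : Prop :=
  forall (m : nat) (t : 'I_m -> int) (i : 'I_m -> 'I_p) (h : int)
         (A : set (m.-tuple R)), measurable A ->
    P [set w | A [tuple X (t k + h) w (i k) 0 | k < m]]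
    = P [set w | A [tuple X (t k) w (i k) 0 | k < m]].

Definition sigma_of (J : set int) : set (set T) :=
  <<s [set E | exists t i (B : set R),
         [/\ J t, measurable B & E = [set w | B (X t w i 0)]] ]>>.

(* The past up to t is independent of the future from time t + m + 1 on. *)
Definition m_dependent (m : nat) : Prop :=
  forall (t : int) (E F : set T),
    sigma_of [set s : int | s <= t] E ->
    sigma_of [set s : int | t + m%:Z < s] F ->
    P (E `&` F) = (P E * P F)%E.

Definition has_mean (mu : 'cV[R]_p) : Prop :=
  forall t i, expectation P (fun w => X t w i 0) = (mu i 0)%:E.

Definition has_autocov (mu : 'cV[R]_p) (Gamma : int -> 'M[R]_p) : Prop :=
  forall t h i j,
    expectation P (fun w => ((X t w - mu) *m (X (t + h) w - mu)^T) i j)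
    = (Gamma h i j)%:E.

Definition gaussian_mdep_process (m : nat) (mu : 'cV[R]_p)
    (Gamma : int -> 'M[R]_p) : Prop :=
  [/\ process_measurable, gaussian_process, strictly_stationary,
      m_dependent m & has_mean mu /\ has_autocov mu Gamma].

(* Var(Mstat) under mu = 0: Mstat is evaluated on the centred path. *)
Definition varM (n m : nat) (mu : 'cV[R]_p) : R :=
  fine (variance P (fun w => Mstat n m (fun t => X t w - mu))).

End Processes.

(* Each Y n lives on its own probability space. *)
Definition cvg_in_probability_cst (R : realType) (d : nat -> measure_display)
    (T : forall n, measurableType (d n)) (P : forall n, probability (T n) R)
    (Y : forall n, T n -> R) (l : R) : Prop :=
  forall e : R, 0 < e ->
    (fun n => P n [set w | e < `|Y n w - l|]) @ \oo --> 0%E.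

(* Main.v *)
(* The mean square error of every trace estimator is bounded explicitly (tr_hat_var), and
   Chebyshev's inequality is applied to the ratio.

   Write Z = X - mu and split the (t,s) summand of tr_hat into products of
   Z_(t+a)'Z_s, of its correction by the mean over B(t,s), and of a term linear in Z
   coming from mu.  For |t - s| > 5(M+1) the product Z_(t+a)'Z_s Z_(s+b)'Z_t is decomposed
   in the sense of Hoeffding into two quadratic forms, whose variance is a fourth-order
   trace by Isserlis' formula, and a degenerate remainder, for which almost all pairs of
   summands are uncorrelated by M-dependence; the other terms are bounded through fourth
   and eighth Gaussian moments.  The bound involves only the Frobenius norms of the
   Gamma(h), the fourth-order traces and mu' Gamma(0) mu.  (iii) controls the first two,
   since tr(GG')^2 <= p tr(GG'GG'), and (iv) at a = 0 controls the last one, as Gamma(0)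
   is the positive semidefinite square root of Gamma(0)Gamma(-0).

   On the deterministic side Theta is close to the identity, hence xi(h,k) is n^-2 up to
   O(M/n^3), and Var(M_n) is 2 tr(Omega^2)/n^2 to first order. *)

Require Import Defs.
From HB Require Import structures.
From mathcomp Require Import all_boot all_order all_algebra.
From mathcomp Require Import all_classical all_reals all_analysis.
From mathcomp Require Import measurable_realfun.
From mathcomp Require Import ring lra zify.

Set Implicit Arguments.
Unset Strict Implicit.
Unset Printing Implicit Defensive.

Import Order.TTheory GRing.Theory Num.Theory.
Import numFieldNormedType.Exports.

Local Open Scope classical_set_scope.
Local Open Scope ring_scope.

(** * Random variables with all moments *)

Section Moments.
Context (R : realType) (d : measure_display) (T : measurableType d).
Variable P : probability T R.
Implicit Types f g h : T -> R.

(** The obstacle is the size of tr(Gamma(h)Gamma(h)'): passing through p leaves it only o(sqrt(n)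
    tr(Omega^2)), so its square, the natural size of the second moment of a summand, is too large by
    a factor n. The summands must therefore cancel: second moments of sums are estimated by counting
    the pairs of summands that are not uncorrelated. Pairs (t,s) at distance O(M) cost more, because
    the fourth moment of a scalar product of dependent vectors is only bounded with a factor p^2.
    Membership in A(a,b) prevents both scalar products of a summand from being of this kind, so
    after Cauchy-Schwarz one factor p remains, and such pairs are a fraction O(M/n) of all. The sum
    over lags of |xi| is O(M^2/n^2), which multiplies every mean square error by M^4 relative to
    n^-4. The exponent 1/8 in (ii) keeps M^4 sqrt(n)/n bounded, as the product of
    tr(Gamma(h)Gamma(h)') with mu' Gamma(0) mu requires. All random quantities are polynomials in
    the centred coordinates, indexed by the times they involve, so that independence is read off
    from distances between index sets. *)

Definition Expect f : R := Rintegral P [set: T] f.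
Local Notation Ex := Expect.

(** All absolute moments are required at once, so that the class is closed under sums and products
    and expectations split without further integrability conditions. *)
Definition mom f := measurable_fun [set: T] f /\
  forall k : nat, P.-integrable [set: T] (EFin \o (fun w => `|f w| ^+ k)).

Lemma mom_ext f g : f =1 g -> mom f -> mom g.
Proof. by move=> /funext ->. Qed.

Lemma Ex_ext f g : f =1 g -> Ex f = Ex g.
Proof. by move=> /funext ->. Qed.

Lemma integrable_le f g : measurable_fun [set: T] f ->
  P.-integrable [set: T] (EFin \o g) -> (forall w, `|f w| <= g w) ->
  P.-integrable [set: T] (EFin \o f).
Proof.
move=> mf ig fg; apply: (le_integrable _ _ _ ig) => //.
  exact/measurable_EFinP.
by move=> w _; rewrite lee_fin (le_trans (fg w))// ler_norm.
Qed.

Lemma mom_int f : mom f -> P.-integrable [set: T] (EFin \o f).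
Proof.
move=> [mf /(_ 1%N) i1]; apply: (integrable_le mf i1) => w.
by rewrite expr1.
Qed.

Lemma mom_meas f : mom f -> measurable_fun [set: T] f.
Proof. by case. Qed.

Lemma mom_cst c : mom (cst c).
Proof.
split=> // k; have := finite_measure_integrable_cst P (`|c| ^+ k).
by apply.
Qed.

Lemma norm_pow_meas f k : measurable_fun [set: T] f ->
  measurable_fun [set: T] (fun w => `|f w| ^+ k).
Proof.
by move=> mf; apply: measurable_funX; apply: measurableT_comp.
Qed.

Lemma momD f g : mom f -> mom g -> mom (fun w => f w + g w).
Proof.
move=> [mf jf] [mg jg]; split; first exact: measurable_funD.
move=> k.
(* The larger of |f| and |g| is at least half of |f + g|, whence the factor 2^k. *)
apply: (@integrable_le _ (fun w => 2 ^+ k * `|f w| ^+ k + 2 ^+ k * `|g w| ^+ k)).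
- by apply: norm_pow_meas; exact: measurable_funD.
- have -> : EFin \o (fun w => 2 ^+ k * `|f w| ^+ k + 2 ^+ k * `|g w| ^+ k) =
    (fun w => (2 ^+ k)%:E * (`|f w| ^+ k)%:E + (2 ^+ k)%:E * (`|g w| ^+ k)%:E)%E.
    by [].
  by apply: integrableD => //; apply: integrableZl => //; [exact: jf|exact: jg].
- move=> w; rewrite ger0_norm ?exprn_ge0//.
  wlog le : f g mf mg jf jg / `|f w| <= `|g w|.
    move=> H; have [|/ltW] := leP `|f w| `|g w|; first exact: H.
    by move=> le; rewrite (addrC (f w)) [X in _ <= X]addrC; exact: H.
  rewrite ler_wpDl ?mulr_ge0 ?exprn_ge0// -exprMn.
  rewrite lerXn2r ?nnegrE ?mulr_ge0// (le_trans (ler_normD _ _))//.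
  by rewrite mulr_natl mulr2n lerD2r.
Qed.

Lemma momM f g : mom f -> mom g -> mom (fun w => f w * g w).
Proof.
move=> [mf jf] [mg jg]; split; first exact: measurable_funM.
move=> k.
apply: (@integrable_le _ (fun w => `|f w| ^+ (k + k) + `|g w| ^+ (k + k))).
- by apply: norm_pow_meas; exact: measurable_funM.
- have -> : EFin \o (fun w => `|f w| ^+ (k + k) + `|g w| ^+ (k + k)) =
    (fun w => (`|f w| ^+ (k + k))%:E + (`|g w| ^+ (k + k))%:E)%E.
    by [].
  by apply: integrableD => //; [exact: jf|exact: jg].
- move=> w; rewrite ger0_norm ?exprn_ge0// normrM exprMn !exprD.
  have : 0 <= `|f w| ^+ k by rewrite exprn_ge0.
  have : 0 <= `|g w| ^+ k by rewrite exprn_ge0.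
  by move: (_ ^+ k) (_ ^+ k) => x y; nra.
Qed.

Lemma momZ c f : mom f -> mom (fun w => c * f w).
Proof. by move=> mf; apply: momM => //; exact: mom_cst. Qed.

Lemma momN f : mom f -> mom (fun w => - f w).
Proof.
move=> /(momZ (-1)); congr mom; apply/funext => w; by rewrite mulN1r.
Qed.

Lemma momB f g : mom f -> mom g -> mom (fun w => f w - g w).
Proof. by move=> mf mg; apply: momD => //; exact: momN. Qed.

Lemma momX f k : mom f -> mom (fun w => f w ^+ k).
Proof.
move=> mf; elim: k => [|k IH]; first exact: mom_cst.
by apply: mom_ext (momM mf IH) => w; rewrite exprS.
Qed.

Lemma mom_sum (I : Type) (r : seq I) (Q : pred I) (F : I -> T -> R) :
  (forall i, Q i -> mom (F i)) -> mom (fun w => \sum_(i <- r | Q i) F i w).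
Proof.
move=> mF; elim: r => [|i r IH].
  by apply: mom_ext (mom_cst 0) => w; rewrite big_nil.
have [Qi|Qi] := boolP (Q i).
  by apply: mom_ext (momD (mF _ Qi) IH) => w; rewrite big_cons Qi.
by apply: mom_ext IH => w; rewrite big_cons (negbTE Qi).
Qed.

Lemma ExD f g : mom f -> mom g -> Ex (fun w => f w + g w) = Ex f + Ex g.
Proof. by move=> mf mg; rewrite /Ex RintegralD//; exact: mom_int. Qed.

Lemma Ex_cst c : Ex (fun=> c) = c.
Proof.
by have := expectation_cst P c; rewrite unlock /Ex /Rintegral => ->.
Qed.

Lemma ExZ c f : mom f -> Ex (fun w => c * f w) = c * Ex f.
Proof. by move=> mf; rewrite /Ex RintegralZl//; exact: mom_int. Qed.

Lemma ExN f : mom f -> Ex (fun w => - f w) = - Ex f.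
Proof.
move=> mf; rewrite -mulN1r -ExZ//; congr Ex; apply/funext => w.
by rewrite mulN1r.
Qed.

Lemma ExB f g : mom f -> mom g -> Ex (fun w => f w - g w) = Ex f - Ex g.
Proof. by move=> mf mg; rewrite ExD ?ExN//; exact: momN. Qed.

Lemma Ex_sum (I : Type) (r : seq I) (Q : pred I) (F : I -> T -> R) :
  (forall i, Q i -> mom (F i)) ->
  Ex (fun w => \sum_(i <- r | Q i) F i w) = \sum_(i <- r | Q i) Ex (F i).
Proof.
move=> mF; elim: r => [|i r IH].
  by rewrite big_nil -[RHS]Ex_cst; apply: Ex_ext => w; rewrite big_nil.
rewrite big_cons -IH; have [Qi|Qi] := boolP (Q i).
  rewrite -ExD; [|exact: mF|exact: mom_sum].
  by apply: Ex_ext => w; rewrite big_cons Qi.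
by apply: Ex_ext => w; rewrite big_cons (negbTE Qi).
Qed.

Lemma Ex_ge0 f : (forall w, 0 <= f w) -> 0 <= Ex f.
Proof. by move=> f0; apply: Rintegral_ge0. Qed.

Lemma Ex_le f g : mom f -> mom g -> (forall w, f w <= g w) -> Ex f <= Ex g.
Proof.
move=> mf mg fg; rewrite -subr_ge0 -ExB//.
by apply: Ex_ge0 => w; rewrite subr_ge0.
Qed.

Lemma Ex_CS f g : mom f -> mom g ->
  Ex (fun w => f w * g w) ^+ 2 <= Ex (fun w => f w ^+ 2) * Ex (fun w => g w ^+ 2).
Proof.
move=> mf mg.
have mff := momX 2 mf; have mgg := momX 2 mg; have mfg := momM mf mg.
set a := Ex (fun w => f w ^+ 2); set b := Ex (fun w => _ * _).
set c := Ex (fun w => g w ^+ 2).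
have a0 : 0 <= a by apply: Ex_ge0 => w; exact: sqr_ge0.
have c0 : 0 <= c by apply: Ex_ge0 => w; exact: sqr_ge0.
have H x y : 0 <= x ^+ 2 * a + 2 * x * y * b + y ^+ 2 * c.
  have -> : x ^+ 2 * a + 2 * x * y * b + y ^+ 2 * c =
     Ex (fun w => (x * f w + y * g w) ^+ 2).
    rewrite -!ExZ// -!ExD; try by repeat (apply: momD || apply: momZ).
    by congr Ex; apply/funext => w /=; ring.
  by apply: Ex_ge0 => w; exact: sqr_ge0.
(* The choice (c, -b) gives c (a c - b^2) >= 0. When c = 0 the choice (-b, a + 1) gives -(a + 2) b^2
   >= 0, hence b = 0. *)
have := H c (- b); have := H (- b) (a + 1).
have [->|cn0] := eqVneq c 0.
  by rewrite !mulr0 => h1 _; nra.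
have cp : 0 < c by rewrite lt_neqAle eq_sym cn0.
move=> _; have -> : c ^+ 2 * a + 2 * c * - b * b + (- b) ^+ 2 * c =
  c * (a * c - b ^+ 2) by ring.
by rewrite pmulr_rge0// subr_ge0.
Qed.

End Moments.

(** * Gaussian moments *)

Section NormalMGF.
Variable R : realType.
Local Notation lmu := (@lebesgue_measure R).

(** [normal_pdf] and the Radon-Nikodym derivative have the same integral over every measurable set,
    hence agree almost everywhere. *)
Lemma normal_prob_integral (m s : R) (f : R -> \bar R) :
  measurable_fun [set: R] f -> (forall x, 0 <= f x)%E ->
  (\int[normal_prob m s]_x f x = \int[lmu]_x (f x * (normal_pdf m s x)%:E))%E.
Proof.
move=> mf f0; have dom := normal_prob_dominates m s.
rewrite -(Radon_Nikodym_SigmaFinite.change_of_variables dom f0 measurableT mf).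
have iRN := Radon_Nikodym_SigmaFinite.f_integrable dom.
apply: ae_eq_integral => //.
- by apply: emeasurable_funM => //; exact: measurable_int iRN.
- by apply: emeasurable_funM => //; apply/measurable_EFinP; exact: measurable_normal_pdf.
- apply: ae_eqe_mul2l => /=.
  apply: integral_ae_eq => //=.
  + by apply/measurable_EFinP; exact: measurable_normal_pdf.
  + by move=> E _ mE; rewrite -Radon_Nikodym_SigmaFinite.f_integral.
Qed.

(* Completing the square. *)
Lemma normal_pdf_tilt (m s u x : R) : s != 0 ->
  expR (u * (x - m)) * normal_pdf m s x =
  expR (u ^+ 2 * s ^+ 2 / 2) * normal_pdf (m + u * s ^+ 2) s x.
Proof.
move=> s0; rewrite !normal_pdfE// mulrCA [RHS]mulrCA; congr (_ * _).
rewrite /normal_fun -!expRD; congr expR.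
by field; rewrite s0.
Qed.

Lemma normal_prob_mgf (m s u : R) : s != 0 ->
  (\int[normal_prob m s]_x (expR (u * (x - m)))%:E =
   (expR (u ^+ 2 * s ^+ 2 / 2))%:E)%E.
Proof.
move=> s0; rewrite normal_prob_integral//; last first.
  apply/measurable_EFinP; apply: measurableT_comp => //.
  by apply: measurable_funM => //; exact: measurable_funB.
under eq_integral do rewrite -EFinM normal_pdf_tilt// EFinM.
rewrite integralZl//; last exact: integrable_normal_pdf.
by rewrite integral_normal_pdf mule1.
Qed.

End NormalMGF.

Section NormalRV.
Context (R : realType) (d : measure_display) (T : measurableType d).
Variable P : probability T R.

(** The point mass (s = 0) satisfies the same formula, both sides being 1, so degenerate linear
    forms need no separate treatment later. *)
Lemma normal_rv_mgf (Y : T -> R) : measurable_fun [set: T] Y ->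
  normal_rv P Y -> exists m s : R, forall u : R,
  (\int[P]_w (expR (u * (Y w - m)))%:E = (expR (u ^+ 2 * s ^+ 2 / 2))%:E)%E.
Proof.
move=> mY [m [s H]]; exists m, s => u.
pose Y' : {RV P >-> measurableTypeR R} :=
  HB.pack (Y : T -> measurableTypeR R)
    (isMeasurableFun.Build _ _ _ _ (Y : T -> measurableTypeR R) mY).
have mf : measurable_fun [set: measurableTypeR R] (fun x => (expR (u * (x - m)))%:E).
  apply/measurable_EFinP; apply: measurableT_comp => //.
  by apply: measurable_funM => //; exact: measurable_funB.
have := @ge0_integral_distribution _ _ _ (measurableTypeR R) R P Y' _ mf.
rewrite /comp /= => <-; last by move=> y; rewrite lee_fin expR_ge0.
have [s0|s0] := eqVneq s 0.
  transitivity (\int[\d_(m : measurableTypeR R)]_x (expR (u * (x - m)))%:E)%E.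
    apply: eq_measure_integral => A mA _.
    by have := H A mA; rewrite s0 eqxx.
  by rewrite integral_dirac// diracT mul1e subrr mulr0 s0 expr0n/= mulr0 mul0r.
rewrite -(normal_prob_mgf m u s0); apply: eq_measure_integral => A mA _.
by have := H A mA; rewrite (negbTE s0).
Qed.

End NormalRV.

(** * Exponential estimates and comparison of coefficients *)

Section Taylor.
Variable R : realType.
Implicit Types x y u : R.

Lemma series_exp_le x n : 0 <= x -> \sum_(0 <= k < n) x ^+ k / k`!%:R <= expR x.
Proof.
move=> x0; rewrite /expR; apply: limr_ge; first exact: is_cvg_series_exp_coeff.
near=> m; rewrite /series /exp_coeff /=.
have nm : (n <= m)%N by near: m; exact: nbhs_infty_ge.
rewrite (big_cat_nat (leq0n _) nm)//= lerDl sumr_ge0// => i _.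
by rewrite divr_ge0// exprn_ge0.
Unshelve. all: by end_near. Qed.

(** Since (N + k)! >= k!, the term of index N + k of the series is at most |y|^N |y|^k / k! in
    absolute value. *)
Lemma expR_taylor N y :
  `|expR y - \sum_(0 <= k < N) y ^+ k / k`!%:R| <= `|y| ^+ N * expR `|y|.
Proof.
set S := \sum_(_ <= k < _) _.
have cv : cvgn (series (exp_coeff y) - cst S)%R.
  by apply: is_cvgB; [exact: is_cvg_series_exp_coeff|exact: is_cvg_cst].
have -> : expR y - S = limn (series (exp_coeff y) - cst S)%R.
  rewrite limB//; [|exact: is_cvg_series_exp_coeff|exact: is_cvg_cst].
  by rewrite lim_cst.
rewrite -lim_norm//; apply: limr_le; first exact: is_cvg_norm.
near=> n.
have Nn : (N <= n)%N by near: n; exact: nbhs_infty_ge.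
rewrite /= /series /exp_coeff /= !fctE (big_cat_nat (leq0n _) Nn)//= -/S addrAC subrr add0r.
rewrite (le_trans (ler_norm_sum _ _ _))//.
apply: le_trans (ler_wpM2l (exprn_ge0 _ (normr_ge0 y)) (series_exp_le (n - N) (normr_ge0 y))).
rewrite mulr_sumr -{1}(add0n N) big_addn; apply: ler_sum => k _.
rewrite normrM normrX normrV ?unitfE ?pnatr_eq0 -?lt0n ?fact_gt0// normr_nat.
rewrite exprD [_ ^+ k * _]mulrC -mulrA ler_wpM2l ?exprn_ge0//.
rewrite ler_wpM2l ?exprn_ge0// lef_pV2 ?posrE ?ltr0n ?fact_gt0//.
by rewrite ler_nat leq_fact// leq_addr.
Unshelve. all: by end_near. Qed.

Lemma pow_le_expR k y : `|y| ^+ k <= k`!%:R * (expR y + expR (- y)).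
Proof.
have H : `|y| ^+ k <= k`!%:R * expR `|y|.
  rewrite mulrC -ler_pdivrMr ?ltr0n ?fact_gt0//.
  apply: le_trans (series_exp_le k.+1 (normr_ge0 y)).
  by rewrite big_nat_recr//= lerDr sumr_ge0.
apply: (le_trans H); rewrite ler_wpM2l//.
case: (ler0P y) => _; first by rewrite lerDr expR_ge0.
by rewrite lerDl expR_ge0.
Qed.

(** Coefficient comparison at 0+, which replaces differentiation of the moment generating function
    under the integral. Letting u tend to 0 kills the constant coefficient; division by u lowers n
    by one. *)
Lemma small_poly_eq0 n (c : nat -> R) K :
  (forall u, 0 < u -> u <= 1 -> `|\sum_(k < n) c k * u ^+ k| <= K * u ^+ n) ->
  forall k, (k < n)%N -> c k = 0.
Proof.
elim: n c K => [//|n IH] c K H.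
have c0 : c 0%N = 0.
  apply/eqP; rewrite -normr_le0; apply/ler_addgt0Pl => e e0; rewrite addr0.
  set B := \sum_(k < n) `|c k.+1|.
  have B0 : 0 <= B by apply: sumr_ge0.
  have K0 : 0 <= K by have := H 1 ltr01 (lexx _); rewrite expr1n mulr1; apply: le_trans.
  (* The higher terms are at most B u and the right-hand side at most K u, so this u makes their sum
     at most e. *)
  pose u := Num.min 1 (e / (B + K + 1)).
  have u0 : 0 < u by rewrite lt_min ltr01 divr_gt0//; lra.
  have u1 : u <= 1 by rewrite ge_min lexx.
  have h := H u u0 u1; rewrite big_ord_recl/= expr0 mulr1 in h.
  have h1 : `|\sum_(i < n) c (bump 0 i) * u ^+ bump 0 i| <= B * u.
    rewrite (le_trans (ler_norm_sum _ _ _))// mulr_suml ler_sum// => i _.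
    rewrite normrM ler_wpM2l// /bump add1n exprS normrM (gtr0_norm u0).
    by rewrite ler_piMr ?(ltW u0)// normrX gtr0_norm// exprn_ile1// ltW.
  have h2 : K * u ^+ n.+1 <= K * u.
    by rewrite ler_wpM2l// exprS ler_piMr ?(ltW u0)// exprn_ile1// ltW.
  have h3 : u * (B + K + 1) <= e.
    rewrite -ler_pdivlMr; last lra.
    by rewrite ge_min lexx orbT.
  have h4 : `|c 0%N| <= `|c 0%N + \sum_(i < n) c (bump 0 i) * u ^+ bump 0 i| +
     `|\sum_(i < n) c (bump 0 i) * u ^+ bump 0 i|.
    by rewrite -{1}[c 0%N](addrK (\sum_(i < n) c (bump 0 i) * u ^+ bump 0 i)) ler_normB.
  nra.
case=> [//|k]; rewrite ltnS => kn.
apply: (IH (fun k => c k.+1) K) => // u u0 u1.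
have := H u u0 u1; rewrite big_ord_recl/= c0 mul0r add0r.
under eq_bigr do rewrite /bump add1n exprS mulrCA.
rewrite -mulr_sumr normrM (gtr0_norm u0) exprS [K * _]mulrCA ler_pM2l//.
Qed.

End Taylor.

Section GaussianMoments.
Context (R : realType) (d : measure_display) (T : measurableType d).
Variable P : probability T R.
Local Notation Ex := (Expect P).
Local Notation mom := (mom P).

Lemma mom_le (f g : T -> R) : measurable_fun [set: T] f -> mom g ->
  (forall w, `|f w| <= g w) -> mom f.
Proof.
move=> mf [mg jg] fg; split => // k.
apply: (integrable_le (norm_pow_meas _ mf) (jg k)) => w.
rewrite ger0_norm ?exprn_ge0// lerXn2r ?nnegrE//.
by rewrite (le_trans (fg w))// ler_norm.
Qed.

(** The expectation of 8! (exp(y) + exp(-y)) for a standard normal y, an upper bound for its eighth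
    moment. *)
Definition gauss8_cst : R := 8`!%:R * (2 * expR (1 / 2)).

Variables (L : T -> R) (s : R).
Hypothesis mL : measurable_fun [set: T] L.
Hypothesis mgf : forall u : R,
  (\int[P]_w (expR (u * L w))%:E = (expR (u ^+ 2 * s ^+ 2 / 2))%:E)%E.

Let meas_exp u : measurable_fun [set: T] (fun w => expR (u * L w)).
Proof. by apply: measurableT_comp => //; exact: measurable_funM. Qed.

Lemma mom_exp u : mom (fun w => expR (u * L w)).
Proof.
split=> [//|k].
have -> : (fun w => `|expR (u * L w)| ^+ k) = (fun w => expR ((k%:R * u) * L w)).
  by apply/funext => w; rewrite ger0_norm ?expR_ge0// -expRM_natl mulrA.
apply/integrableP; split; first exact/measurable_EFinP.
under eq_integral do rewrite /= ger0_norm ?expR_ge0//.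
by rewrite mgf ltry.
Qed.

Lemma Ex_exp u : Ex (fun w => expR (u * L w)) = expR (u ^+ 2 * s ^+ 2 / 2).
Proof. by rewrite /Expect /Rintegral mgf. Qed.

Let cosh2 w := expR (1 * L w) + expR (-1 * L w).

Let mom_cosh : mom cosh2.
Proof. exact: momD (mom_exp _) (mom_exp _). Qed.

Lemma mom_gauss : mom L.
Proof.
apply: (mom_le mL mom_cosh) => w; have := pow_le_expR 1 (L w).
by rewrite expr1 (_ : 1`! = 1%N)// /cosh2 !mul1r mulN1r.
Qed.

(** On (0, 1] the Taylor polynomials of degree 5 of E exp(u L) and of exp(u^2 v), v = s^2/2, differ
    by O(u^6), so their coefficients agree; [c] is the sequence of differences of these
    coefficients. *)
Lemma gauss_moments :
  [/\ Ex L = 0, Ex (fun w => L w ^+ 2) = s ^+ 2 &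
      Ex (fun w => L w ^+ 4) = 3 * s ^+ 4].
Proof.
have mX k := momX k mom_gauss.
pose v := s ^+ 2 / 2.
have v0 : 0 <= v by rewrite divr_ge0// sqr_ge0.
pose c k := Ex (fun w => L w ^+ k) / k`!%:R -
  (if k == 0%N then 1 else if k == 2 then v else if k == 4 then v ^+ 2 / 2 else 0).
pose K := Ex (fun w => L w ^+ 6 * cosh2 w) + v ^+ 3 * expR v.
have H : forall k, (k < 6)%N -> c k = 0.
  apply: (@small_poly_eq0 _ _ _ K) => u u0 u1.
  pose S w := \sum_(0 <= k < 6) (u * L w) ^+ k / k`!%:R.
  have mS : mom S.
    apply: mom_sum => k _; apply: (mom_ext _ (momZ (u ^+ k / k`!%:R) (mX k))) => w.
    by rewrite exprMn; ring.
  have ES : Ex S = \sum_(0 <= k < 6) (Ex (fun w => L w ^+ k) / k`!%:R) * u ^+ k.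
    rewrite Ex_sum; last first.
      move=> k _; apply: (mom_ext _ (momZ (u ^+ k / k`!%:R) (mX k))) => w.
      by rewrite exprMn; ring.
    apply: eq_bigr => k _.
    rewrite (@Ex_ext _ _ _ _ _ (fun w => (u ^+ k / k`!%:R) * L w ^+ k)).
      by rewrite ExZ//; ring.
    by move=> w; rewrite exprMn; ring.
  have e1 : `|Ex (fun w => expR (u * L w)) - Ex S| <= u ^+ 6 * Ex (fun w => L w ^+ 6 * cosh2 w).
    have mB : mom (fun w => expR (u * L w) - S w) by exact: momB (mom_exp _) _.
    have mK : mom (fun w => u ^+ 6 * (L w ^+ 6 * cosh2 w)).
      by apply: momZ; exact: momM (mX 6) mom_cosh.
    have pt w : `|expR (u * L w) - S w| <= u ^+ 6 * (L w ^+ 6 * cosh2 w).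
      apply: (le_trans (expR_taylor _ _)).
      have -> : `|u * L w| ^+ 6 = u ^+ 6 * L w ^+ 6.
        by rewrite -exprMn -normrX ger0_norm// exprn_even_ge0.
      rewrite -mulrA ler_wpM2l ?exprn_even_ge0// ler_wpM2l ?exprn_even_ge0//.
      apply: (@le_trans _ _ (expR `|L w|)).
        by rewrite ler_expR normrM (gtr0_norm u0) ler_piMl.
      rewrite /cosh2 mul1r mulN1r.
      case: (ler0P (L w)) => _; first by rewrite lerDr expR_ge0.
      by rewrite lerDl expR_ge0.
    rewrite -ExB//; [|exact: mom_exp].
    rewrite -ExZ//; last exact: momM (mX 6) mom_cosh.
    rewrite ler_norml; apply/andP; split.
      rewrite -ExN//; apply: Ex_le => //; first exact: momN.
      by move=> w; have := pt w; rewrite ler_norml => /andP[].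
    apply: Ex_le => // w; have := pt w; rewrite ler_norml => /andP[] //.
  have e2 := expR_taylor 3 (u ^+ 2 * v).
  rewrite !big_nat_recr//= big_geq// in e2.
  rewrite Ex_exp -mulrA -/v in e1.
  have e3 : `|u ^+ 2 * v| ^+ 3 * expR `|u ^+ 2 * v| <= u ^+ 6 * (v ^+ 3 * expR v).
    have uv0 : 0 <= u ^+ 2 * v by rewrite mulr_ge0 ?sqr_ge0.
    rewrite (ger0_norm uv0) exprMn -exprM -mulrA ler_wpM2l//.
      by rewrite exprn_even_ge0.
    rewrite ler_wpM2l ?exprn_ge0// ler_expR ler_piMl// exprn_ile1//; exact: ltW.
  have -> : \sum_(k < 6) c k * u ^+ k =
    (expR (u ^+ 2 * v) - (0 + (u ^+ 2 * v) ^+ 0 / 0`!%:R + (u ^+ 2 * v) ^+ 1 / 1`!%:R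
       + (u ^+ 2 * v) ^+ 2 / 2`!%:R)) - (expR (u ^+ 2 * v) - Ex S).
    rewrite ES !big_nat_recr//= big_geq// !big_ord_recr/= big_ord0 /c/=.
    rewrite ?factS ?fact0 ?muln1 !expr0 !expr1 !divr1 ?natrM.
    move: (Ex (fun w => L w ^+ 0)) (Ex (fun w => L w ^+ 1)) (Ex (fun w => L w ^+ 2))
      (Ex (fun w => L w ^+ 3)) (Ex (fun w => L w ^+ 4)) (Ex (fun w => L w ^+ 5))
      (expR (u ^+ 2 * v)) => a0 a1 a2 a3 a4 a5 ee.
    by clear; move: v => v'; ring.
  apply: (le_trans (ler_normB _ _)).
  apply: (le_trans (lerD (le_trans e2 e3) e1)).
  by rewrite /K -mulrDr addrC mulrC.
have := H 1%N isT; have := H 2%N isT; have := H 4%N isT.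
rewrite /c /= ?factS ?fact0 ?muln1 => /subr0_eq h4 /subr0_eq h2 h1.
split.
- by move: h1; rewrite subr0 divr1 => <-; apply: Ex_ext => w; rewrite expr1.
- by move: h2; rewrite /v => h2; lra.
- by move: h4; rewrite /v => h4; rewrite (_ : s ^+ 4 = (s ^+ 2) ^+ 2); [lra|ring].
Qed.

Lemma gauss_moment8 : Ex (fun w => L w ^+ 8) <= gauss8_cst * s ^+ 8.
Proof.
have mX k := momX k mom_gauss.
have H u : u ^+ 8 * Ex (fun w => L w ^+ 8) <= 8`!%:R * (2 * expR (u ^+ 2 * s ^+ 2 / 2)).
  have me := momD (mom_exp u) (mom_exp (- u)).
  rewrite -ExZ//; apply: (@le_trans _ _ (Ex (fun w =>
    8`!%:R * (expR (u * L w) + expR (- u * L w))))).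
    apply: Ex_le; [exact: momZ|exact: momZ|] => w.
    have := pow_le_expR 8 (u * L w).
    by rewrite -mulNr -normrX ger0_norm ?exprn_even_ge0// exprMn.
  rewrite ExZ// ExD; [|exact: mom_exp|exact: mom_exp].
  by rewrite !Ex_exp sqrrN; apply: ler_wpM2l; [exact: ler0n|lra].
(* For s nonzero, u = 1/s is taken. For s = 0 the right-hand side of [H] does not depend on u, and u
   = 1 + C/e shows that the moment is at most e for every e > 0. *)
have [s0|s0] := eqVneq s 0; last first.
  have := H s^-1; rewrite -exprMn mulVf// expr1n -/gauss8_cst => h.
  by rewrite mulrC -ler_pdivrMl -?exprVn// exprn_even_gt0.
have h0 : 0 <= Ex (fun w => L w ^+ 8) by apply: Ex_ge0 => w; rewrite exprn_even_ge0.
rewrite s0 expr0n/= mulr0.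
apply/ler_addgt0Pl => e e0; rewrite addr0.
pose C : R := 8`!%:R * 2.
have C0 : 0 <= C by rewrite mulr_ge0.
have := H (1 + C / e); rewrite s0 expr0n/= mulr0 mul0r expR0 mulr1 -/C.
set y := 1 + C / e => h.
have y1 : 1 <= y by rewrite lerDl divr_ge0// ltW.
have y8 : y <= y ^+ 8 by rewrite exprS ler_peMr ?exprn_ege1//; lra.
have h2 : y * Ex (fun w => L w ^+ 8) <= C by apply: le_trans h; rewrite ler_wpM2r.
have h3 : C <= y * e by rewrite /y mulrDl divfK ?gt_eqF//; lra.
have y0 : 0 < y by lra.
by rewrite -(ler_pM2l y0) (le_trans h2).
Qed.

End GaussianMoments.

(** * Gaussian M-dependent processes *)

Section Independence.
Context (R : realType) (d : measure_display) (T : measurableType d).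
Variable P : probability T R.
Local Notation Ex := (Expect P).
Local Notation mom := (mom P).

(** Factorization on preimages identifies the joint law of (f, g) with the product of the marginal
    laws; Fubini's theorem then factors the expectation. *)
Lemma indep_Ex (f g : T -> R) : mom f -> mom g ->
  (forall A B : set R, measurable A -> measurable B ->
     P (f @^-1` A `&` g @^-1` B) = (P (f @^-1` A) * P (g @^-1` B))%E) ->
  Ex (fun w => f w * g w) = Ex f * Ex g.
Proof.
move=> mf mg H.
have mfg : measurable_fun [set: T] (fun w => (f w, g w)).
  by apply: measurable_fun_pair; [exact: mom_meas mf|exact: mom_meas mg].
pose F : {mfun T >-> (R * R)%type} :=
  HB.pack (fun w => (f w, g w)) (isMeasurableFun.Build _ _ _ _ _ mfg).
pose f' : {RV P >-> R} := HB.pack f (isMeasurableFun.Build _ _ _ _ f (mom_meas mf)).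
pose g' : {RV P >-> R} := HB.pack g (isMeasurableFun.Build _ _ _ _ g (mom_meas mg)).
pose m1 : probability R R := distribution P f'.
pose m2 : probability R R := distribution P g'.
pose m : probability (R * R)%type R := distribution P F.
have E : forall X : set (R * R), measurable X -> (m1 \x m2)%E X = m X.
  apply: product_measure_unique => A B mA mB.
  by rewrite -(H A B mA mB).
pose h (z : R * R) : \bar R := (z.1 * z.2)%:E.
have mh : measurable_fun setT h.
  by apply/measurable_EFinP; apply: measurable_funM.
have ih : m.-integrable setT h.
  apply: integrable_pushforward => //.
  by apply: mom_int; exact: momM.
have ih' : (m1 \x m2)%E.-integrable setT h.
  apply/integrableP; split => //; move/integrableP : ih => [_].
  suff -> : (\int[(m1 \x m2)%E]_z `|h z| = \int[m]_z `|h z|)%E by [].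
  by apply: eq_measure_integral => A mA _; exact: E.
rewrite /Expect /Rintegral.
have -> : (\int[P]_w (f w * g w)%:E = \int[m]_z h z)%E.
  by rewrite integral_pushforward//; apply: mom_int; exact: momM.
have -> : (\int[m]_z h z = \int[(m1 \x m2)%E]_z h z)%E.
  by apply: eq_measure_integral => A mA _; exact/esym/E.
rewrite -integral12_prod_meas1//.
have ig : m2.-integrable setT (fun y => y%:E).
  apply: integrable_pushforward => //; first exact/measurable_EFinP.
  exact: (mom_int mg).
have if_ : m1.-integrable setT (fun y => y%:E).
  apply: integrable_pushforward => //; first exact/measurable_EFinP.
  exact: (mom_int mf).
have e2 : (\int[m2]_y y%:E = (Ex g)%:E)%E.
  rewrite integral_pushforward//; try exact: (mom_int mg); try exact/measurable_EFinP.
  rewrite /Expect /Rintegral fineK//.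
  exact: (integrable_fin_num measurableT (mom_int mg)).
have e1 : (\int[m1]_y y%:E = (Ex f)%:E)%E.
  rewrite integral_pushforward//; try exact: (mom_int mf); try exact/measurable_EFinP.
  rewrite /Expect /Rintegral fineK//.
  exact: (integrable_fin_num measurableT (mom_int mf)).
have e3 x : (\int[m2]_y h (x, y) = x%:E * (Ex g)%:E)%E.
  by rewrite -e2 -integralZl.
transitivity (fine (\int[m1]_x (x%:E * (Ex g)%:E)))%E.
  by congr fine; apply: eq_integral => x _; exact: e3.
by rewrite integralZr// e1.
Qed.

End Independence.

Section Process.
Context (R : realType) (d : measure_display) (T : measurableType d).
Variable P : probability T R.
Local Notation Ex := (Expect P).
Local Notation mom := (mom P).
Variables (p : nat) (X : int -> T -> 'cV[R]_p) (M : nat) (mu : 'cV[R]_p).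
Variable Gamma : int -> 'M[R]_p.
Hypothesis hX : gaussian_mdep_process P X M mu Gamma.

Definition centred (t : int) (i : 'I_p) (w : T) : R := X t w i 0 - mu i 0.
Local Notation Z := centred.

Let mX : process_measurable X. Proof. by case: hX. Qed.
Let gX : gaussian_process P X. Proof. by case: hX. Qed.
Let dX : m_dependent P X M. Proof. by case: hX. Qed.
Let eX : has_mean P X mu. Proof. by case: hX => _ _ _ _ []. Qed.
Let cX : has_autocov P X mu Gamma. Proof. by case: hX => _ _ _ _ []. Qed.

Definition Zcomb (s : seq (R * (int * 'I_p))) (w : T) : R :=
  \sum_(x <- s) x.1 * Z x.2.1 x.2.2 w.
Local Notation lincomb := Zcomb.

Lemma dotv_delta (i : 'I_p) (c : R) (v : 'cV[R]_p) :
  dotv (c *: delta_mx i 0) v = c * v i 0.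
Proof.
rewrite /dotv mxE (bigD1 i)//= !mxE !eqxx mulr1 big1 ?addr0// => j ji.
by rewrite !mxE (negbTE ji)/= mulr0 mul0r.
Qed.

Let Y0 (s : seq (R * (int * 'I_p))) (w : T) : R :=
  \sum_(x <- s) x.1 * X x.2.1 w x.2.2 0.

Let Y0_meas s : measurable_fun [set: T] (Y0 s).
Proof.
by apply: measurable_sum => x; apply: measurable_funM => //; exact: mX.
Qed.

Let Y0_normal s : normal_rv P (Y0 s).
Proof.
have := gX (fun k : 'I_(size s) => (tnth (in_tuple s) k).2.1)
  (fun k => (tnth (in_tuple s) k).1 *: delta_mx (tnth (in_tuple s) k).2.2 0).
congr normal_rv; apply/funext => w; rewrite /Y0.
rewrite [RHS]big_tnth; apply: eq_bigr => k _; exact: dotv_delta.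
Qed.

Let Y0_shift s : exists m sg : R, forall u : R,
  (\int[P]_w (expR (u * (Y0 s w - m)))%:E = (expR (u ^+ 2 * sg ^+ 2 / 2))%:E)%E.
Proof. by apply: normal_rv_mgf; [exact: Y0_meas|exact: Y0_normal]. Qed.

Let mom_Y0 s : mom (Y0 s).
Proof.
have [m [sg H]] := Y0_shift s.
have ms : measurable_fun [set: T] (fun w => Y0 s w - m) by exact: measurable_funB.
apply: (mom_ext _ (momD (mom_gauss ms H) (mom_cst P m))) => w.
by rewrite /cst subrK.
Qed.

Lemma mom_X t i : mom (fun w => X t w i 0).
Proof.
by apply: (mom_ext _ (mom_Y0 [:: (1, (t, i))])) => w; rewrite /Y0 big_seq1 mul1r.
Qed.

Lemma mom_Z t i : mom (Z t i).
Proof. exact: momB (mom_X t i) (mom_cst P _). Qed.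

Let expE f : mom f -> fine ('E_P[f])%E = Ex f.
Proof. by move=> mf; rewrite unlock. Qed.

Lemma Ex_Z t i : Ex (Z t i) = 0.
Proof.
rewrite (ExB (mom_X t i) (mom_cst P _)) Ex_cst -expE; last exact: mom_X.
by rewrite eX subrr.
Qed.

Lemma Ex_ZZ t s i j : Ex (fun w => Z t i w * Z s j w) = Gamma (s - t) i j.
Proof.
have := cX t (s - t) i j; rewrite addrCA subrr addr0 => /(congr1 (@fine R)).
rewrite expE /=.
  move=> <-; apply: Ex_ext => w.
  by rewrite mxE big_ord1 !mxE.
apply: (mom_ext _ (momM (mom_Z t i) (mom_Z s j))) => w.
by rewrite mxE big_ord1 !mxE.
Qed.

(** Gaussianity of the uncentred combination [Y0] comes with an unspecified centring constant m.
    Both [Y0 s - m] and the combination of centred coordinates have mean zero, so m is the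
    combination of the means. *)
Lemma lincomb_moments s :
  Ex (fun w => lincomb s w ^+ 4) = 3 * Ex (fun w => lincomb s w ^+ 2) ^+ 2 /\
  Ex (fun w => lincomb s w ^+ 8) <= gauss8_cst R * Ex (fun w => lincomb s w ^+ 2) ^+ 4.
Proof.
have [m [sg H]] := Y0_shift s.
have ms : measurable_fun [set: T] (fun w => Y0 s w - m) by exact: measurable_funB.
have [h1 h2 h4] := gauss_moments ms H.
have h8 := gauss_moment8 ms H.
have E : lincomb s = (fun w => Y0 s w - m).
  pose c := \sum_(x <- s) x.1 * mu x.2.2 0.
  have E1 w : lincomb s w = Y0 s w - c.
    by rewrite /lincomb /Y0 /c -sumrB; apply: eq_bigr => x _; rewrite /Z mulrBr.
  have h0 : Ex (lincomb s) = 0.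
    rewrite Ex_sum; last by move=> x _; apply: momZ; exact: mom_Z.
    by rewrite big1// => x _; rewrite ExZ ?Ex_Z ?mulr0//; exact: mom_Z.
  suff -> : m = c by apply/funext.
  move: h0; rewrite (Ex_ext _ E1) ExB//; last exact: mom_cst.
  move: h1; rewrite ExB//; last exact: mom_cst.
  by rewrite !Ex_cst => /subr0_eq -> /subr0_eq.
rewrite E h2 h4 -!exprM; split => //.
Qed.

Definition Zmono (l : seq (int * 'I_p)) (w : T) : R :=
  \prod_(x <- l) Z x.1 x.2 w.
Local Notation mono := Zmono.

Lemma mono_cons x l w : mono (x :: l) w = Z x.1 x.2 w * mono l w.
Proof. by rewrite /mono big_cons. Qed.

Lemma mono_cat l1 l2 w : mono (l1 ++ l2) w = mono l1 w * mono l2 w.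
Proof. by rewrite /mono big_cat. Qed.

Lemma mom_mono l : mom (mono l).
Proof.
elim: l => [|x l IH].
  by apply: mom_ext (mom_cst P 1) => w; rewrite /mono big_nil.
by apply: mom_ext (momM (mom_Z x.1 x.2) IH) => w; rewrite mono_cons.
Qed.

Let mono_sigma (J : set int) l : (forall x, x \in l -> J x.1) ->
  forall B : set R, measurable B -> sigma_of X J (mono l @^-1` B).
Proof.
move=> Jl B mB.
pose G := [set E | exists t i (B : set R),
         [/\ J t, measurable B & E = [set w | B (X t w i 0)]] ].
suff : measurable_fun [set: g_sigma_algebraType G] (mono l : g_sigma_algebraType G -> R).
  by move=> /(_ measurableT B mB); rewrite setTI.
elim: l Jl => [|x l IH] Jl.
  by have -> : mono [::] = cst 1 by apply/funext => w; rewrite /mono big_nil.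
have -> : mono (x :: l) = (fun w => Z x.1 x.2 w * mono l w).
  by apply/funext => w; rewrite mono_cons.
apply: measurable_funM; last first.
  by apply: IH => y yl; apply: Jl; rewrite inE yl orbT.
apply: measurable_funB => //.
move=> _ C mC; rewrite setTI.
apply: sub_sigma_algebra; exists x.1, x.2, C; split => //.
by apply: Jl; rewrite inE eqxx.
Qed.

Lemma mono_cut (k : int) l1 l2 :
  (forall x, x \in l1 -> x.1 <= k) -> (forall x, x \in l2 -> k + M%:Z < x.1) ->
  Ex (fun w => mono l1 w * mono l2 w) = Ex (mono l1) * Ex (mono l2).
Proof.
move=> h1 h2; apply: indep_Ex; [exact: mom_mono|exact: mom_mono|].
by move=> A B mA mB; apply: (@dX k); exact: mono_sigma.
Qed.

Definition far (J K : int -> Prop) := forall s t, J s -> K t -> M%:Z < `|s - t|.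

Let last_time (l : seq (int * 'I_p)) : l != [::] ->
  exists2 x, x \in l & forall y, y \in l -> y.1 <= x.1.
Proof.
elim: l => [//|x [_ _|z l IH _]].
  by exists x; rewrite ?inE// => y; rewrite inE => /eqP ->.
have [//|y yl H] := IH.
have [xy|yx] := leP x.1 y.1.
  exists y; first by rewrite inE yl orbT.
  by move=> v; rewrite inE => /predU1P[->//|]; exact: H.
exists x; first by rewrite inE eqxx.
move=> v; rewrite inE => /predU1P[->//|/H h]; exact: le_trans h (ltW yx).
Qed.

(** M-dependence separates a past from a future, whereas the times of [l1] and [l2] may interleave.
    If the last time of [l1] precedes that of [l2], the factors of [l2] after it are more than M
    later than everything else. Cutting them off leaves a strictly shorter [l2], to which the
    induction hypothesis applies. *)
Lemma mono_far l1 l2 :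
  (forall x y, x \in l1 -> y \in l2 -> M%:Z < `|x.1 - y.1|) ->
  Ex (fun w => mono l1 w * mono l2 w) = Ex (mono l1) * Ex (mono l2).
Proof.
have [n] := ubnP (size l1 + size l2); elim: n l1 l2 => // n IH l1 l2.
rewrite ltnS => sz h.
have mono0 : mono [::] = cst 1 by apply/funext => w; rewrite /mono big_nil.
have [->|/last_time[x0 x0l hx0]] := eqVneq l1 [::].
  by rewrite mono0 Ex_cst mul1r; apply: Ex_ext => w; rewrite mul1r.
have [->|/last_time[y0 y0l hy0]] := eqVneq l2 [::].
  by rewrite mono0 Ex_cst mulr1; apply: Ex_ext => w; rewrite mulr1.
wlog xy : l1 l2 x0 y0 sz h x0l y0l hx0 hy0 / x0.1 < y0.1.
  move=> H; have [|yx] := leP y0.1 x0.1; last exact: (H _ _ x0 y0).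
  rewrite le_eqVlt => /predU1P[e|yx].
    by have := h _ _ x0l y0l; rewrite e subrr normr0; lia.
  rewrite mulrC (Ex_ext _ (g := fun w => mono l2 w * mono l1 w)); last first.
    by move=> w; rewrite mulrC.
  apply: (H _ _ y0 x0) => //; first by rewrite addnC.
  by move=> x y xl yl; rewrite distrC; exact: h.
pose q (y : int * 'I_p) := y.1 <= x0.1.
pose l2a := seq.filter q l2; pose l2b := seq.filter (predC q) l2.
have eq2 w : mono l2 w = mono l2a w * mono l2b w.
  by rewrite -mono_cat /mono; apply/esym/perm_big; rewrite perm_filterC.
have hb y : y \in l2b -> x0.1 + M%:Z < y.1.
  rewrite mem_filter /= /q -ltNge => /andP[h1 h2].
  by have := h _ _ x0l h2; rewrite ltr0_norm ?subr_lt0// opprB ltrBrDl.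
have ha y : y \in l2a -> y.1 <= x0.1 by rewrite mem_filter => /andP[].
have szb : (size l2a < size l2)%N.
  rewrite -(count_predC q l2) size_filter -addn1 leq_add2l -has_count.
  by apply/hasP; exists y0 => //=; rewrite /q -ltNge.
have E2 : Ex (mono l2) = Ex (mono l2a) * Ex (mono l2b).
  by rewrite -(mono_cut ha hb); exact: Ex_ext.
rewrite E2 mulrA -IH; first last.
- by move=> x y xl; rewrite mem_filter => /andP[_]; exact: h.
- by apply: leq_trans sz; rewrite ltn_add2l.
rewrite (Ex_ext _ (g := fun w => mono (l1 ++ l2a) w * mono l2b w)); last first.
  by move=> w; rewrite eq2 mono_cat mulrA.
rewrite (@mono_cut x0.1)//.
  by congr (_ * _); apply: Ex_ext => w; rewrite mono_cat.
by move=> y; rewrite mem_cat => /orP[/hx0|/ha].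
Qed.

End Process.

(** * Finite sums *)

Section FiniteSums.
Variable R : realType.

Lemma sum_CS (I : finType) (a b : I -> R) :
  (\sum_i a i * b i) ^+ 2 <= (\sum_i a i ^+ 2) * (\sum_i b i ^+ 2).
Proof.
set A := \sum_i a i ^+ 2; set B := \sum_i b i ^+ 2; set C := \sum_i a i * b i.
have A0 : 0 <= A by apply: sumr_ge0 => i _; exact: sqr_ge0.
have H x y : 0 <= x ^+ 2 * A + 2 * x * y * C + y ^+ 2 * B.
  have -> : x ^+ 2 * A + 2 * x * y * C + y ^+ 2 * B = \sum_i (x * a i + y * b i) ^+ 2.
    rewrite !mulr_sumr -!big_split; apply: eq_bigr => i _ /=; ring.
  by apply: sumr_ge0 => i _; exact: sqr_ge0.
have [B0|Bn0] := eqVneq B 0.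
  by have := H (- C) (A + 1); rewrite B0 !mulr0 => h; nra.
have Bp : 0 < B by rewrite lt_neqAle eq_sym Bn0 sumr_ge0// => i _; exact: sqr_ge0.
have := H B (- C).
have -> : B ^+ 2 * A + 2 * B * - C * C + (- C) ^+ 2 * B = B * (A * B - C ^+ 2) by ring.
by rewrite pmulr_rge0// subr_ge0.
Qed.

Lemma sum_pow4 (I : finType) (a : I -> R) :
  (\sum_i a i) ^+ 4 =
  \sum_(x : (I * I) * (I * I)) (a x.1.1 * a x.1.2) * (a x.2.1 * a x.2.2).
Proof.
have e2 : (\sum_i a i) ^+ 2 = \sum_(x : I * I) a x.1 * a x.2.
  rewrite expr2.
  rewrite -(pair_big xpredT xpredT (fun i j => a i * a j))/=.
  by rewrite mulr_suml; apply: eq_bigr => i _; rewrite mulr_sumr.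
rewrite (exprM _ 2 2) e2 [_ ^+ 2]expr2.
rewrite -(pair_big xpredT xpredT (fun x y : I * I => (a x.1 * a x.2) * (a y.1 * a y.2)))/=.
by rewrite mulr_suml; apply: eq_bigr => i _; rewrite mulr_sumr.
Qed.

End FiniteSums.

(** * Polynomials and linear forms in the centred coordinates *)

Section Polynomials.
Context (R : realType) (d : measure_display) (T : measurableType d).
Variable P : probability T R.
Local Notation Ex := (Expect P).
Local Notation mom := (mom P).
Variables (p : nat) (X : int -> T -> 'cV[R]_p) (M : nat) (mu : 'cV[R]_p).
Variable Gamma : int -> 'M[R]_p.
Hypothesis hX : gaussian_mdep_process P X M mu Gamma.
Local Notation Z := (centred X mu).
Local Notation lincomb := (Zcomb X mu).
Local Notation mono := (Zmono X mu).
Implicit Types (J K : set int) (f g : T -> R).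

(** The set [J] records the times that may occur, so that [pol_far] factors expectations from the
    distance between two such sets alone. *)
Definition pol J f := exists s : seq (R * seq (int * 'I_p)),
  (forall x y, x \in s -> y \in x.2 -> J y.1) /\
  f =1 (fun w => \sum_(x <- s) x.1 * mono x.2 w).

Lemma pol_ext J f g : f =1 g -> pol J f -> pol J g.
Proof. by move=> fg [s [h e]]; exists s; split=> // w; rewrite -fg. Qed.

Lemma pol_cst J c : pol J (fun=> c).
Proof.
exists [:: (c, [::])]; split.
  by move=> x y; rewrite inE => /eqP ->.
by move=> w; rewrite big_seq1 /Zmono big_nil mulr1.
Qed.

Lemma pol_Z J t i : J t -> pol J (Z t i).
Proof.
move=> Jt; exists [:: (1, [:: (t, i)])]; split.
  by move=> x y; rewrite inE => /eqP -> /=; rewrite inE => /eqP ->.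
by move=> w; rewrite big_seq1 /Zmono big_seq1 mul1r.
Qed.

Lemma polD J f g : pol J f -> pol J g -> pol J (fun w => f w + g w).
Proof.
move=> [s [h e]] [r [h' e']]; exists (s ++ r); split.
  by move=> x y; rewrite mem_cat => /orP[/h|/h']; apply.
by move=> w; rewrite big_cat e e'.
Qed.

Lemma polM J f g : pol J f -> pol J g -> pol J (fun w => f w * g w).
Proof.
move=> [s [h e]] [r [h' e']].
exists [seq (x.1 * y.1, x.2 ++ y.2) | x <- s, y <- r]; split.
  move=> x y /allpairsP[[u v] /= [us vr ->]] /=; rewrite mem_cat => /orP[].
    exact: h us.
  exact: h' vr.
move=> w; rewrite big_allpairs_dep/= e e' mulr_suml; apply: eq_bigr => x _.
by rewrite mulr_sumr; apply: eq_bigr => y _ /=; rewrite mono_cat mulrACA.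
Qed.

Lemma polZ J c f : pol J f -> pol J (fun w => c * f w).
Proof. exact/polM/pol_cst. Qed.

Lemma polN J f : pol J f -> pol J (fun w => - f w).
Proof. by move=> /(polZ (-1)); apply: pol_ext => w; rewrite mulN1r. Qed.

Lemma polB J f g : pol J f -> pol J g -> pol J (fun w => f w - g w).
Proof. by move=> jf jg; apply: polD => //; exact: polN. Qed.

Lemma pol_sum J (I : Type) (r : seq I) (Q : pred I) (F : I -> T -> R) :
  (forall i, Q i -> pol J (F i)) -> pol J (fun w => \sum_(i <- r | Q i) F i w).
Proof.
move=> jF; elim: r => [|i r IH].
  by apply: pol_ext (pol_cst J 0) => w; rewrite big_nil.
have [Qi|Qi] := boolP (Q i).
  by apply: pol_ext (polD (jF _ Qi) IH) => w; rewrite big_cons Qi.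
by apply: pol_ext IH => w; rewrite big_cons (negbTE Qi).
Qed.

Lemma mom_pol J f : pol J f -> mom f.
Proof.
move=> [s [_ e]]; apply: (mom_ext (fun w => esym (e w))).
by apply: mom_sum => x _; apply: momZ; exact: (mom_mono hX).
Qed.

Lemma pol_far J K f g : far M J K -> pol J f -> pol K g ->
  Ex (fun w => f w * g w) = Ex f * Ex g.
Proof.
move=> JK [s [h e]] [r [h' e']].
have mm l c : mom (fun w => c * mono l w) by apply: momZ; exact: (mom_mono hX).
rewrite (Ex_ext _ e) (Ex_ext _ e') !Ex_sum//.
rewrite (Ex_ext _ (g := fun w => \sum_(x <- s) \sum_(y <- r)
   (x.1 * y.1) * (mono x.2 w * mono y.2 w))); last first.
  move=> w; rewrite e e' mulr_suml; apply: eq_bigr => x _.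
  by rewrite mulr_sumr; apply: eq_bigr => y _; rewrite mulrACA.
have mm2 (x y : R * seq (int * 'I_p)) : mom (fun w => (x.1 * y.1) * (mono x.2 w * mono y.2 w)).
  by apply: momZ; apply: momM; exact: (mom_mono hX).
rewrite Ex_sum; last by move=> x _; apply: mom_sum => y _; exact: mm2.
rewrite mulr_suml !big_seq; apply: eq_bigr => x xs.
rewrite Ex_sum; last by move=> y _; exact: mm2.
rewrite mulr_sumr !big_seq; apply: eq_bigr => y yr.
rewrite ExZ; last by apply: momM; exact: (mom_mono hX).
rewrite (mono_far hX) ?ExZ; [|exact: (mom_mono hX)|exact: (mom_mono hX)|].
  by rewrite mulrACA.
by move=> u v ux vy; apply: JK; [exact: h ux|exact: h' vy].
Qed.

(** Linear forms are singled out because they are Gaussian: their fourth and eighth moments are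
    controlled by the variance. *)
Definition lin J f := exists s : seq (R * (int * 'I_p)),
  (forall x, x \in s -> J x.2.1) /\ f =1 lincomb s.

Lemma lin_pol J f : lin J f -> pol J f.
Proof.
move=> [s [h e]]; apply: (pol_ext (fun w => esym (e w))).
exists [seq (x.1, [:: x.2]) | x <- s]; split.
  by move=> x y /mapP[u us ->] /=; rewrite inE => /eqP ->; exact: (h _ us).
by move=> w; rewrite big_map; apply: eq_bigr => x _; rewrite /Zmono big_seq1.
Qed.

Lemma lin_ext J f g : f =1 g -> lin J f -> lin J g.
Proof. by move=> fg [s [h e]]; exists s; split=> // w; rewrite -fg. Qed.

Lemma lin_Z J t i : J t -> lin J (Z t i).
Proof.
move=> Jt; exists [:: (1, (t, i))]; split; first by move=> x; rewrite inE => /eqP ->.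
by move=> w; rewrite /Zcomb big_seq1 mul1r.
Qed.

Lemma linD J f g : lin J f -> lin J g -> lin J (fun w => f w + g w).
Proof.
move=> [s [h e]] [r [h' e']]; exists (s ++ r); split.
  by move=> x; rewrite mem_cat => /orP[/h|/h'].
by move=> w; rewrite /Zcomb big_cat e e'.
Qed.

Lemma linZ J c f : lin J f -> lin J (fun w => c * f w).
Proof.
move=> [s [h e]]; exists [seq (c * x.1, x.2) | x <- s]; split.
  by move=> x /mapP[u us ->]; exact: (h _ us).
move=> w; rewrite e /Zcomb big_map mulr_sumr.
by apply: eq_bigr => x _; rewrite mulrA.
Qed.

Lemma lin_sum J (I : Type) (r : seq I) (Q : pred I) (F : I -> T -> R) :
  (forall i, Q i -> lin J (F i)) -> lin J (fun w => \sum_(i <- r | Q i) F i w).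
Proof.
move=> jF; elim: r => [|i r IH].
  by exists [::]; split=> // w; rewrite big_nil /Zcomb big_nil.
have [Qi|Qi] := boolP (Q i).
  by apply: lin_ext (linD (jF _ Qi) IH) => w; rewrite big_cons Qi.
by apply: lin_ext IH => w; rewrite big_cons (negbTE Qi).
Qed.

Lemma lin_sub J K f : J `<=` K -> lin J f -> lin K f.
Proof. by move=> JK [s [h e]]; exists s; split => // x /h/JK. Qed.

Lemma mom_lin J f : lin J f -> mom f.
Proof. by move=> /lin_pol/mom_pol. Qed.

Lemma lin_moment4 J f : lin J f ->
  Ex (fun w => f w ^+ 4) = 3 * Ex (fun w => f w ^+ 2) ^+ 2.
Proof.
by move=> [s [_ /funext ->]]; have [] := lincomb_moments hX s.
Qed.

Lemma lin_moment8 J f : lin J f ->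
  Ex (fun w => f w ^+ 8) <= gauss8_cst R * Ex (fun w => f w ^+ 2) ^+ 4.
Proof.
by move=> [s [_ /funext ->]]; have [] := lincomb_moments hX s.
Qed.

Let lin4 J f1 f2 f3 f4 (e2 e3 e4 : R) :
  lin J f1 -> lin J f2 -> lin J f3 -> lin J f4 ->
  e2 ^+ 2 = 1 -> e3 ^+ 2 = 1 -> e4 ^+ 2 = 1 ->
  let a f g := Ex (fun w => f w * g w) in
  Ex (fun w => (f1 w + e2 * f2 w + e3 * f3 w + e4 * f4 w) ^+ 4) =
  3 * (a f1 f1 + a f2 f2 + a f3 f3 + a f4 f4 + 2 * e2 * a f1 f2 + 2 * e3 * a f1 f3
    + 2 * e4 * a f1 f4 + 2 * e2 * e3 * a f2 f3 + 2 * e2 * e4 * a f2 f4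
    + 2 * e3 * e4 * a f3 f4) ^+ 2.
Proof.
move=> l1 l2 l3 l4 h2 h3 h4 a.
have m1 := mom_lin l1; have m2 := mom_lin l2; have m3 := mom_lin l3; have m4 := mom_lin l4.
rewrite (@lin_moment4 J); last by repeat apply: linD => //; exact: linZ.
congr (3 * _ ^+ 2).
pose b f g w := f w * g w : R.
rewrite (Ex_ext _ (g := fun w => b f1 f1 w + b f2 f2 w + b f3 f3 w + b f4 f4 w
    + 2 * e2 * b f1 f2 w + 2 * e3 * b f1 f3 w
    + 2 * e4 * b f1 f4 w + 2 * e2 * e3 * b f2 f3 w + 2 * e2 * e4 * b f2 f4 w
    + 2 * e3 * e4 * b f3 f4 w)); last first.
  move=> w; rewrite /b; transitivity (f1 w ^+ 2 + e2 ^+ 2 * f2 w ^+ 2 + e3 ^+ 2 * f3 w ^+ 2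
    + e4 ^+ 2 * f4 w ^+ 2 + 2 * e2 * (f1 w * f2 w) + 2 * e3 * (f1 w * f3 w)
    + 2 * e4 * (f1 w * f4 w) + 2 * e2 * e3 * (f2 w * f3 w) + 2 * e2 * e4 * (f2 w * f4 w)
    + 2 * e3 * e4 * (f3 w * f4 w)); first by ring.
  by rewrite h2 h3 h4 !mul1r !expr2.
by rewrite !ExD ?ExZ//; repeat (apply: momD || apply: momZ || apply: momM).
Qed.

(* Polarization: the fourth moment of the Gaussian form e1 f1 + ... + e4 f4 is three
   times the square of its variance for all signs e_i. *)
Lemma isserlis J f1 f2 f3 f4 : lin J f1 -> lin J f2 -> lin J f3 -> lin J f4 ->
  Ex (fun w => (f1 w * f2 w) * (f3 w * f4 w)) =
    Ex (fun w => f1 w * f2 w) * Ex (fun w => f3 w * f4 w)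
  + Ex (fun w => f1 w * f3 w) * Ex (fun w => f2 w * f4 w)
  + Ex (fun w => f1 w * f4 w) * Ex (fun w => f2 w * f3 w).
Proof.
move=> l1 l2 l3 l4.
have m1 := mom_lin l1; have m2 := mom_lin l2; have m3 := mom_lin l3; have m4 := mom_lin l4.
pose F (e2 e3 e4 : R) w := (f1 w + e2 * f2 w + e3 * f3 w + e4 * f4 w) ^+ 4.
have mF e2 e3 e4 : mom (F e2 e3 e4).
  by apply: momX; repeat apply: momD => //; exact: momZ.
have n1 : (-1 : R) ^+ 2 = 1 by rewrite sqrrN expr1n.
have o1 : (1 : R) ^+ 2 = 1 by rewrite expr1n.
have E e2 e3 e4 := lin4 l1 l2 l3 l4 (e2 := e2) (e3 := e3) (e4 := e4).
(* The signed sum over the eight sign patterns leaves only the multilinear term of the fourth power,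
   with coefficient 8 * 4! = 192. *)
have : 192 * Ex (fun w => (f1 w * f2 w) * (f3 w * f4 w)) =
  Ex (F 1 1 1) - Ex (F (-1) 1 1) - Ex (F 1 (-1) 1) - Ex (F 1 1 (-1))
  + Ex (F (-1) (-1) 1) + Ex (F (-1) 1 (-1)) + Ex (F 1 (-1) (-1)) - Ex (F (-1) (-1) (-1)).
  rewrite -ExZ; last by repeat apply: momM.
  rewrite -!(ExB, ExD)//; try by repeat (apply: momB || apply: momD).
  by apply: Ex_ext => w; rewrite /F; ring.
rewrite /F !E// => h.
apply: (mulfI (_ : 192 != 0 :> R)); first by rewrite pnatr_eq0.
by rewrite h; ring.
Qed.

End Polynomials.

(** * Second moments of weighted sums *)

Section L2.
Context (R : realType) (d : measure_display) (T : measurableType d).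
Variable P : probability T R.
Local Notation Ex := (Expect P).
Local Notation mom := (mom P).
Implicit Types f g : T -> R.

Lemma sqr_le_le (x y : R) : 0 <= y -> x ^+ 2 <= y ^+ 2 -> x <= y.
Proof. by move=> y0 h; rewrite leNgt; apply/negP => yx; nra. Qed.

Lemma Ex_CS_le f g a b : mom f -> mom g -> 0 <= a -> 0 <= b ->
  Ex (fun w => f w ^+ 2) <= a ^+ 2 -> Ex (fun w => g w ^+ 2) <= b ^+ 2 ->
  Ex (fun w => f w * g w) <= a * b.
Proof.
move=> mf mg a0 b0 fa gb; apply: sqr_le_le; first exact: mulr_ge0.
rewrite exprMn; apply: (le_trans (Ex_CS mf mg)).
by apply: ler_pM => //; apply: Ex_ge0 => w; exact: sqr_ge0.
Qed.

Lemma Ex_sqM f g a b : mom f -> mom g -> 0 <= a -> 0 <= b ->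
  Ex (fun w => f w ^+ 4) <= a ^+ 2 -> Ex (fun w => g w ^+ 4) <= b ^+ 2 ->
  Ex (fun w => (f w * g w) ^+ 2) <= a * b.
Proof.
move=> mf mg a0 b0 fa gb.
rewrite (Ex_ext _ (g := fun w => f w ^+ 2 * g w ^+ 2)); last by move=> w; rewrite exprMn.
apply: Ex_CS_le => //; try exact: momX.
  by apply: le_trans fa; rewrite (Ex_ext _ (g := fun w => f w ^+ 4))// => w; rewrite -exprM.
by apply: le_trans gb; rewrite (Ex_ext _ (g := fun w => g w ^+ 4))// => w; rewrite -exprM.
Qed.

(** In the expansion of the square, unlinked pairs vanish and each linked pair is at most B by
    Cauchy-Schwarz, which reduces a variance bound to a count. Indices of weight zero are exempt
    from the hypotheses, so the weights can encode the domain of summation. *)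
Lemma Ex_linked (I : finType) (F : I -> T -> R) (c : I -> R) (link : rel I) B :
  (forall i, mom (F i)) -> 0 <= B ->
  (forall i, c i != 0 -> Ex (fun w => F i w ^+ 2) <= B) ->
  (forall i j, c i != 0 -> c j != 0 -> ~~ link i j -> Ex (fun w => F i w * F j w) = 0) ->
  Ex (fun w => (\sum_i c i * F i w) ^+ 2)
    <= B * \sum_i \sum_j `|c i| * `|c j| * (link i j)%:R.
Proof.
move=> mF B0 hB hl.
rewrite (Ex_ext _ (g := fun w => \sum_i \sum_j (c i * c j) * (F i w * F j w))); last first.
  move=> w; rewrite expr2 mulr_suml; apply: eq_bigr => i _.
  by rewrite mulr_sumr; apply: eq_bigr => j _; rewrite mulrACA.
have mm i j : mom (fun w => (c i * c j) * (F i w * F j w)).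
  by apply: momZ; exact: momM.
rewrite Ex_sum; last by move=> i _; apply: mom_sum.
rewrite mulr_sumr; apply: ler_sum => i _.
rewrite Ex_sum// mulr_sumr; apply: ler_sum => j _.
rewrite ExZ; last exact: momM.
have [ci|ci] := eqVneq (c i) 0; first by rewrite ci !mul0r normr0 !mul0r mulr0.
have [cj|cj] := eqVneq (c j) 0; first by rewrite cj !(mulr0, mul0r) normr0 !(mulr0, mul0r).
have [lij|lij] := boolP (link i j); last by rewrite hl// !mulr0.
rewrite mulr1 -normrM.
apply: (le_trans (ler_norm _)); rewrite [leLHS]normrM [leRHS]mulrC; apply: ler_wpM2l => //.
have sB : (Num.sqrt B) ^+ 2 = B by rewrite sqr_sqrtr.
have Bs : B = Num.sqrt B * Num.sqrt B by rewrite -expr2.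
have h1 : Ex (fun w => F i w * F j w) <= B.
  by rewrite Bs; apply: Ex_CS_le; rewrite ?sqrtr_ge0 ?sB ?hB.
have h2 : Ex (fun w => (- F i w) * F j w) <= B.
  rewrite Bs; apply: Ex_CS_le; rewrite ?sqrtr_ge0 ?sB ?hB//; first exact: momN.
  by rewrite (Ex_ext _ (g := fun w => F i w ^+ 2)) ?hB// => w; rewrite sqrrN.
rewrite ler_norml h1 andbT lerNl -ExN; last exact: momM.
by apply: le_trans h2; rewrite (Ex_ext _ (g := fun w => - F i w * F j w))// => w; rewrite mulNr.
Qed.

(** The case where every pair is linked: a bound for averages that uses no cancellation. *)
Lemma Ex_avg (I : finType) (F : I -> T -> R) (c : I -> R) B :
  (forall i, mom (F i)) -> 0 <= B ->
  (forall i, c i != 0 -> Ex (fun w => F i w ^+ 2) <= B) ->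
  Ex (fun w => (\sum_i c i * F i w) ^+ 2) <= B * (\sum_i `|c i|) ^+ 2.
Proof.
move=> mF B0 hB; apply: (le_trans (Ex_linked (link := fun _ _ => true) mF B0 hB _)) => //.
rewrite expr2 mulr_suml ler_wpM2l// ler_sum// => i _.
by rewrite mulr_sumr ler_sum// => j _; rewrite mulr1.
Qed.

End L2.

(** * Fourth moments of scalar products *)

Section Dot.
Context (R : realType) (d : measure_display) (T : measurableType d).
Variable P : probability T R.
Local Notation Ex := (Expect P).
Local Notation mom := (mom P).
Variables (p : nat) (X : int -> T -> 'cV[R]_p) (M : nat) (mu : 'cV[R]_p).
Variable Gamma : int -> 'M[R]_p.
Hypothesis hX : gaussian_mdep_process P X M mu Gamma.
Local Notation pol := (pol X mu).
Local Notation lin := (lin X mu).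
Implicit Types (J K : set int) (U V : 'I_p -> T -> R).

Definition dot U V (w : T) : R := \sum_i U i w * V i w.

Lemma pol_dot J U V : (forall i, pol J (U i)) -> (forall i, pol J (V i)) -> pol J (dot U V).
Proof. by move=> hU hV; apply: pol_sum => i _; exact: polM. Qed.

(** Each of the three pairings of the indices i, j, k, l gives, up to a permutation of the
    summations, the square of the double sum. *)
Let sum4 (a : 'I_p -> 'I_p -> R) (g : R) : \sum_i \sum_j a i j ^+ 2 <= g ->
  let S F := \sum_(x : ('I_p * 'I_p) * ('I_p * 'I_p)) F x.1.1 x.1.2 x.2.1 x.2.2 in
  [/\ S (fun i j k l => (a i j * a k l) ^+ 2) <= g ^+ 2,
      S (fun i j k l => (a i k * a j l) ^+ 2) <= g ^+ 2 &
      S (fun i j k l => (a i l * a j k) ^+ 2) <= g ^+ 2].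
Proof.
move=> ag S.
have S0 : 0 <= \sum_i \sum_j a i j ^+ 2.
  by apply: sumr_ge0 => i _; apply: sumr_ge0 => j _; exact: sqr_ge0.
have SE F : S F = \sum_i \sum_j \sum_k \sum_l F i j k l.
  rewrite /S -(pair_big xpredT xpredT (fun x y : 'I_p * 'I_p => F x.1 x.2 y.1 y.2))/=.
  rewrite -(pair_big xpredT xpredT (fun i j : 'I_p => \sum_(y : 'I_p * 'I_p) F i j y.1 y.2))/=.
  apply: eq_bigr => i _; apply: eq_bigr => j _.
  by rewrite -(pair_big xpredT xpredT (fun k l : 'I_p => F i j k l))/=.
have key : \sum_i \sum_j \sum_k \sum_l (a i j * a k l) ^+ 2 = (\sum_i \sum_j a i j ^+ 2) ^+ 2.
  rewrite expr2 mulr_suml; apply: eq_bigr => i _; rewrite mulr_suml; apply: eq_bigr => j _.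
  rewrite mulr_sumr; apply: eq_bigr => k _; rewrite mulr_sumr; apply: eq_bigr => l _.
  by rewrite exprMn.
have le2 : (\sum_i \sum_j a i j ^+ 2) ^+ 2 <= g ^+ 2.
  by rewrite lerXn2r// nnegrE// (le_trans S0).
split; rewrite SE; apply: le_trans le2; rewrite -key.
- by [].
- by apply: ler_sum => i _; rewrite exchange_big.
- rewrite le_eqVlt; apply/orP; left; apply/eqP; apply: eq_bigr => i _.
  transitivity (\sum_l \sum_j \sum_k (a i l * a j k) ^+ 2); last by [].
  under eq_bigr do rewrite exchange_big /=.
  exact: exchange_big.
Qed.

(** The fourth power is a sum over four coordinates; independence splits each term into a fourth
    moment of U times one of V. By Isserlis' formula, with three pairings, the squares of either
    family sum to at most 9 times the squared Frobenius bound, and Cauchy-Schwarz combines the two.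
    No power of the dimension appears. *)
Lemma dot4_far J K U V gA gB : far M J K ->
  (forall i, lin J (U i)) -> (forall i, lin K (V i)) ->
  \sum_i \sum_j Ex (fun w => U i w * U j w) ^+ 2 <= gA ->
  \sum_i \sum_j Ex (fun w => V i w * V j w) ^+ 2 <= gB ->
  Ex (fun w => dot U V w ^+ 4) <= 9 * gA * gB.
Proof.
move=> JK hU hV hA hB.
have gA0 : 0 <= gA.
  by apply: le_trans hA; apply: sumr_ge0 => i _; apply: sumr_ge0 => j _; exact: sqr_ge0.
have gB0 : 0 <= gB.
  by apply: le_trans hB; apply: sumr_ge0 => i _; apply: sumr_ge0 => j _; exact: sqr_ge0.
pose I4 := (('I_p * 'I_p) * ('I_p * 'I_p))%type.
pose m4 (W : 'I_p -> T -> R) (x : I4) w := (W x.1.1 w * W x.1.2 w) * (W x.2.1 w * W x.2.2 w).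
have pm4 L W x : (forall i, lin L (W i)) -> pol L (m4 W x).
  by move=> hW; apply: polM; apply: polM; exact: lin_pol.
rewrite (Ex_ext _ (g := fun w => \sum_(x : I4) m4 U x w * m4 V x w)); last first.
  by move=> w; rewrite /dot sum_pow4; apply: eq_bigr => x _; rewrite /m4; ring.
rewrite Ex_sum; last first.
  move=> x _; apply: momM; first exact: (mom_pol hX (pm4 _ _ x hU)).
  exact: (mom_pol hX (pm4 _ _ x hV)).
have -> : \sum_(x : I4) Ex (fun w => m4 U x w * m4 V x w) =
          \sum_(x : I4) Ex (m4 U x) * Ex (m4 V x).
  by apply: eq_bigr => x _; apply: (pol_far hX JK); exact: pm4.
have bnd L W g : (forall i, lin L (W i)) ->
   \sum_i \sum_j Ex (fun w => W i w * W j w) ^+ 2 <= g ->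
   \sum_(x : I4) Ex (m4 W x) ^+ 2 <= 9 * g ^+ 2.
  move=> hW hg.
  pose a i j := Ex (fun w => W i w * W j w).
  have [s1 s2 s3] := sum4 (a := a) hg.
  apply: (@le_trans _ _ (\sum_(x : I4) 3 * ((a x.1.1 x.1.2 * a x.2.1 x.2.2) ^+ 2 +
     (a x.1.1 x.2.1 * a x.1.2 x.2.2) ^+ 2 + (a x.1.1 x.2.2 * a x.1.2 x.2.1) ^+ 2))).
    apply: ler_sum => x _.
    rewrite /m4 (isserlis hX (hW _) (hW _) (hW _) (hW _)) -!/(a _ _).
    move: (a x.1.1 x.1.2 * _) (a x.1.1 x.2.1 * _) (a x.1.1 x.2.2 * _) => u v t.
    by have := sqr_ge0 (u - v); have := sqr_ge0 (u - t); have := sqr_ge0 (v - t); nra.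
  rewrite -mulr_sumr !big_split/=; lra.
apply: sqr_le_le; first by rewrite !mulr_ge0.
apply: (le_trans (sum_CS _ _)).
apply: (le_trans (ler_pM _ _ (bnd _ _ _ hU hA) (bnd _ _ _ hV hB))).
- by apply: sumr_ge0 => x _; exact: sqr_ge0.
- by apply: sumr_ge0 => x _; exact: sqr_ge0.
- by rewrite le_eqVlt; apply/orP; left; apply/eqP; ring.
Qed.

Lemma gauss8_cst_ge0 : 0 <= gauss8_cst R.
Proof. by rewrite /gauss8_cst; apply: mulr_ge0; [exact: ler0n|rewrite mulr_ge0// expR_ge0]. Qed.

Let pow8 J (f1 f2 f3 f4 : T -> R) : lin J f1 -> lin J f2 -> lin J f3 -> lin J f4 ->
  Ex (fun w => (f1 w ^+ 2 * f2 w ^+ 2) * (f3 w ^+ 2 * f4 w ^+ 2)) <=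
  gauss8_cst R * ((Ex (fun w => f1 w ^+ 2) * Ex (fun w => f2 w ^+ 2)) *
     (Ex (fun w => f3 w ^+ 2) * Ex (fun w => f4 w ^+ 2))).
Proof.
move=> l1 l2 l3 l4.
have K0 := gauss8_cst_ge0.
have ss : Num.sqrt (gauss8_cst R) * Num.sqrt (gauss8_cst R) = gauss8_cst R by rewrite -expr2 sqr_sqrtr.
have q0 f : 0 <= Ex (fun w => f w ^+ 2) by apply: Ex_ge0 => w; exact: sqr_ge0.
have two f g : lin J f -> lin J g ->
  Ex (fun w => (f w ^+ 2 * g w ^+ 2) ^+ 2) <=
   gauss8_cst R * (Ex (fun w => f w ^+ 2) * Ex (fun w => g w ^+ 2)) ^+ 2.
  move=> lf lg.
  have -> : gauss8_cst R * (Ex (fun w => f w ^+ 2) * Ex (fun w => g w ^+ 2)) ^+ 2 =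
    (Num.sqrt (gauss8_cst R) * Ex (fun w => f w ^+ 2) ^+ 2) *
    (Num.sqrt (gauss8_cst R) * Ex (fun w => g w ^+ 2) ^+ 2).
    by rewrite -{1}ss; ring.
  have h8 h : lin J h -> Ex (fun w => (h w ^+ 2) ^+ 4) <=
       (Num.sqrt (gauss8_cst R) * Ex (fun w => h w ^+ 2) ^+ 2) ^+ 2.
    move=> lh; rewrite exprMn sqr_sqrtr// -exprM.
    apply: le_trans (lin_moment8 hX lh).
    by rewrite (Ex_ext _ (g := fun w => h w ^+ 8))// => w; rewrite -exprM.
  apply: Ex_sqM; rewrite ?h8//.
  - by apply: momX; exact: (mom_lin hX lf).
  - by apply: momX; exact: (mom_lin hX lg).
  - by rewrite mulr_ge0 ?sqrtr_ge0// sqr_ge0.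
  - by rewrite mulr_ge0 ?sqrtr_ge0// sqr_ge0.
have -> : gauss8_cst R * ((Ex (fun w => f1 w ^+ 2) * Ex (fun w => f2 w ^+ 2)) *
     (Ex (fun w => f3 w ^+ 2) * Ex (fun w => f4 w ^+ 2))) =
   (Num.sqrt (gauss8_cst R) * (Ex (fun w => f1 w ^+ 2) * Ex (fun w => f2 w ^+ 2))) *
   (Num.sqrt (gauss8_cst R) * (Ex (fun w => f3 w ^+ 2) * Ex (fun w => f4 w ^+ 2))).
  by rewrite -{1}ss; ring.
apply: Ex_CS_le.
- by apply: momM; apply: momX; [exact: (mom_lin hX l1)|exact: (mom_lin hX l2)].
- by apply: momM; apply: momX; [exact: (mom_lin hX l3)|exact: (mom_lin hX l4)].
- by rewrite !mulr_ge0 ?sqrtr_ge0.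
- by rewrite !mulr_ge0 ?sqrtr_ge0.
- by rewrite [leRHS]exprMn sqr_sqrtr// two.
- by rewrite [leRHS]exprMn sqr_sqrtr// two.
Qed.

Let norm8 J U t : (forall i, lin J (U i)) ->
  \sum_i Ex (fun w => U i w ^+ 2) <= t ->
  Ex (fun w => (\sum_i U i w ^+ 2) ^+ 4) <= gauss8_cst R * t ^+ 4.
Proof.
move=> hU ht.
pose I4 := (('I_p * 'I_p) * ('I_p * 'I_p))%type.
have mU i : mom (fun w => U i w ^+ 2) by apply: momX; exact: (mom_lin hX (hU i)).
rewrite (Ex_ext _ (fun w => sum_pow4 (fun i => U i w ^+ 2))).
rewrite Ex_sum; last by move=> x _; apply: momM; apply: momM.
pose a i := Ex (fun w => U i w ^+ 2).
have S0 : 0 <= \sum_i a i.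
  by apply: sumr_ge0 => i _; apply: Ex_ge0 => w; exact: sqr_ge0.
apply: (@le_trans _ _ (gauss8_cst R * (\sum_i a i) ^+ 4)).
  rewrite sum_pow4 mulr_sumr; apply: ler_sum => x _.
  exact: (pow8 (hU _) (hU _) (hU _) (hU _)).
rewrite ler_wpM2l ?gauss8_cst_ge0//.
by rewrite lerXn2r// nnegrE// (le_trans S0).
Qed.

(** Without independence the scalar product is bounded by the product of the norms. The moments of
    the norms are governed by traces instead of Frobenius norms, and this is where the dimension
    will enter. *)
Lemma dot4_dep J U V t : (forall i, lin J (U i)) -> (forall i, lin J (V i)) ->
  \sum_i Ex (fun w => U i w ^+ 2) <= t -> \sum_i Ex (fun w => V i w ^+ 2) <= t ->
  Ex (fun w => dot U V w ^+ 4) <= gauss8_cst R * t ^+ 4.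
Proof.
move=> hU hV hu hv.
have mU i : mom (U i) by exact: (mom_lin hX (hU i)).
have mV i : mom (V i) by exact: (mom_lin hX (hV i)).
have mUU : mom (fun w => (\sum_i U i w ^+ 2) ^+ 4).
  by apply: momX; apply: mom_sum => i _; exact: momX.
have mVV : mom (fun w => (\sum_i V i w ^+ 2) ^+ 4).
  by apply: momX; apply: mom_sum => i _; exact: momX.
apply: (@le_trans _ _ (Ex (fun w => 2^-1 * ((\sum_i U i w ^+ 2) ^+ 4 + (\sum_i V i w ^+ 2) ^+ 4)))).
  apply: Ex_le.
  - by apply: momX; apply: mom_sum => i _; exact: momM.
  - by apply: momZ; exact: momD.
  move=> w; have := sum_CS (fun i => U i w) (fun i => V i w).
  rewrite -/(dot U V w).
  set A := \sum_i _; set B := \sum_i _ => h.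
  have h0 : 0 <= dot U V w ^+ 2 by exact: sqr_ge0.
  have h1 : dot U V w ^+ 4 <= (A * B) ^+ 2.
    by rewrite (exprM _ 2 2) lerXn2r// nnegrE// (le_trans h0).
  apply: (le_trans h1); rewrite (exprM A 2 2) (exprM B 2 2) exprMn.
  by have := sqr_ge0 (A ^+ 2 - B ^+ 2); nra.
rewrite ExZ; last exact: momD.
rewrite ExD//; have := norm8 hU hu; have := norm8 hV hv; lra.
Qed.

End Dot.

(** * Counting *)

Section Counting.
Variable n : nat.

Definition obs_at (i : 'I_n) : int := (i.+1)%:Z.
Local Notation tm := obs_at.

Lemma sum_obs (V : nmodType) (F : nat -> V) :
  \sum_(1 <= t < n.+1) F t = \sum_(i < n) F i.+1.
Proof. by rewrite big_add1 big_mkord. Qed.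

Definition nearb (r : nat) (x y : int) : bool := `|x - y| <= r%:Z.

Lemma nearbC r x y : nearb r x y = nearb r y x.
Proof. by rewrite /nearb distrC. Qed.

Lemma count_near_nat r (x : int) : (\sum_(i < n) nearb r (tm i) x <= r.*2.+1)%N.
Proof.
rewrite -[leqRHS]card_ord -big_mkcond/= sum1_card.
pose f (i : 'I_n) : 'I_r.*2.+1 := inord (absz (tm i - (x - r%:Z))%R).
rewrite -(card_in_imset (f := f)); first exact: max_card.
move=> i j; rewrite !unfold_in /nearb /f => hi hj.
move=> /(congr1 val); rewrite /= !inordK; rewrite ?ltnS; try by rewrite /tm in hi hj *; lia.
by move=> h; apply/val_inj => /=; rewrite /tm in hi hj h *; lia.
Qed.

Lemma count_near (R : numDomainType) r (x : int) :
  \sum_(i < n) (nearb r (tm i) x)%:R <= (r.*2.+1)%:R :> R.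
Proof. by rewrite -natr_sum ler_nat count_near_nat. Qed.

Lemma count_near_r (R : numDomainType) r (x : int) :
  \sum_(i < n) (nearb r x (tm i))%:R <= (r.*2.+1)%:R :> R.
Proof. by under eq_bigr do rewrite nearbC; exact: count_near. Qed.

End Counting.

(** * Weighted numbers of linked pairs *)

Section LinkSums.
Variables (R : realType) (n r : nat).
Local Notation tm := (@obs_at n).
Local Notation m := ((r.*2.+1)%:R : R).

Lemma boolR_and (b c : bool) : ((b && c)%:R : R) = b%:R * c%:R.
Proof. by case: b; rewrite ?mul1r ?mul0r. Qed.

(** One of the two matchings, straight or crossed, pairs the indices within distance r. If neither
    does, one of the four indices is far from both indices of the other pair. *)
Definition link2 (x y : 'I_n * 'I_n) : bool :=
  (nearb r (tm x.1) (tm y.1) && nearb r (tm x.2) (tm y.2)) ||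
  (nearb r (tm x.1) (tm y.2) && nearb r (tm x.2) (tm y.1)).

Lemma sum_link2 : \sum_x \sum_y (link2 x y)%:R <= 2 * (n%:R * m) ^+ 2 :> R.
Proof.
have m0 : 0 <= m by exact: ler0n.
have row (x : 'I_n * 'I_n) : \sum_y (link2 x y)%:R <= 2 * m ^+ 2 :> R.
  apply: (@le_trans _ _ (\sum_(y : 'I_n * 'I_n)
     ((nearb r (tm x.1) (tm y.1))%:R * (nearb r (tm x.2) (tm y.2))%:R +
      (nearb r (tm x.2) (tm y.1))%:R * (nearb r (tm x.1) (tm y.2))%:R))).
    apply: ler_sum => y _; rewrite -!boolR_and -natrD ler_nat /link2.
    rewrite [nearb r (tm x.2) (tm y.1) && _]andbC.
    by case: (_ && _); case: (_ && _).
  have prod (u v : int) : \sum_(y : 'I_n * 'I_n)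
     ((nearb r u (tm y.1))%:R * (nearb r v (tm y.2))%:R) <= m ^+ 2.
    rewrite -(pair_big xpredT xpredT (fun i j => (nearb r u (tm i))%:R * (nearb r v (tm j))%:R))/=.
    rewrite -(eq_bigr _ (fun i _ => mulr_sumr _ _ _ _)) -mulr_suml expr2.
    by apply: ler_pM; rewrite ?count_near_r// sumr_ge0.
  by rewrite big_split/= mulr_natl mulr2n lerD.
apply: (le_trans (ler_sum _ (fun x _ => row x))).
rewrite sumr_const card_prod card_ord -[leLHS]mulr_natr natrM.
by rewrite le_eqVlt; apply/orP; left; apply/eqP; ring.
Qed.

Lemma sum_near1 (c : 'I_n -> R) (C : R) : (forall i, `|c i| <= C) ->
  \sum_i \sum_j `|c i| * `|c j| * (nearb r (tm i) (tm j))%:R <= C ^+ 2 * (n%:R * m).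
Proof.
move=> hC.
apply: (@le_trans _ _ (\sum_(i < n) C ^+ 2 * m)); last first.
  by rewrite sumr_const card_ord -[leLHS]mulr_natl mulrCA.
apply: ler_sum => i _.
apply: (@le_trans _ _ (\sum_(j < n) C ^+ 2 * (nearb r (tm i) (tm j))%:R)).
  apply: ler_sum => j _; rewrite ler_wpM2r// expr2; exact: ler_pM.
by rewrite -mulr_sumr ler_wpM2l ?sqr_ge0// count_near_r.
Qed.

Lemma sum_pair2 (c : 'I_n * 'I_n -> R) (C : R) : (forall x, `|c x| <= C) ->
  \sum_x \sum_y `|c x| * `|c y| * (link2 x y)%:R <= C ^+ 2 * (2 * (n%:R * m) ^+ 2).
Proof.
move=> hC.
apply: (@le_trans _ _ (C ^+ 2 * \sum_x \sum_y (link2 x y)%:R)); last first.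
  by rewrite ler_wpM2l ?sqr_ge0// sum_link2.
rewrite mulr_sumr; apply: ler_sum => x _; rewrite mulr_sumr; apply: ler_sum => y _.
by rewrite ler_wpM2r// expr2; exact: ler_pM.
Qed.

(** The weights confine each pair to a band of width k about the diagonal: the first index of x is
    free, and the remaining three range over windows of radii k, r and k. *)
Lemma sum_near_pair (C : R) k (c : 'I_n * 'I_n -> R) :
  (forall x, `|c x| <= C * (nearb k (tm x.1) (tm x.2))%:R) ->
  \sum_x \sum_y `|c x| * `|c y| * (nearb r (tm x.1) (tm y.1))%:R
    <= C ^+ 2 * (n%:R * (k.*2.+1)%:R ^+ 2 * m).
Proof.
move=> hC.
set K := (k.*2.+1)%:R : R.
have C2 : 0 <= C ^+ 2 by exact: sqr_ge0.
apply: (@le_trans _ _ (\sum_(x : 'I_n * 'I_n) \sum_(y : 'I_n * 'I_n)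
   C ^+ 2 * ((nearb k (tm x.1) (tm x.2))%:R *
      ((nearb r (tm x.1) (tm y.1))%:R * (nearb k (tm y.1) (tm y.2))%:R)))).
  apply: ler_sum => x _; apply: ler_sum => y _.
  have -> : C ^+ 2 * ((nearb k (tm x.1) (tm x.2))%:R *
      ((nearb r (tm x.1) (tm y.1))%:R * (nearb k (tm y.1) (tm y.2))%:R)) =
    (C * (nearb k (tm x.1) (tm x.2))%:R) * (C * (nearb k (tm y.1) (tm y.2))%:R) *
      (nearb r (tm x.1) (tm y.1))%:R by ring.
  by rewrite ler_wpM2r//; apply: ler_pM.
have inner (u : int) : \sum_(y : 'I_n * 'I_n)
    ((nearb r u (tm y.1))%:R * (nearb k (tm y.1) (tm y.2))%:R) <= K * m.
  rewrite -(pair_big xpredT xpredT (fun i j => (nearb r u (tm i))%:R * (nearb k (tm i) (tm j))%:R))/=.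
  apply: (@le_trans _ _ (\sum_(i < n) (nearb r u (tm i))%:R * K)).
    apply: ler_sum => i _; rewrite -mulr_sumr ler_wpM2l//; exact: count_near_r.
  by rewrite -mulr_suml mulrC ler_wpM2l// count_near_r.
apply: (@le_trans _ _ (\sum_(x : 'I_n * 'I_n) C ^+ 2 * ((nearb k (tm x.1) (tm x.2))%:R * (K * m)))).
  apply: ler_sum => x _; rewrite -mulr_sumr ler_wpM2l// -mulr_sumr ler_wpM2l//.
rewrite -mulr_sumr ler_wpM2l// -mulr_suml.
rewrite -(pair_big xpredT xpredT (fun i j => (nearb k (tm i) (tm j))%:R))/=.
have : \sum_(i < n) \sum_(j < n) (nearb k (tm i) (tm j))%:R <= n%:R * K.
  apply: (@le_trans _ _ (\sum_(i < n) K)).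
    by apply: ler_sum => i _; exact: count_near_r.
  by rewrite sumr_const card_ord mulr_natl.
have Km : 0 <= K * m by rewrite mulr_ge0.
move=> h; apply: (le_trans (ler_wpM2r Km h)).
by rewrite le_eqVlt; apply/orP; left; apply/eqP; ring.
Qed.

End LinkSums.

Lemma trace4 (R : comNzRingType) (p : nat) (A B C D : 'M[R]_p) :
  \tr (A *m B *m C *m D) = \sum_i \sum_j \sum_k \sum_l A i j * B j k * C k l * D l i.
Proof.
rewrite /mxtrace; apply: eq_bigr => i _.
rewrite mxE.
under eq_bigr => l _ do rewrite mxE mulr_suml.
under eq_bigr => l _ do under eq_bigr => k _ do rewrite mxE !mulr_suml.
rewrite exchange_big /=.
under eq_bigr => k _ do rewrite exchange_big /=.
by rewrite exchange_big.
Qed.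

Lemma trace2 (R : comNzRingType) (p : nat) (A B : 'M[R]_p) :
  \tr (A *m B) = \sum_i \sum_j A i j * B j i.
Proof. by rewrite /mxtrace; apply: eq_bigr => i _; rewrite mxE. Qed.

(** * Autocovariances and moments of quadratic expressions *)

Section GammaFacts.
Context (R : realType) (d : measure_display) (T : measurableType d).
Variable P : probability T R.
Local Notation Ex := (Expect P).
Local Notation mom := (mom P).
Variables (p : nat) (X : int -> T -> 'cV[R]_p) (M : nat) (mu : 'cV[R]_p).
Variable Gamma : int -> 'M[R]_p.
Hypothesis hX : gaussian_mdep_process P X M mu Gamma.
Local Notation Z := (centred X mu).
Local Notation pol := (pol X mu).
Local Notation lin := (lin X mu).
Implicit Types (J K : set int).

Lemma Ex_ZZ_far t s i j : M%:Z < `|t - s| -> Ex (fun w => Z t i w * Z s j w) = 0.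
Proof.
move=> h; rewrite (pol_far hX (J := [set t]) (K := [set s])).
- by rewrite (Ex_Z hX) mul0r.
- by move=> u v -> ->.
- exact: pol_Z.
- exact: pol_Z.
Qed.

Lemma Gamma_far h : M%:Z < `|h| -> Gamma h = 0.
Proof.
move=> hh; apply/matrixP => i j; rewrite mxE.
have := Ex_ZZ hX 0 h i j; rewrite subr0 => <-.
by apply: Ex_ZZ_far; rewrite sub0r normrN.
Qed.

Lemma GammaN h i j : Gamma (- h) i j = Gamma h j i.
Proof.
have := Ex_ZZ hX h 0 i j; have := Ex_ZZ hX 0 h j i.
by rewrite sub0r subr0 => <- <-; apply: Ex_ext => w; rewrite mulrC.
Qed.

Lemma lin_ZT t i : lin setT (Z t i).
Proof. exact: lin_Z. Qed.

Lemma Ex_Z4 t1 t2 t3 t4 i1 i2 i3 i4 :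
  Ex (fun w => (Z t1 i1 w * Z t2 i2 w) * (Z t3 i3 w * Z t4 i4 w)) =
  Gamma (t2 - t1) i1 i2 * Gamma (t4 - t3) i3 i4
  + Gamma (t3 - t1) i1 i3 * Gamma (t4 - t2) i2 i4
  + Gamma (t4 - t1) i1 i4 * Gamma (t3 - t2) i2 i3.
Proof.
rewrite (isserlis hX (lin_ZT _ _) (lin_ZT _ _) (lin_ZT _ _) (lin_ZT _ _)).
by rewrite !(Ex_ZZ hX).
Qed.

Lemma mom_ZZ t s i j : mom (fun w => Z t i w * Z s j w).
Proof. by apply: momM; exact: (mom_Z hX). Qed.

Definition dotZ (t s : int) : T -> R := dot (Z t) (Z s).
Local Notation dZ := dotZ.

Lemma mom_dZ t s : mom (dZ t s).
Proof. by apply: mom_sum => i _; exact: mom_ZZ. Qed.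

Lemma pol_dZ J t s : J t -> J s -> pol J (dZ t s).
Proof. by move=> Jt Js; apply: pol_dot => i; exact: pol_Z. Qed.

Lemma dZC t s w : dZ t s w = dZ s t w.
Proof. by apply: eq_bigr => i _; rewrite mulrC. Qed.

(** The form Z_(t+a)' B Z_t. For B = Gamma(b) it is the conditional expectation of Z_(t+a)'Z_s
    Z_(s+b)'Z_t given Z_t and Z_(t+a), when s and s + b are far from both times. *)
Definition Zquad (a : int) (B : 'M[R]_p) (t : int) (w : T) : R :=
  \sum_i \sum_j B i j * (Z (t + a) i w * Z t j w).
Local Notation quad := Zquad.

Lemma pol_quad J a B t : J t -> J (t + a) -> pol J (quad a B t).
Proof.
move=> Jt Ja; apply: pol_sum => i _; apply: pol_sum => j _.
by apply: polZ; apply: polM; exact: pol_Z.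
Qed.

Lemma mom_quad a B t : mom (quad a B t).
Proof. by apply: (mom_pol hX (J := setT)); exact: pol_quad. Qed.

Lemma Ex_quad a B t : Ex (quad a B t) = \tr (Gamma a *m B).
Proof.
rewrite Ex_sum; last by move=> i _; apply: mom_sum => j _; apply: momZ; exact: mom_ZZ.
rewrite trace2 exchange_big/=; apply: eq_bigr => i _.
rewrite Ex_sum; last by move=> j _; apply: momZ; exact: mom_ZZ.
apply: eq_bigr => j _; rewrite ExZ ?(Ex_ZZ hX); last exact: mom_ZZ.
by rewrite opprD addrA subrr add0r GammaN mulrC.
Qed.

(** Isserlis' formula: the pairing inside each copy of the form cancels against the squared mean,
    and the two cross pairings give the two fourth-order traces. *)
Lemma Ex_quad2 a b t :
  Ex (fun w => (quad a (Gamma b) t w - \tr (Gamma a *m Gamma b)) ^+ 2) =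
  \tr (Gamma (- b) *m Gamma 0 *m Gamma b *m Gamma 0) +
  \tr (Gamma b *m Gamma a *m Gamma b *m Gamma a).
Proof.
set B := Gamma b; set tau := \tr _.
have mq := mom_quad a B t.
have -> : Ex (fun w => (quad a B t w - tau) ^+ 2) = Ex (fun w => quad a B t w * quad a B t w) - tau * tau.
  rewrite (Ex_ext _ (g := fun w => quad a B t w * quad a B t w + ((- 2 * tau) * quad a B t w + tau * tau))).
    rewrite ExD; [|exact: momM|apply: momD; [exact: momZ|exact: mom_cst]].
    by rewrite ExD ?ExZ ?Ex_cst ?Ex_quad -/tau//; first [exact: mom_cst | exact: momZ | ring].
  by move=> w; ring.
rewrite (Ex_ext _ (g := fun w => \sum_i \sum_j \sum_k \sum_l
   (B i j * B k l) * ((Z (t + a) i w * Z t j w) * (Z (t + a) k w * Z t l w)))); last first.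
  move=> w; rewrite /quad mulr_suml; apply: eq_bigr => i _.
  rewrite mulr_suml; apply: eq_bigr => j _.
  rewrite mulr_sumr; apply: eq_bigr => k _.
  by rewrite mulr_sumr; apply: eq_bigr => l _; rewrite mulrACA.
have m4 i j k l : mom (fun w => (B i j * B k l) * ((Z (t + a) i w * Z t j w) * (Z (t + a) k w * Z t l w))).
  by apply: momZ; apply: momM; exact: mom_ZZ.
rewrite Ex_sum; last first.
  by move=> i _; apply: mom_sum => j _; apply: mom_sum => k _; apply: mom_sum => l _.
have tt : tau * tau = \sum_i \sum_j \sum_k \sum_l
    (B i j * B k l) * (Gamma (- a) i j * Gamma (- a) k l).
  rewrite {1}/tau trace2 exchange_big/= mulr_suml; apply: eq_bigr => i _.
  rewrite mulr_suml; apply: eq_bigr => j _.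
  rewrite /tau trace2 exchange_big/= mulr_sumr; apply: eq_bigr => k _.
  by rewrite mulr_sumr; apply: eq_bigr => l _; rewrite !GammaN -/B; ring.
have t1 : \tr (Gamma (- b) *m Gamma 0 *m Gamma b *m Gamma 0) =
   \sum_i \sum_j \sum_k \sum_l (B i j * B k l) * (Gamma 0 i k * Gamma 0 j l).
  rewrite trace4 exchange_big /=; apply: eq_bigr => i _; apply: eq_bigr => j _.
  apply: eq_bigr => k _; apply: eq_bigr => l _.
  by rewrite GammaN -/B -[in Gamma 0 l j]oppr0 GammaN; ring.
have t2 : \tr (Gamma b *m Gamma a *m Gamma b *m Gamma a) =
   \sum_i \sum_j \sum_k \sum_l (B i j * B k l) * (Gamma (- a) i l * Gamma a j k).
  rewrite trace4; apply: eq_bigr => i _; apply: eq_bigr => j _.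
  by apply: eq_bigr => k _; apply: eq_bigr => l _; rewrite GammaN -/B; ring.
rewrite tt t1 t2 -sumrB -!big_split; apply: eq_bigr => i _ /=.
rewrite Ex_sum; last by move=> j _; apply: mom_sum => k _; apply: mom_sum => l _.
rewrite -sumrB -!big_split; apply: eq_bigr => j _ /=.
rewrite Ex_sum; last by move=> k _; apply: mom_sum => l _.
rewrite -sumrB -!big_split; apply: eq_bigr => k _ /=.
rewrite Ex_sum// -sumrB -!big_split; apply: eq_bigr => l _ /=.
rewrite ExZ; last by apply: momM; exact: mom_ZZ.
rewrite Ex_Z4 !subrr.
have -> : t - (t + a) = - a by ring.
have -> : t + a - t = a by ring.
by ring.
Qed.

(** The distance conditions of A(a,b) are made for this: pairing t + a with s + b gives zero by the
    first one, and pairing t + a with s, s + b with t gives zero because one of these two distances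
    exceeds M. Only the pairing of t + a with t and of s with s + b survives. *)
Lemma Ex_dZdZ t s a b : `|a| <= M%:Z -> `|b| <= M%:Z ->
  M%:Z < `|t + a - s - b| -> M%:Z < `|t - s| ->
  Ex (fun w => dZ (t + a) s w * dZ (s + b) t w) = \tr (Gamma a *m Gamma b).
Proof.
move=> ha hb h1 h2.
rewrite (Ex_ext _ (g := fun w => \sum_i \sum_j
   (Z (t + a) i w * Z s i w) * (Z (s + b) j w * Z t j w))); last first.
  move=> w; rewrite /dZ /dot mulr_suml; apply: eq_bigr => i _.
  by rewrite mulr_sumr.
rewrite Ex_sum; last by move=> i _; apply: mom_sum => j _; apply: momM; exact: mom_ZZ.
rewrite trace2 exchange_big/=; apply: eq_bigr => i _.
rewrite Ex_sum; last by move=> j _; apply: momM; exact: mom_ZZ.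
apply: eq_bigr => j _; rewrite Ex_Z4.
have -> : t - (t + a) = - a by ring.
have -> : s + b - s = b by ring.
rewrite (@Gamma_far (s + b - (t + a))); last by lia.
rewrite mxE mul0r addr0 GammaN.
have [h3|h3] : M%:Z < `|s - (t + a)| \/ M%:Z < `|t - (s + b)| by lia.
  by rewrite (Gamma_far h3) mxE mul0r add0r.
by rewrite (Gamma_far h3) [X in _ * X + _]mxE mulr0 add0r.
Qed.

End GammaFacts.

(** * The trace estimators *)

Section CardBounds.
Variables (R : realType) (n M : nat).
Local Notation tm := (@obs_at n).
Local Notation m1 := (M.+1%:R : R).
Local Notation N := (n%:R : R).

Lemma in_B_sym a b t s i : in_B n M a b t s i = in_B n M b a s t i.
Proof. by rewrite /in_B /obs_time; lia. Qed.

Lemma obs_tm (i : 'I_n) : obs_time n (tm i).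
Proof. by rewrite /obs_time /obs_at; have := ltn_ord i; lia. Qed.

Lemma dbl_le : ((M.*2.+1)%:R : R) <= 2 * m1.
Proof. by rewrite -natrM ler_nat; lia. Qed.

(** A pair outside A(a,b) has t or s within M of 1 or n, or s within M of t or of t + a - b. Each of
    these six bands has at most 2(M + 1) n pairs. *)
Lemma bad_A_count (a b : int) : `|a| <= M%:Z -> `|b| <= M%:Z ->
  \sum_(x : 'I_n * 'I_n) (~~ in_A n M a b (tm x.1) (tm x.2))%:R <= 12 * m1 * N.
Proof.
move=> ha hb.
pose k (x y : int) : R := (nearb M x y)%:R.
apply: (@le_trans _ _ (\sum_(i < n) \sum_(j < n)
  (k (tm i) n%:Z + k (tm i) 1 + k (tm j) n%:Z + k (tm j) 1
   + k (tm j) (tm i) + k (tm j) (tm i + a - b)))).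
  rewrite -(pair_big xpredT xpredT (fun i j => (~~ in_A n M a b (tm i) (tm j))%:R))/=.
  apply: ler_sum => i _; apply: ler_sum => j _.
  rewrite /k -!natrD ler_nat.
  case: (boolP (in_A _ _ _ _ _ _)) => //= h.
  have : [|| nearb M (tm i) n%:Z, nearb M (tm i) 1, nearb M (tm j) n%:Z, nearb M (tm j) 1,
     nearb M (tm j) (tm i) | nearb M (tm j) (tm i + a - b)].
    move: (tm i) (tm j) (obs_tm i) (obs_tm j) h => t s.
    by rewrite /in_A /obs_time /nearb; lia.
  by do 6 case: (nearb _ _ _) => //.
have c x : \sum_(i < n) k (tm i) x <= 2 * m1.
  by apply: le_trans dbl_le; exact: count_near.
apply: (@le_trans _ _ (\sum_(i < n) (N * k (tm i) n%:Z + N * k (tm i) 1 + 2 * m1 + 2 * m1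
   + 2 * m1 + 2 * m1))).
  apply: ler_sum => i _; rewrite !big_split /= !sumr_const card_ord.
  rewrite -[k (tm i) n%:Z *+ n]mulr_natl -[k (tm i) 1 *+ n]mulr_natl.
  by rewrite !lerD// c.
rewrite !big_split /= -!mulr_sumr !sumr_const card_ord -[m1 *+ n]mulr_natl.
have := ler_wpM2l (ler0n R n) (c n%:Z); have := ler_wpM2l (ler0n R n) (c 1).
lra.
Qed.

(** A numerical margin, valid for large n because M^8 = O(n); it absorbs later constants such as 168
    (M + 1)/n <= 2. *)
Hypothesis hn : (100 * M.+1 <= n)%N.

Lemma m1_le : 100 * m1 <= N.
Proof. by rewrite -natrM ler_nat. Qed.

Lemma m1_ge1 : 1 <= m1.
Proof. by rewrite ler1n. Qed.

Lemma N_gt0 : 0 < N.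
Proof. by have := m1_le; have := m1_ge1; lra. Qed.

Lemma card_AE (a b : int) :
  (card_A n M a b)%:R = \sum_(x : 'I_n * 'I_n) (in_A n M a b (tm x.1) (tm x.2))%:R :> R.
Proof.
rewrite /card_A natr_sum sum_obs.
rewrite -(pair_big xpredT xpredT (fun i j => (in_A n M a b (tm i) (tm j))%:R))/=.
by apply: eq_bigr => i _; rewrite natr_sum sum_obs.
Qed.

Lemma card_A_ge (a b : int) : `|a| <= M%:Z -> `|b| <= M%:Z ->
  N ^+ 2 <= 2 * (card_A n M a b)%:R.
Proof.
move=> ha hb; have := bad_A_count ha hb.
have : \sum_(x : 'I_n * 'I_n) (1 : R) = N ^+ 2.
  by rewrite sumr_const card_prod card_ord natrM expr2.
have -> : \sum_(x : 'I_n * 'I_n) (1 : R) = (card_A n M a b)%:R +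
   \sum_(x : 'I_n * 'I_n) (~~ in_A n M a b (tm x.1) (tm x.2))%:R.
  by rewrite card_AE -big_split; apply: eq_bigr => x _ /=; case: in_A; rewrite ?addr0 ?add0r.
have := m1_le; have := m1_ge1; move=> h1 h2 e h3.
have : 24 * m1 * N <= N * N by rewrite ler_wpM2r//; lra.
rewrite -expr2; lra.
Qed.

Lemma card_BE (a b t s : int) :
  (card_B n M a b t s)%:R = \sum_(i < n) (in_B n M a b t s (tm i))%:R :> R.
Proof. by rewrite /card_B natr_sum sum_obs. Qed.

Lemma card_B_ge (a b t s : int) : N <= 2 * (card_B n M a b t s)%:R.
Proof.
have : \sum_(x < n) (1 : R) = N by rewrite sumr_const card_ord.
have -> : \sum_(x < n) (1 : R) = (card_B n M a b t s)%:R +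
   \sum_(x < n) (~~ in_B n M a b t s (tm x))%:R.
  by rewrite card_BE -big_split; apply: eq_bigr => x _ /=; case: in_B; rewrite ?addr0 ?add0r.
have : \sum_(x < n) (~~ in_B n M a b t s (tm x))%:R <= 8 * m1 :> R.
  pose k (x y : int) : R := (nearb M x y)%:R.
  apply: (@le_trans _ _ (\sum_(i < n) (k (tm i) t + k (tm i) s + k (tm i) (t + a) + k (tm i) (s + b)))).
    apply: ler_sum => i _; rewrite /k -!natrD ler_nat.
    case: (boolP (in_B _ _ _ _ _ _ _)) => //= h.
    have : [|| nearb M (tm i) t, nearb M (tm i) s, nearb M (tm i) (t + a) | nearb M (tm i) (s + b)].
      move: (tm i) (obs_tm i) h => v.
      by rewrite /in_B /obs_time /nearb; lia.
    by do 4 case: (nearb _ _ _) => //.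
  rewrite !big_split/=.
  have c x : \sum_(i < n) k (tm i) x <= 2 * m1.
    by apply: le_trans dbl_le; exact: count_near.
  have := c t; have := c s; have := c (t + a); have := c (s + b); lra.
have := m1_le; have := m1_ge1; lra.
Qed.

Lemma card_A_gt0 (a b : int) : `|a| <= M%:Z -> `|b| <= M%:Z -> 0 < (card_A n M a b)%:R :> R.
Proof.
move=> ha hb; have := card_A_ge ha hb; have := N_gt0.
move=> h h'; have h2 : 0 < N ^+ 2 by rewrite exprn_gt0.
lra.
Qed.

Lemma card_B_gt0 (a b t s : int) : 0 < (card_B n M a b t s)%:R :> R.
Proof. by have := card_B_ge a b t s; have := N_gt0; lra. Qed.

Lemma card_Ainv (a b : int) : `|a| <= M%:Z -> `|b| <= M%:Z ->
  (card_A n M a b)%:R^-1 <= 2 / N ^+ 2.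
Proof.
move=> ha hb; rewrite -[leLHS]mul1r ler_pdivrMr ?card_A_gt0//.
rewrite mulrAC ler_pdivlMr ?exprn_gt0 ?N_gt0// mul1r; exact: card_A_ge.
Qed.

Lemma card_Binv (a b t s : int) : (card_B n M a b t s)%:R^-1 <= 2 / N.
Proof.
rewrite -[leLHS]mul1r ler_pdivrMr ?card_B_gt0//.
rewrite mulrAC ler_pdivlMr ?N_gt0// mul1r; exact: card_B_ge.
Qed.

End CardBounds.

Lemma dotvE (R : realType) (p : nat) (x y : 'cV[R]_p) :
  dotv x y = \sum_i x i 0 * y i 0.
Proof. by rewrite /dotv mxE; apply: eq_bigr => i _; rewrite mxE. Qed.

Lemma subcolE (R : realType) (p : nat) (x y : 'cV[R]_p) i :
  (x - y) i 0 = x i 0 - y i 0.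
Proof. by rewrite !mxE. Qed.

(** * Splitting the summands of a trace estimator *)

Section Terms.
Context (R : realType) (d : measure_display) (T : measurableType d).
Variable P : probability T R.
Local Notation mom := (mom P).
Variables (p : nat) (X : int -> T -> 'cV[R]_p) (M : nat) (mu : 'cV[R]_p).
Variable Gamma : int -> 'M[R]_p.
Hypothesis hX : gaussian_mdep_process P X M mu Gamma.
Local Notation Z := (centred X mu).
Local Notation lin := (lin X mu).
Local Notation dZ := (dotZ X mu).
Implicit Types (J K : set int).
Variable n : nat.
Hypothesis hn : (100 * M.+1 <= n)%N.
Variables (g L : R).
Hypothesis hg : forall h, `|h| <= M%:Z -> \sum_i \sum_j Gamma h i j ^+ 2 <= g.
Hypothesis hL : dotv mu (Gamma 0 *m mu) <= L.
Local Notation tm := (@obs_at n).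

Definition Zbar_star a b t s (i : 'I_p) (w : T) : R :=
  \sum_(u < n) ((card_B n M a b t s)%:R^-1 * (in_B n M a b t s (tm u))%:R) * Z (tm u) i w.
Local Notation zb := Zbar_star.

Definition main_factor a t s : T -> R := dZ (t + a) s.
Local Notation A0 := main_factor.
Definition mean_factor a b t s : T -> R := dot (zb a b t s) (Z s).
Local Notation A1 := mean_factor.
Definition mu_factor a b t s (w : T) : R := \sum_i (Z (t + a) i w - zb a b t s i w) * mu i 0.
Local Notation A2 := mu_factor.
(** The expansion of (Z_(t+a) - zb)'(Z_s + mu), where [zb] is the centred mean over B(t,s): mu
    cancels exactly in the first factor and survives only through a linear form. *)
Definition tr_hat_term a b t s (w : T) : R := A0 a t s w - A1 a b t s w + A2 a b t s w.
Local Notation FF := tr_hat_term.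

(** B(t,s) is unchanged when (t,a) and (s,b) are exchanged, so the two factors of a summand are
    instances of one expression. *)
Lemma zb_sym a b t s : zb a b t s = zb b a s t.
Proof.
rewrite /zb; apply/funext => i; apply/funext => w; apply: eq_bigr => u _.
rewrite in_B_sym; congr (_^-1 * _ * _); congr (_%:R).
by rewrite /card_B; apply: eq_bigr => v _; rewrite in_B_sym.
Qed.

Lemma sum_zb_coef a b t s :
  \sum_(u < n) `|(card_B n M a b t s)%:R^-1 * (in_B n M a b t s (tm u))%:R| = 1 :> R.
Proof.
under eq_bigr do rewrite ger0_norm ?mulr_ge0 ?invr_ge0//.
by rewrite -mulr_sumr -card_BE mulVf// gt_eqF// card_B_gt0.
Qed.

Lemma lin_zb a b t s i : lin [set u | in_B n M a b t s u] (zb a b t s i).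
Proof.
apply: lin_sum => u _.
have [h|h] := boolP (in_B n M a b t s (tm u)).
  by apply: linZ; exact: lin_Z.
exists [::]; split => // w.
by rewrite /Zcomb big_nil mulr0 mul0r.
Qed.

Lemma lin_zbT a b t s i : lin setT (zb a b t s i).
Proof. exact: lin_sub (lin_zb a b t s i). Qed.

Lemma mom_zb a b t s i : mom (zb a b t s i).
Proof. exact: (mom_lin hX (lin_zb a b t s i)). Qed.

Lemma mom_A1 a b t s : mom (A1 a b t s).
Proof. by apply: mom_sum => i _; apply: momM; [exact: mom_zb|exact: (mom_Z hX)]. Qed.

Lemma lin_A2 a b t s : lin setT (A2 a b t s).
Proof.
apply: (lin_ext (f := fun w => \sum_i (mu i 0) * (Z (t + a) i w + (-1) * zb a b t s i w))).
  by move=> w; apply: eq_bigr => i _; rewrite mulN1r mulrC.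
apply: lin_sum => i _; apply: linZ; apply: linD; first exact: lin_Z.
by apply: linZ; exact: lin_zbT.
Qed.

Lemma mom_A2 a b t s : mom (A2 a b t s).
Proof. exact: (mom_lin hX (lin_A2 a b t s)). Qed.

(** B(t,s) is nonempty under the margin on n, so the weights sum to 1 and mu comes out exactly. *)
Lemma mean_starE a b t s w i :
  mean_star n M (fun t => X t w) a b t s i 0 = zb a b t s i w + mu i 0.
Proof.
rewrite /mean_star mxE big_mkcond/= sum_obs summxE.
rewrite [mu i 0](_ : _ = (card_B n M a b t s)%:R^-1 * \sum_(u < n) (in_B n M a b t s (tm u))%:R * mu i 0); last first.
  by rewrite -mulr_suml -card_BE mulrA mulVf ?mul1r// gt_eqF// card_B_gt0.
rewrite /zb; under [X in _ = X + _]eq_bigr do rewrite -mulrA.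
rewrite -mulr_sumr -mulrDr -big_split; congr (_ * _); apply: eq_bigr => u _ /=.
rewrite -/(tm u) -mulrDr /centred subrK.
by case: in_B; rewrite ?mul1r// mxE mul0r.
Qed.

Lemma tr_hatE a b w : tr_hat n M (fun t => X t w) a b =
  \sum_(x : 'I_n * 'I_n) ((card_A n M a b)%:R^-1 * (in_A n M a b (tm x.1) (tm x.2))%:R)
     * (FF a b (tm x.1) (tm x.2) w * FF b a (tm x.2) (tm x.1) w).
Proof.
have E a' b' t s : dotv (X (t + a') w - mean_star n M (fun t => X t w) a' b' t s) (X s w)
     = FF a' b' t s w.
  rewrite dotvE /FF /A0 /A1 /A2 /dotZ /dot -sumrB -big_split.
  by apply: eq_bigr => i _ /=; rewrite subcolE mean_starE /centred; ring.
rewrite /tr_hat sum_obs.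
rewrite -(pair_big xpredT xpredT (fun i j => ((card_A n M a b)%:R^-1 * (in_A n M a b (tm i) (tm j))%:R)
     * (FF a b (tm i) (tm j) w * FF b a (tm j) (tm i) w)))/=.
rewrite mulr_sumr; apply: eq_bigr => i _; rewrite big_mkcond sum_obs mulr_sumr.
apply: eq_bigr => j _; rewrite -mulrA; congr (_ * _).
rewrite -/(tm i) -/(tm j); case: in_A; last by rewrite mul0r.
rewrite mul1r -!E; congr (_ * dotv (_ - _) _).
by apply/matrixP => k l; rewrite !ord1 !mean_starE zb_sym.
Qed.

End Terms.

Lemma wsum_CS (R : realType) (I : finType) (c x : I -> R) : (forall i, 0 <= c i) ->
  (\sum_i c i * x i) ^+ 2 <= (\sum_i c i) * (\sum_i c i * x i ^+ 2).
Proof.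
move=> c0; have := sum_CS (fun i => Num.sqrt (c i)) (fun i => Num.sqrt (c i) * x i).
rewrite (eq_bigr (fun i => c i * x i)); last by move=> i _; rewrite mulrA -expr2 sqr_sqrtr.
rewrite [X in _ <= X * _](eq_bigr c); last by move=> i _; rewrite sqr_sqrtr.
rewrite [X in _ <= _ * X](eq_bigr (fun i => c i * x i ^+ 2))//.
by move=> i _; rewrite exprMn sqr_sqrtr.
Qed.

(** * Fourth moments of the factors *)

Section TermBounds.
Context (R : realType) (d : measure_display) (T : measurableType d).
Variable P : probability T R.
Local Notation Ex := (Expect P).
Local Notation mom := (mom P).
Variables (p : nat) (X : int -> T -> 'cV[R]_p) (M : nat) (mu : 'cV[R]_p).
Variable Gamma : int -> 'M[R]_p.
Hypothesis hX : gaussian_mdep_process P X M mu Gamma.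
Local Notation Z := (centred X mu).
Local Notation lin := (lin X mu).
Local Notation dZ := (dotZ X mu).
Implicit Types (J K : set int).
Variable n : nat.
Hypothesis hn : (100 * M.+1 <= n)%N.
Variables (g q L : R).
Hypothesis hg : forall h, `|h| <= M%:Z -> \sum_i \sum_j Gamma h i j ^+ 2 <= g.
Hypothesis hL : dotv mu (Gamma 0 *m mu) <= L.
Local Notation tm := (@obs_at n).
Local Notation m1 := (M.+1%:R : R).
Local Notation N := (n%:R : R).
Local Notation p1 := (p.+1%:R : R).
Local Notation zb := (Zbar_star X M mu n).
Local Notation A1 := (mean_factor X M mu n).
Local Notation A2 := (mu_factor X M mu n).
Local Notation card_B := (card_B n M).
Local Notation in_B := (in_B n M).

Lemma g_ge0 : 0 <= g.
Proof.
apply: le_trans (hg (h := 0) _); last by rewrite normr0.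
by apply: sumr_ge0 => i _; apply: sumr_ge0 => j _; exact: sqr_ge0.
Qed.

Lemma Z_frob t : \sum_i \sum_j Ex (fun w => Z t i w * Z t j w) ^+ 2 <= g.
Proof.
under eq_bigr do under eq_bigr do rewrite (Ex_ZZ hX) subrr.
by apply: hg; rewrite normr0.
Qed.

Lemma dZ_far t s : M%:Z < `|t - s| -> Ex (fun w => dZ t s w ^+ 4) <= (3 * g) ^+ 2.
Proof.
move=> h; have -> : (3 * g) ^+ 2 = 9 * g * g by ring.
apply: (dot4_far hX (J := [set t]) (K := [set s])); try exact: Z_frob.
- by move=> u v -> ->.
- by move=> i; exact: lin_Z.
- by move=> i; exact: lin_Z.
Qed.

(** It is at least 3, the constant of the independent case, and its square dominates
    [gauss8_cst]. *)
Definition dot4_cst : R := 3 + gauss8_cst R.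

Lemma dot4_cst_ge3 : 3 <= dot4_cst.
Proof. by rewrite lerDl gauss8_cst_ge0. Qed.

(** The expectation of |Z_u|^2 is tr Gamma(0), at most sqrt(p g) by Cauchy-Schwarz against the
    Frobenius norm; this is the origin of the factor p. *)
Lemma dZ_dep t s : Ex (fun w => dZ t s w ^+ 4) <= (dot4_cst * p1 * g) ^+ 2.
Proof.
have g0 := g_ge0.
have tr u : \sum_i Ex (fun w => Z u i w ^+ 2) <= Num.sqrt (p1 * g).
  apply: sqr_le_le; first exact: sqrtr_ge0.
  rewrite sqr_sqrtr ?mulr_ge0//.
  have := sum_CS (fun=> 1) (fun i : 'I_p => Gamma 0 i i).
  rewrite (eq_bigr (fun i => Ex (fun w => Z u i w ^+ 2))); last first.
    by move=> i _; rewrite mul1r -(subrr u) -(Ex_ZZ hX); apply: Ex_ext => w; rewrite expr2.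
  rewrite expr1n sumr_const card_ord -/(p%:R) => h; apply: (le_trans h).
  apply: ler_pM => //; first by apply: sumr_ge0 => i _; exact: sqr_ge0.
    by rewrite ler_nat.
  apply: le_trans (hg (h := 0) _); last by rewrite normr0.
  apply: ler_sum => i _; rewrite (bigD1 i)//= lerDl.
  by apply: sumr_ge0 => j _; exact: sqr_ge0.
have := dot4_dep hX (J := setT) (U := Z t) (V := Z s) (fun i => lin_ZT X mu t i)
  (fun i => lin_ZT X mu s i) (tr t) (tr s).
move=> h; apply: (le_trans h).
rewrite (exprM _ 2 2) sqr_sqrtr ?mulr_ge0// -mulrA [leRHS]exprMn ler_wpM2r ?sqr_ge0//.
by rewrite /dot4_cst; have := gauss8_cst_ge0 R; nra.
Qed.

(** The covariance of the mean over B(t,s) combines the Gamma(v - u) over pairs of times within M.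
    There are at most 2(M + 1) n such pairs, with weights at most (2/n)^2, hence total weight 8(M +
    1)/n; the weighted Cauchy-Schwarz inequality squares it. *)
Lemma zb_frob a b t s :
  \sum_i \sum_j Ex (fun w => zb a b t s i w * zb a b t s j w) ^+ 2 <= 64 * m1 ^+ 2 / N ^+ 2 * g.
Proof.
have g0 := g_ge0; have N0 := N_gt0 R hn.
pose c (u : 'I_n) : R := (card_B a b t s)%:R^-1 * (in_B a b t s (tm u))%:R.
have c0 u : 0 <= c u by rewrite mulr_ge0 ?invr_ge0.
have cN u : `|c u| <= 2 / N.
  rewrite ger0_norm// /c.
  apply: le_trans (card_Binv R hn a b t s).
  by case: in_B; rewrite ?mulr1// mulr0 invr_ge0.
pose k (x : 'I_n * 'I_n) : R := c x.1 * c x.2 * (nearb M (tm x.1) (tm x.2))%:R.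
have k0 x : 0 <= k x by rewrite !mulr_ge0.
have E i j : Ex (fun w => zb a b t s i w * zb a b t s j w) =
    \sum_x k x * Gamma (tm x.2 - tm x.1) i j.
  rewrite (Ex_ext _ (g := fun w => \sum_(u < n) \sum_(v < n) (c u * c v) *
     (Z (tm u) i w * Z (tm v) j w))); last first.
    move=> w; rewrite /Zbar_star mulr_suml; apply: eq_bigr => u _.
    by rewrite mulr_sumr; apply: eq_bigr => v _; rewrite -/(c u) -/(c v) mulrACA.
  rewrite Ex_sum; last first.
    by move=> u _; apply: mom_sum => v _; apply: momZ; exact: (mom_ZZ hX).
  rewrite -(pair_big xpredT xpredT (fun u v => (c u * c v * (nearb M (tm u) (tm v))%:R) *
     Gamma (tm v - tm u) i j))/=.
  apply: eq_bigr => u _; rewrite Ex_sum; last by move=> v _; apply: momZ; exact: (mom_ZZ hX).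
  apply: eq_bigr => v _; rewrite ExZ ?(Ex_ZZ hX); last exact: (mom_ZZ hX).
  have [nr|fr] := boolP (nearb M (tm u) (tm v)); first by rewrite mulr1.
  by rewrite (Gamma_far hX) ?mxE ?mulr0// distrC ltNge.
have Sk : \sum_x k x <= 8 * m1 / N.
  have := sum_near1 M cN.
  rewrite (eq_bigr (fun i => \sum_j k (i, j))); last first.
    by move=> i _; apply: eq_bigr => j _; rewrite !ger0_norm.
  rewrite (pair_big xpredT xpredT (fun u v => k (u, v)))/=.
  rewrite (eq_bigr k); last by case.
  move=> h; apply: (le_trans h); have := dbl_le R M.
  move: (_.*2.+1%:R) => m' hm.
  have -> : (2 / N) ^+ 2 * (N * m') = (4 / N) * m' by field; rewrite gt_eqF.
  have -> : 8 * m1 / N = (4 / N) * (2 * m1) by field; rewrite gt_eqF.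
  by rewrite ler_wpM2l// divr_ge0// ltW.
under eq_bigr do under eq_bigr do rewrite E.
have Sk0 : 0 <= \sum_x k x by apply: sumr_ge0.
apply: (@le_trans _ _ ((\sum_x k x) * ((\sum_x k x) * g))); last first.
  have -> : 64 * m1 ^+ 2 / N ^+ 2 * g = (8 * m1 / N) * ((8 * m1 / N) * g).
    by field; rewrite gt_eqF.
  by apply: ler_pM => //; rewrite ?mulr_ge0// ler_wpM2r.
apply: (@le_trans _ _ (\sum_i \sum_j (\sum_x k x) * \sum_x k x * Gamma (tm x.2 - tm x.1) i j ^+ 2)).
  by apply: ler_sum => i _; apply: ler_sum => j _; exact: wsum_CS.
under eq_bigr do rewrite -mulr_sumr.
rewrite -mulr_sumr ler_wpM2l// mulr_suml.
under eq_bigr do rewrite exchange_big/=.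
rewrite exchange_big/=; apply: ler_sum => x _.
under eq_bigr do rewrite -mulr_sumr.
rewrite -mulr_sumr /k.
have [nr|fr] := boolP (nearb M (tm x.1) (tm x.2)); last by rewrite !mulr0 !mul0r.
by rewrite ler_wpM2l ?mulr_ge0// hg// distrC.
Qed.

(** B(t,s) stays more than M away from s, so the mean is independent of Z_s. The constant is the
    square root of 9 * 64. *)
Lemma A1_bound a b t s : Ex (fun w => A1 a b t s w ^+ 4) <= (24 * (m1 * g / N)) ^+ 2.
Proof.
have N0 := N_gt0 R hn.
have -> : (24 * (m1 * g / N)) ^+ 2 = 9 * (64 * m1 ^+ 2 / N ^+ 2 * g) * g.
  by field; rewrite gt_eqF.
apply: (dot4_far hX (J := [set u | in_B a b t s u]) (K := [set s])).
- by move=> u v /= + ->; rewrite /Defs.in_B; case/and5P.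
- by move=> i; exact: lin_zb.
- by move=> i; exact: lin_Z.
- exact: zb_frob.
- exact: Z_frob.
Qed.

Let zeta (u : int) (w : T) : R := \sum_i mu i 0 * Z u i w.

Let lin_zeta u : lin setT (zeta u).
Proof. by apply: lin_sum => i _; apply: linZ; exact: lin_Z. Qed.

Let mom_zeta u : mom (zeta u).
Proof. exact: (mom_lin hX (lin_zeta u)). Qed.

Let Ex_zeta2 u : Ex (fun w => zeta u w ^+ 2) <= L.
Proof.
apply: le_trans hL; rewrite le_eqVlt; apply/orP; left; apply/eqP.
rewrite (Ex_ext _ (g := fun w => \sum_i \sum_j (mu i 0 * mu j 0) * (Z u i w * Z u j w))); last first.
  move=> w; rewrite expr2 mulr_suml; apply: eq_bigr => i _.
  by rewrite mulr_sumr; apply: eq_bigr => j _; rewrite mulrACA.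
rewrite Ex_sum; last by move=> i _; apply: mom_sum => j _; apply: momZ; exact: (mom_ZZ hX).
rewrite dotvE; apply: eq_bigr => i _.
rewrite Ex_sum; last by move=> j _; apply: momZ; exact: (mom_ZZ hX).
rewrite mxE mulr_sumr; apply: eq_bigr => j _.
by rewrite ExZ ?(Ex_ZZ hX) ?subrr; [ring|exact: (mom_ZZ hX)].
Qed.

Lemma L_ge0 : 0 <= L.
Proof. by apply: le_trans (Ex_zeta2 0); apply: Ex_ge0 => w; exact: sqr_ge0. Qed.

(** A Gaussian linear form with variance at most 4 L, hence with fourth moment at most 3 (4 L)^2 <=
    (7 L)^2. *)
Lemma A2_bound a b t s : Ex (fun w => A2 a b t s w ^+ 4) <= (7 * L) ^+ 2.
Proof.
have L0 := L_ge0.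
rewrite (lin_moment4 hX (lin_A2 X M mu n a b t s)).
pose c (u : 'I_n) : R := (card_B a b t s)%:R^-1 * (in_B a b t s (tm u))%:R.
pose zt w := \sum_(u < n) c u * zeta (tm u) w.
have E w : A2 a b t s w = zeta (t + a) w - zt w.
  rewrite /zt /zeta.
  under [X in _ = _ - X]eq_bigr do rewrite mulr_sumr.
  rewrite exchange_big/= -sumrB; apply: eq_bigr => i _.
  rewrite mulrBl [Z _ _ _ * _]mulrC; congr (_ - _).
  by rewrite /Zbar_star mulr_suml; apply: eq_bigr => u _; rewrite -/(c u); ring.
have mzt : mom zt by apply: mom_sum => u _; exact: momZ.
have h1 : Ex (fun w => zt w ^+ 2) <= L.
  have := Ex_avg (c := c) (F := fun u : 'I_n => zeta (tm u)) (fun u => mom_zeta (tm u)) L0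
    (fun u _ => Ex_zeta2 (tm u)).
  by rewrite sum_zb_coef// expr1n mulr1.
have h2 : Ex (fun w => A2 a b t s w ^+ 2) <= 4 * L.
  apply: (@le_trans _ _ (Ex (fun w => 2 * zeta (t + a) w ^+ 2 + 2 * zt w ^+ 2))).
    apply: Ex_le.
    - by apply: momX; exact: (mom_A2 hX).
    - by apply: momD; apply: momZ; exact: momX.
    - by move=> w; rewrite E; have := sqr_ge0 (zeta (t + a) w + zt w); nra.
  rewrite ExD ?ExZ; try by [exact: momX | apply: momZ; exact: momX].
  by have := Ex_zeta2 (t + a); lra.
have h0 : 0 <= Ex (fun w => A2 a b t s w ^+ 2) by apply: Ex_ge0 => w; exact: sqr_ge0.
nra.
Qed.

End TermBounds.

(** * Far pairs: projections and degenerate remainder *)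

Section Pieces.
Context (R : realType) (d : measure_display) (T : measurableType d).
Variable P : probability T R.
Local Notation Ex := (Expect P).
Local Notation mom := (mom P).
Variables (p : nat) (X : int -> T -> 'cV[R]_p) (M : nat) (mu : 'cV[R]_p).
Variable Gamma : int -> 'M[R]_p.
Hypothesis hX : gaussian_mdep_process P X M mu Gamma.
Local Notation Z := (centred X mu).
Local Notation pol := (pol X mu).
Local Notation dZ := (dotZ X mu).
Implicit Types (J K : set int).
Variable n : nat.
Hypothesis hn : (100 * M.+1 <= n)%N.
Variables (g q L : R).
Hypothesis hg : forall h, `|h| <= M%:Z -> \sum_i \sum_j Gamma h i j ^+ 2 <= g.
Hypothesis hL : dotv mu (Gamma 0 *m mu) <= L.
Local Notation tm := (@obs_at n).
Local Notation m1 := (M.+1%:R : R).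
Local Notation N := (n%:R : R).
Hypothesis hq : forall h1 h2 h3 h4 : int,
  `|h1| <= M%:Z -> `|h2| <= M%:Z -> `|h3| <= M%:Z -> `|h4| <= M%:Z ->
  `|\tr (Gamma h1 *m Gamma h2 *m Gamma h3 *m Gamma h4)| <= q.
Local Notation quad := (Zquad X mu).
Local Notation II := ('I_n * 'I_n)%type.

Lemma q_ge0 : 0 <= q.
Proof.
have h0 : `|0 : int| <= M%:Z by rewrite normr0.
exact: le_trans (hq h0 h0 h0 h0).
Qed.

Lemma trace2_le a b : `|a| <= M%:Z -> `|b| <= M%:Z -> \tr (Gamma a *m Gamma b) ^+ 2 <= g ^+ 2.
Proof.
move=> ha hb; rewrite trace2.
rewrite (pair_big xpredT xpredT (fun i j => Gamma a i j * Gamma b j i))/=.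
apply: (le_trans (sum_CS _ _)); rewrite expr2.
apply: ler_pM; try by apply: sumr_ge0 => x _; exact: sqr_ge0.
  by rewrite -(pair_big xpredT xpredT (fun i j => Gamma a i j ^+ 2))/= hg.
rewrite -(pair_big xpredT xpredT (fun i j => Gamma b j i ^+ 2))/= exchange_big/=.
exact: hg.
Qed.

Lemma quad_var a b t : `|a| <= M%:Z -> `|b| <= M%:Z ->
  Ex (fun w => (quad a (Gamma b) t w - \tr (Gamma a *m Gamma b)) ^+ 2) <= 2 * q.
Proof.
move=> ha hb; rewrite (Ex_quad2 hX).
have h0 : `|0 : int| <= M%:Z by rewrite normr0.
have hb' : `|- b| <= M%:Z by rewrite normrN.
have := hq hb' h0 hb h0; have := hq hb ha hb ha.
rewrite !ler_norml => /andP[_ h1] /andP[_ h2]; lra.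
Qed.

(** Summing over the second index leaves a sum over t of centred quadratic forms involving only t
    and t + a. Forms more than 3M apart are independent, so only O(n M) pairs of times
    contribute. *)
Lemma lin_part a b (c : II -> R) : `|a| <= M%:Z -> `|b| <= M%:Z ->
  (forall x, `|c x| <= 2 / N ^+ 2) ->
  Ex (fun w => (\sum_(x : II) c x *
       (quad a (Gamma b) (tm x.1) w - \tr (Gamma a *m Gamma b))) ^+ 2)
  <= 48 * (q * m1 / N).
Proof.
move=> ha hb hc; have N0 := N_gt0 R hn; have q0 := q_ge0.
set tau := \tr _.
pose Q (i : 'I_n) w := quad a (Gamma b) (tm i) w - tau.
pose e (i : 'I_n) := \sum_(j < n) c (i, j).
have mQ i : mom (Q i) by apply: momB; [exact: (mom_quad hX)|exact: mom_cst].
rewrite (Ex_ext _ (g := fun w => (\sum_i e i * Q i w) ^+ 2)); last first.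
  move=> w; congr (_ ^+ 2).
  transitivity (\sum_(x : II) c (x.1, x.2) * Q x.1 w); first by apply: eq_bigr; case.
  rewrite -(pair_big xpredT xpredT (fun i j => c (i, j) * Q i w))/=.
  by apply: eq_bigr => i _; rewrite mulr_suml.
have he i : `|e i| <= 2 / N.
  apply: (le_trans (ler_norm_sum _ _ _)).
  apply: (le_trans (ler_sum _ (fun j _ => hc (i, j)))).
  rewrite sumr_const card_ord -[leLHS]mulr_natl.
  by rewrite le_eqVlt; apply/orP; left; apply/eqP; field; rewrite gt_eqF.
apply: (@le_trans _ _ (2 * q * \sum_i \sum_j `|e i| * `|e j| * (nearb (3 * M) (tm i) (tm j))%:R)).
  apply: (Ex_linked (link := fun i j => nearb (3 * M) (tm i) (tm j))) => //.
  - by rewrite mulr_ge0.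
  - by move=> i _; exact: quad_var.
  move=> i j _ _; rewrite /nearb -ltNge => hij.
  rewrite (pol_far hX (J := [set u | `|u - tm i| <= M%:Z]) (K := [set u | `|u - tm j| <= M%:Z])).
  - rewrite /Q ExB ?(Ex_quad hX) ?Ex_cst ?subrr ?mul0r//.
      exact: (mom_quad hX).
    exact: mom_cst.
  - by move=> u v /=; lia.
  - by apply: polB (pol_cst _ _ _ _); apply: pol_quad => /=; lia.
  - by apply: polB (pol_cst _ _ _ _); apply: pol_quad => /=; lia.
apply: (@le_trans _ _ (2 * q * ((2 / N) ^+ 2 * (N * (6 * m1))))).
  rewrite ler_wpM2l ?mulr_ge0//; apply: (le_trans (sum_near1 (3 * M) he)).
  rewrite ler_wpM2l ?sqr_ge0// ler_wpM2l//.
  by rewrite -natrM ler_nat; lia.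
by rewrite le_eqVlt; apply/orP; left; apply/eqP; field; rewrite gt_eqF.
Qed.

Section Degenerate.
Variables (a b : int).
Hypotheses (ha : `|a| <= M%:Z) (hb : `|b| <= M%:Z).
Let tau := \tr (Gamma a *m Gamma b).

Let W t i j w := Z (t + a) i w * Z t j w - Gamma a j i.
Let W' s i j w := Z s i w * Z (s + b) j w - Gamma b i j.

Let polW J t i j : J t -> J (t + a) -> pol J (W t i j).
Proof. by move=> h1 h2; apply: polB (pol_cst _ _ _ _); apply: polM; exact: pol_Z. Qed.

Let polW' J s i j : J s -> J (s + b) -> pol J (W' s i j).
Proof. by move=> h1 h2; apply: polB (pol_cst _ _ _ _); apply: polM; exact: pol_Z. Qed.

Let ExW t i j : Ex (W t i j) = 0.
Proof.
rewrite ExB ?Ex_cst; [|exact: (mom_ZZ hX)|exact: mom_cst].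
rewrite (Ex_ZZ hX) -[Gamma a j i](GammaN hX); have -> : t - (t + a) = - a by ring.
by rewrite subrr.
Qed.

Let ExW' s i j : Ex (W' s i j) = 0.
Proof.
rewrite ExB ?Ex_cst; [|exact: (mom_ZZ hX)|exact: mom_cst].
by rewrite (Ex_ZZ hX) (addrC s) addrK subrr.
Qed.

(* Hoeffding decomposition: the product of the two scalar products minus its
   projections on the observations near t and on those near s. *)
Definition degenerate_term t s w : R := dZ (t + a) s w * dZ (s + b) t w
  - (quad a (Gamma b) t w - tau) - (quad b (Gamma a) s w - tau) - tau.

(** Subtracting both projections turns the product into one of two centred factors, the first in the
    times t, t + a and the second in s, s + b. Each factor then makes the expectation vanish once it
    is isolated. *)
Let HHE t s w : degenerate_term t s w = \sum_i \sum_j W t i j w * W' s i j w.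
Proof.
have e1 : dZ (t + a) s w * dZ (s + b) t w = \sum_i \sum_j
   (Z (t + a) i w * Z s i w) * (Z (s + b) j w * Z t j w).
  rewrite /dotZ /dot mulr_suml; apply: eq_bigr => i _.
  by rewrite mulr_sumr.
have e2 : quad b (Gamma a) s w = \sum_i \sum_j Gamma a j i * (Z (s + b) j w * Z s i w).
  by rewrite /Zquad exchange_big.
have e3 : tau = \sum_i \sum_j Gamma a j i * Gamma b i j.
  by rewrite /tau trace2 exchange_big.
transitivity (dZ (t + a) s w * dZ (s + b) t w - quad a (Gamma b) t w - quad b (Gamma a) s w + tau).
  by rewrite /degenerate_term; ring.
rewrite e1 e2 {}e3 /Zquad -!sumrB -big_split; apply: eq_bigr => i _ /=.
rewrite -!sumrB -big_split; apply: eq_bigr => j _ /=.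
by rewrite /W /W'; ring.
Qed.

Let momW t i j : mom (W t i j).
Proof. exact: (mom_pol hX (polW (J := setT) _ _ I I)). Qed.
Let momW' s i j : mom (W' s i j).
Proof. exact: (mom_pol hX (polW' (J := setT) _ _ I I)). Qed.

Let pol_HH J t s : J t -> J (t + a) -> J s -> J (s + b) -> pol J (degenerate_term t s).
Proof.
move=> h1 h2 h3 h4; apply: (pol_ext (fun w => esym (HHE t s w))).
by apply: pol_sum => i _; apply: pol_sum => j _; apply: polM; [exact: polW|exact: polW'].
Qed.

Lemma mom_degenerate t s : mom (degenerate_term t s).
Proof. exact: (mom_pol hX (pol_HH (J := setT) I I I I)). Qed.

(** As |s - t| > 3M, all times outside [W], including those of [W'], are more than 2M from t. Those
    of [W] are within M of t, so [W] factors out with mean zero. *)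
Let HH_zero1 t s (G : T -> R) : 3 * M%:Z < `|s - t| ->
  pol [set u | 2 * M%:Z < `|u - t|] G -> Ex (fun w => degenerate_term t s w * G w) = 0.
Proof.
move=> hts pG.
rewrite (Ex_ext _ (g := fun w => \sum_i \sum_j W t i j w * (W' s i j w * G w))); last first.
  move=> w; rewrite HHE mulr_suml; apply: eq_bigr => i _.
  by rewrite mulr_suml; apply: eq_bigr => j _; rewrite mulrA.
have mG := mom_pol hX pG.
have mm i j : mom (fun w => W t i j w * (W' s i j w * G w)).
  by apply: momM => //; exact: momM.
rewrite Ex_sum; last by move=> i _; exact: mom_sum.
rewrite big1// => i _; rewrite Ex_sum// big1// => j _.
rewrite (pol_far hX (J := [set u | `|u - t| <= M%:Z]) (K := [set u | 2 * M%:Z < `|u - t|])).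
- by rewrite ExW mul0r.
- by move=> u v /=; lia.
- by apply: polW => /=; lia.
- by apply: polM => //; apply: polW' => /=; lia.
Qed.

Let HH_zero2 t s (G : T -> R) : 3 * M%:Z < `|t - s| ->
  pol [set u | 2 * M%:Z < `|u - s|] G -> Ex (fun w => degenerate_term t s w * G w) = 0.
Proof.
move=> hts pG.
rewrite (Ex_ext _ (g := fun w => \sum_i \sum_j W' s i j w * (W t i j w * G w))); last first.
  move=> w; rewrite HHE mulr_suml; apply: eq_bigr => i _.
  by rewrite mulr_suml; apply: eq_bigr => j _; rewrite mulrCA mulrA.
have mG := mom_pol hX pG.
have mm i j : mom (fun w => W' s i j w * (W t i j w * G w)).
  by apply: momM => //; exact: momM.
rewrite Ex_sum; last by move=> i _; exact: mom_sum.
rewrite big1// => i _; rewrite Ex_sum// big1// => j _.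
rewrite (pol_far hX (J := [set u | `|u - s| <= M%:Z]) (K := [set u | 2 * M%:Z < `|u - s|])).
- by rewrite ExW' mul0r.
- by move=> u v /=; lia.
- by apply: polW' => /=; lia.
- by apply: polM => //; apply: polW => /=; lia.
Qed.

(** When no matching within 3M exists, one of the four times is far from both times of the other
    pair, and by assumption from its own partner; its centred factor gives zero. *)
Lemma degenerate_link (x y : II) :
  ~~ nearb (3 * M) (tm x.1) (tm x.2) -> ~~ nearb (3 * M) (tm y.1) (tm y.2) ->
  ~~ link2 (3 * M) x y ->
  Ex (fun w => degenerate_term (tm x.1) (tm x.2) w * degenerate_term (tm y.1) (tm y.2) w) = 0.
Proof.
rewrite /link2; move: (tm x.1) (tm x.2) (tm y.1) (tm y.2) => t s t' s' h1 h2 h3.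
have swap : Ex (fun w => degenerate_term t s w * degenerate_term t' s' w) = Ex (fun w => degenerate_term t' s' w * degenerate_term t s w).
  by apply: Ex_ext => w; rewrite mulrC.
have : [\/ ~~ nearb (3 * M) t t' /\ ~~ nearb (3 * M) t s',
           ~~ nearb (3 * M) s t' /\ ~~ nearb (3 * M) s s',
           ~~ nearb (3 * M) t t' /\ ~~ nearb (3 * M) s t' |
           ~~ nearb (3 * M) t s' /\ ~~ nearb (3 * M) s s'].
  move: h3; case: (nearb _ t t'); case: (nearb _ t s'); case: (nearb _ s t');
    case: (nearb _ s s') => //= _;
    first [by apply: Or41|by apply: Or42|by apply: Or43|by apply: Or44].
rewrite /nearb -!ltNge in h1 h2 *; case=> -[h4 h5].
- by apply: HH_zero1; [lia|apply: pol_HH => /=; lia].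
- by apply: HH_zero2; [lia|apply: pol_HH => /=; lia].
- by rewrite swap; apply: HH_zero1; [lia|apply: pol_HH => /=; lia].
- by rewrite swap; apply: HH_zero2; [lia|apply: pol_HH => /=; lia].
Qed.

Lemma degenerate_bound t s : M%:Z < `|t + a - s| -> M%:Z < `|s + b - t| ->
  Ex (fun w => degenerate_term t s w ^+ 2) <= 40 * g ^+ 2 + 16 * q.
Proof.
move=> h1 h2.
have g0 := g_ge0 hg.
pose Q1 w := quad a (Gamma b) t w - tau.
pose Q2 w := quad b (Gamma a) s w - tau.
pose Y w := dZ (t + a) s w * dZ (s + b) t w.
have mQ1 : mom Q1 by apply: momB; [exact: (mom_quad hX)|exact: mom_cst].
have mQ2 : mom Q2 by apply: momB; [exact: (mom_quad hX)|exact: mom_cst].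
have mY : mom Y by apply: momM; exact: (mom_dZ hX).
have bY : Ex (fun w => Y w ^+ 2) <= (3 * g) * (3 * g).
  apply: Ex_sqM; try exact: (mom_dZ hX); rewrite ?mulr_ge0//; exact: (dZ_far hX hg).
have bQ1 := quad_var t ha hb.
have bQ2 : Ex (fun w => Q2 w ^+ 2) <= 2 * q.
  by rewrite /Q2 /tau mxtrace_mulC; exact: quad_var.
have bt := trace2_le ha hb.
(* The square of a sum of four terms is at most 4 times the sum of the squares, which gives 4 (9 g^2
   + 2 q + 2 q + g^2). *)
apply: (@le_trans _ _ (Ex (fun w => 4 * (Y w ^+ 2 + (Q1 w ^+ 2 + (Q2 w ^+ 2 + tau ^+ 2)))))).
  apply: Ex_le.
  - by apply: momX; exact: mom_degenerate.
  - apply: momZ; apply: momD; first exact: momX.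
    by apply: momD; [exact: momX|apply: momD; [exact: momX|exact: mom_cst]].
  - move=> w; rewrite /degenerate_term -/(Y w) -/(Q1 w) -/(Q2 w).
    move: (Y w) (Q1 w) (Q2 w) tau => y u v z.
    have := sqr_ge0 (y + u); have := sqr_ge0 (y + v); have := sqr_ge0 (y + z).
    have := sqr_ge0 (u - v); have := sqr_ge0 (u - z); have := sqr_ge0 (v - z).
    by nra.
have mc : mom (fun=> tau ^+ 2) by exact: mom_cst.
have m3 : mom (fun w => Q2 w ^+ 2 + tau ^+ 2) by apply: momD => //; exact: momX.
have m2 : mom (fun w => Q1 w ^+ 2 + (Q2 w ^+ 2 + tau ^+ 2)) by apply: momD => //; exact: momX.
rewrite ExZ; last by apply: momD => //; exact: momX.
rewrite ExD//; last exact: momX.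
rewrite ExD//; last exact: momX.
rewrite ExD//; last exact: momX.
rewrite Ex_cst -/tau in bt *; rewrite -/(Q1 _) in bQ1.
have := bQ1; rewrite -/tau -/Q1; lra.
Qed.

(** Among the n^4 pairs of index pairs only O(n^2 M^2) are linked, a gain of M^2/n^2 over the bound
    for a single term. The threshold 5(M + 1) makes both scalar products independent and exceeds the
    3M needed for degeneracy. *)
Lemma deg_part (c : II -> R) :
  (forall x, `|c x| <= 2 / N ^+ 2) ->
  (forall x, c x != 0 -> ~~ nearb (5 * M.+1) (tm x.1) (tm x.2)) ->
  Ex (fun w => (\sum_(x : II) c x * degenerate_term (tm x.1) (tm x.2) w) ^+ 2)
  <= (40 * g ^+ 2 + 16 * q) * (288 * (m1 ^+ 2 / N ^+ 2)).
Proof.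
move=> hc hfar; have N0 := N_gt0 R hn; have q0 := q_ge0.
have B0 : 0 <= 40 * g ^+ 2 + 16 * q by apply: addr_ge0; rewrite mulr_ge0 ?sqr_ge0.
apply: (@le_trans _ _ ((40 * g ^+ 2 + 16 * q) *
   \sum_x \sum_y `|c x| * `|c y| * (link2 (3 * M) x y)%:R)).
  apply: (Ex_linked (F := fun x => degenerate_term (tm x.1) (tm x.2)) (link := link2 (3 * M))) => //.
  - by move=> x; exact: mom_degenerate.
  - move=> x /hfar; rewrite /nearb -ltNge; move: (tm x.1) (tm x.2) => t s h.
    by apply: degenerate_bound; lia.
  - have f3 x : c x != 0 -> ~~ nearb (3 * M) (tm x.1) (tm x.2).
      by move=> /hfar; rewrite /nearb -!ltNge; move: (tm x.1) (tm x.2) => t s; lia.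
    by move=> x y /f3 hx /f3 hy; exact: degenerate_link.
rewrite ler_wpM2l//; apply: (le_trans (sum_pair2 (3 * M) hc)).
apply: (@le_trans _ _ ((2 / N ^+ 2) ^+ 2 * (2 * (N * (6 * m1)) ^+ 2))).
  rewrite ler_wpM2l ?sqr_ge0// ler_wpM2l// lerXn2r ?nnegrE ?mulr_ge0//.
  by rewrite ler_wpM2l// -natrM ler_nat; lia.
by rewrite le_eqVlt; apply/orP; left; apply/eqP; field; rewrite gt_eqF.
Qed.

End Degenerate.

End Pieces.

Lemma window (M : nat) (t s a b : int) : `|a| <= M%:Z -> `|b| <= M%:Z ->
  `|t - s| <= (5 * M.+1)%:Z ->
  [/\ `|t + a - t| <= 6 * (M.+1)%:Z, `|s - t| <= 6 * (M.+1)%:Z,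
      `|s + b - t| <= 6 * (M.+1)%:Z & `|t - t| <= 6 * (M.+1)%:Z].
Proof. by move=> ha hb h; split; lia. Qed.

Lemma far_pair_in_B (n M : nat) (t s a b u : int) : `|a| <= M%:Z ->
  (5 * M.+1)%:Z < `|t - s| -> in_B n M b a s t u ->
  [/\ M%:Z < `|t + a - s|, M%:Z < `|t - s|, M%:Z < `|u - s|, M%:Z < `|s - u| &
  [/\ M%:Z < `|u - t|, M%:Z < `|t - u|, M%:Z < `|u - (t + a)| & M%:Z < `|t + a - u| ]].
Proof. by move=> ha h; rewrite /in_B => /and5P[_ h2 h3 h4 h5]; split; [lia|lia|lia|lia|split; lia]. Qed.

(** * Near pairs, and the correction by the mean *)

Section NearAndMean.
Context (R : realType) (d : measure_display) (T : measurableType d).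
Variable P : probability T R.
Local Notation Ex := (Expect P).
Local Notation mom := (mom P).
Variables (p : nat) (X : int -> T -> 'cV[R]_p) (M : nat) (mu : 'cV[R]_p).
Variable Gamma : int -> 'M[R]_p.
Hypothesis hX : gaussian_mdep_process P X M mu Gamma.
Local Notation Z := (centred X mu).
Local Notation pol := (pol X mu).
Local Notation dZ := (dotZ X mu).
Implicit Types (J K : set int).
Variable n : nat.
Hypothesis hn : (100 * M.+1 <= n)%N.
Variables (g q L : R).
Hypothesis hg : forall h, `|h| <= M%:Z -> \sum_i \sum_j Gamma h i j ^+ 2 <= g.
Hypothesis hL : dotv mu (Gamma 0 *m mu) <= L.
Local Notation tm := (@obs_at n).
Local Notation m1 := (M.+1%:R : R).
Local Notation N := (n%:R : R).
Local Notation p1 := (p.+1%:R : R).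
Local Notation A0 := (main_factor X mu).
Local Notation A1 := (mean_factor X M mu n).
Local Notation dot4_cst := (dot4_cst R).
Local Notation II := ('I_n * 'I_n)%type.

(** Let x = t - s. Both x and x + a - b exceed M in absolute value, and they have the same sign;
    their sum is (x + a) + (x - b), so these two terms cannot both be within M. *)
Lemma in_A_one_far a b t s : `|a| <= M%:Z -> `|b| <= M%:Z -> in_A n M a b t s ->
  M%:Z < `|t + a - s| \/ M%:Z < `|s + b - t|.
Proof. by move=> ha hb; rewrite /in_A => /and5P[_ _ _ _ /andP[]]; lia. Qed.

Lemma in_A_prod_bound a b t s : `|a| <= M%:Z -> `|b| <= M%:Z -> in_A n M a b t s ->
  Ex (fun w => (A0 a t s w * A0 b s t w) ^+ 2) <= 3 * (dot4_cst * p1 * g ^+ 2).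
Proof.
move=> ha hb hA; have g0 := g_ge0 hg; have K3 := dot4_cst_ge3 R.
have K0 : 0 <= dot4_cst by apply: le_trans K3.
have [h|h] := in_A_one_far ha hb hA.
- have -> : 3 * (dot4_cst * p1 * g ^+ 2) = (3 * g) * (dot4_cst * p1 * g) by ring.
  apply: Ex_sqM; try exact: (mom_dZ hX); rewrite ?mulr_ge0//.
    exact: (dZ_far hX hg).
  exact: (dZ_dep hX hg).
- have -> : 3 * (dot4_cst * p1 * g ^+ 2) = (dot4_cst * p1 * g) * (3 * g) by ring.
  apply: Ex_sqM; try exact: (mom_dZ hX); rewrite ?mulr_ge0//.
    exact: (dZ_dep hX hg).
  exact: (dZ_far hX hg).
Qed.

Lemma p1_ge1 : 1 <= p1. Proof. by rewrite ler1n. Qed.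

(** There are O(n M) near pairs, each correlated with O(M^2) others; the resulting M^3/n^3 pays for
    the factor p without any decomposition. The constants 11 and 27 come from the sizes of windows
    of radii 5(M + 1) and 13(M + 1). *)
Lemma near_part a b (c : II -> R) : `|a| <= M%:Z -> `|b| <= M%:Z ->
  (forall x, `|c x| <= 2 / N ^+ 2 * (nearb (5 * M.+1) (tm x.1) (tm x.2))%:R) ->
  (forall x, c x != 0 -> in_A n M a b (tm x.1) (tm x.2)) ->
  Ex (fun w => (\sum_(x : II) c x * (A0 a (tm x.1) (tm x.2) w * A0 b (tm x.2) (tm x.1) w
      - \tr (Gamma a *m Gamma b))) ^+ 2)
  <= 32 * (121 * (27 * (dot4_cst * p1 * g ^+ 2 * m1 ^+ 3 / N ^+ 3))).
Proof.
move=> ha hb hc hA; have N0 := N_gt0 R hn; have g0 := g_ge0 hg; have K3 := dot4_cst_ge3 R.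
have p1' := p1_ge1.
set tau := \tr _.
pose F (x : II) w := A0 a (tm x.1) (tm x.2) w * A0 b (tm x.2) (tm x.1) w - tau.
have mY t s : mom (fun w => A0 a t s w * A0 b s t w) by apply: momM; exact: (mom_dZ hX).
have mF x : mom (F x) by apply: momB; [exact: mY|exact: mom_cst].
pose B := 8 * (dot4_cst * p1 * g ^+ 2).
have G0 : 0 <= dot4_cst * p1 * g ^+ 2 by rewrite mulr_ge0 ?mulr_ge0 ?sqr_ge0//; lra.
have Gg : g ^+ 2 <= dot4_cst * p1 * g ^+ 2.
  by rewrite ler_peMl ?sqr_ge0//; nra.
have B0 : 0 <= B by rewrite mulr_ge0.
have nr x : c x != 0 -> nearb (5 * M.+1) (tm x.1) (tm x.2).
  by move=> cx; have := hc x; case: nearb => //; rewrite mulr0 normr_le0 (negbTE cx).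
have EF x : c x != 0 -> Ex (F x) = 0.
  move=> /hA; rewrite /in_A => /and5P[_ _ _ _ /andP[h1 h2]].
  rewrite ExB ?Ex_cst; [|exact: mY|exact: mom_cst].
  by rewrite (Ex_dZdZ hX)// subrr.
apply: (@le_trans _ _ (B * \sum_x \sum_y `|c x| * `|c y| *
    (nearb (13 * M.+1) (tm x.1) (tm y.1))%:R)).
  apply: (Ex_linked (F := F) (link := fun x y => nearb (13 * M.+1) (tm x.1) (tm y.1))) => //.
  - move=> x cx.
    apply: (@le_trans _ _ (Ex (fun w => 2 * (A0 a (tm x.1) (tm x.2) w * A0 b (tm x.2) (tm x.1) w) ^+ 2
       + 2 * tau ^+ 2))).
      apply: Ex_le.
      + exact: momX.
      + by apply: momD; [apply: momZ; exact: momX|exact: mom_cst].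
      + move=> w; rewrite /F; move: (A0 _ _ _ _ * _) => y.
        by have := sqr_ge0 (y + tau); nra.
    rewrite ExD ?ExZ ?Ex_cst; try by [exact: momX|apply: momZ; exact: momX|exact: mom_cst].
    have := in_A_prod_bound ha hb (hA _ cx); have := trace2_le hg ha hb; rewrite -/tau /B; lra.
  - move=> x y cx cy hxy.
    have := nr x cx; have := nr y cy; have := EF x cx; move: hxy.
    rewrite /F; move: (tm x.1) (tm x.2) (tm y.1) (tm y.2) => t s t' s'.
    rewrite /nearb -ltNge => h1 E h2 h3.
    (* All times of a near pair lie within 6(M + 1) of its first time. Beyond 13(M + 1) = 2 * 6(M +
       1) + (M + 1), two such windows are more than M apart. *)
    have [w1 w2 w3 w4] := window ha hb h3; have [w1' w2' w3' w4'] := window ha hb h2.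
    rewrite (pol_far hX (J := [set u | `|u - t| <= 6 * (M.+1)%:Z])
       (K := [set u | `|u - t'| <= 6 * (M.+1)%:Z])).
    + by rewrite E mul0r.
    + move=> u v /=; clear -h1; lia.
    + by apply: polB (pol_cst _ _ _ _); apply: polM; apply: pol_dZ.
    + by apply: polB (pol_cst _ _ _ _); apply: polM; apply: pol_dZ.
apply: (@le_trans _ _ (B * ((2 / N ^+ 2) ^+ 2 * (N * (11 * m1) ^+ 2 * (27 * m1))))).
  rewrite ler_wpM2l//; apply: (le_trans (sum_near_pair (13 * M.+1) hc)).
  rewrite ler_wpM2l ?sqr_ge0//.
  have h11 : ((5 * M.+1).*2.+1)%:R <= 11 * m1 by rewrite -natrM ler_nat; clear; lia.
  have h27 : ((13 * M.+1).*2.+1)%:R <= 27 * m1 by rewrite -natrM ler_nat; clear; lia.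
  apply: ler_pM; [by rewrite mulr_ge0 ?exprn_ge0|by []| |exact: h27].
  by rewrite ler_wpM2l//; apply: lerXn2r => //; rewrite nnegrE.
by rewrite /B le_eqVlt; apply/orP; left; apply/eqP; field; rewrite gt_eqF.
Qed.

(** For fixed t this is a double sum over s and over the points u of B(t,s) of Z_(t+a)'Z_s Z_u'Z_t,
    where an isolated Z_s or Z_u gives zero; linked pairs (s,u) are counted as before. The factor n
    in [e] turns the outer sum into an average over t, for which no cancellation is used. *)
Lemma mean_part a b (c : II -> R) : `|a| <= M%:Z -> `|b| <= M%:Z ->
  (forall x, `|c x| <= 2 / N ^+ 2) ->
  (forall x, c x != 0 -> ~~ nearb (5 * M.+1) (tm x.1) (tm x.2)) ->
  Ex (fun w => (\sum_(x : II) c x *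
     (A0 a (tm x.1) (tm x.2) w * A1 b a (tm x.2) (tm x.1) w)) ^+ 2)
  <= 9 * (128 * (g ^+ 2 * m1 ^+ 2 / N ^+ 2)).
Proof.
move=> ha hb hc hfar; have N0 := N_gt0 R hn; have g0 := g_ge0 hg.
have Nn : N != 0 by rewrite gt_eqF.
pose kap (t s : int) (u : 'I_n) : R := (card_B n M b a s t)%:R^-1 * (in_B n M b a s t (tm u))%:R.
pose e (i : 'I_n) (x : II) := N * c (i, x.1) * kap (tm i) (tm x.1) x.2.
pose G (i : 'I_n) (x : II) w := dZ (tm i + a) (tm x.1) w * dZ (tm x.2) (tm i) w.
pose f (i : 'I_n) w := \sum_x e i x * G i x w.
have mG i x : mom (G i x) by apply: momM; exact: (mom_dZ hX).
have mf i : mom (f i) by apply: mom_sum => x _; exact: momZ.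
rewrite (Ex_ext _ (g := fun w => (\sum_(i < n) N^-1 * f i w) ^+ 2)); last first.
  move=> w; congr (_ ^+ 2).
  transitivity (\sum_(x : II) c (x.1, x.2) *
     (A0 a (tm x.1) (tm x.2) w * A1 b a (tm x.2) (tm x.1) w)).
    by apply: eq_bigr; case.
  rewrite -(pair_big xpredT xpredT (fun i j => c (i, j) *
     (A0 a (tm i) (tm j) w * A1 b a (tm j) (tm i) w)))/=.
  apply: eq_bigr => i _; rewrite /f.
  rewrite -(pair_big xpredT xpredT (fun j u => e i (j, u) * G i (j, u) w))/=.
  rewrite mulr_sumr; apply: eq_bigr => j _.
  have -> : A1 b a (tm j) (tm i) w = \sum_u kap (tm i) (tm j) u * dZ (tm u) (tm i) w.
    rewrite /mean_factor /dot /Zbar_star.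
    under eq_bigr do rewrite mulr_suml.
    rewrite exchange_big/=; apply: eq_bigr => u _.
    rewrite /dotZ /dot mulr_sumr; apply: eq_bigr => k _.
    by rewrite -/(kap (tm i) (tm j) u) mulrA.
  rewrite mulrA mulr_sumr [RHS]mulr_sumr; apply: eq_bigr => u _.
  by rewrite /e /G /main_factor /=; field.
pose B := 9 * (128 * (g ^+ 2 * m1 ^+ 2 / N ^+ 2)).
have B0 : 0 <= B.
  by rewrite mulr_ge0// mulr_ge0 ?mulr_ge0 ?sqr_ge0// invr_ge0 sqr_ge0.
have fB i : Ex (fun w => f i w ^+ 2) <= B.
  have he x : `|e i x| <= 4 / N ^+ 2.
    rewrite /e !normrM (gtr0_norm N0).
    have -> : 4 / N ^+ 2 = N * (2 / N ^+ 2) * (2 / N) by field.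
    apply: ler_pM => //.
      by rewrite ler_wpM2l// ltW.
    rewrite /kap ger0_norm ?mulr_ge0 ?invr_ge0//.
    apply: le_trans (card_Binv R hn b a (tm x.1) (tm i)).
    by rewrite normr_nat; case: (in_B _ _ _ _ _ _ _); rewrite ?mulr1 ?mulr0 ?invr_ge0.
  have e1 x : e i x != 0 -> ~~ nearb (5 * M.+1) (tm i) (tm x.1) /\
      in_B n M b a (tm x.1) (tm i) (tm x.2).
    rewrite /e /kap => h; split.
      by apply: (hfar (i, x.1)); apply: contraNneq h => ->; rewrite mulr0 mul0r.
    by case: (in_B _ _ _ _ _ _ _) h => //; rewrite !mulr0 eqxx.
  apply: (@le_trans _ _ (((3 * g) * (3 * g)) * \sum_x \sum_y `|e i x| * `|e i y| * (link2 M x y)%:R)).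
    apply: Ex_linked => //.
    - by rewrite !mulr_ge0.
    - move=> x /e1; rewrite /nearb -ltNge => -[h1 hB].
      have [g1 _ _ _ [g5 _ _ _]] := far_pair_in_B ha h1 hB.
      by apply: Ex_sqM; try exact: (mom_dZ hX); rewrite ?mulr_ge0//; exact: (dZ_far hX hg).
    - move=> x y /e1 + /e1 + .
      rewrite /G /link2 {1 2}/nearb; move: (tm i) (tm x.1) (tm x.2) (tm y.1) (tm y.2) => t s u s' u'.
      rewrite -!ltNge => -[h1 hB] [h1' hB'] hl.
      have [g1 g2 g3 g4 [g5 g6 g7 g8]] := far_pair_in_B ha h1 hB.
      have [k1 k2 k3 k4 [k5 k6 k7 k8]] := far_pair_in_B ha h1' hB'.
      have : [\/ ~~ nearb M s s' /\ ~~ nearb M s u', ~~ nearb M u s' /\ ~~ nearb M u u',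
                 ~~ nearb M s s' /\ ~~ nearb M u s' | ~~ nearb M s u' /\ ~~ nearb M u u'].
        move: hl; case: (nearb M s s'); case: (nearb M s u'); case: (nearb M u s');
          case: (nearb M u u') => //= _;
          first [by apply: Or41|by apply: Or42|by apply: Or43|by apply: Or44].
      rewrite /nearb -!ltNge.
      (* An isolated coordinate vector in one of the two scalar products factors out. *)
      have zero v v' (H : T -> R) : pol [set z | M%:Z < `|z - v|] H -> M%:Z < `|v' - v| ->
         Ex (fun w => dZ v v' w * H w) = 0.
        move=> pH hv.
        rewrite (Ex_ext _ (g := fun w => \sum_k Z v k w * (Z v' k w * H w))); last first.
          by move=> w; rewrite /dotZ /dot mulr_suml; apply: eq_bigr => k _; rewrite mulrA.
        rewrite Ex_sum; last first.
          move=> k _; apply: momM; first exact: (mom_Z hX).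
          by apply: momM; [exact: (mom_Z hX)|exact: (mom_pol hX pH)].
        rewrite big1// => k _.
        rewrite (pol_far hX (J := [set v]) (K := [set z | M%:Z < `|z - v|])).
        - by rewrite (Ex_Z hX) mul0r.
        - by move=> z z' -> /=; rewrite distrC.
        - exact: pol_Z.
        - by apply: polM => //; exact: pol_Z.
      case=> -[h6 h7].
      + rewrite (Ex_ext _ (g := fun w => dZ s (t + a) w * (dZ u t w * (dZ (t + a) s' w * dZ u' t w)))).
          apply: zero => //.
          by apply: polM; [|apply: polM]; apply: pol_dZ => //=; rewrite distrC.
        by move=> w; rewrite [dZ s _ _]dZC; ring.
      + rewrite (Ex_ext _ (g := fun w => dZ u t w * (dZ (t + a) s w * (dZ (t + a) s' w * dZ u' t w)))).
          apply: zero => //.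
          by apply: polM; [|apply: polM]; apply: pol_dZ => //=; rewrite distrC.
        by move=> w; ring.
      + rewrite (Ex_ext _ (g := fun w => dZ s' (t + a) w * (dZ u' t w * (dZ (t + a) s w * dZ u t w)))).
          apply: zero => //.
          by apply: polM; [|apply: polM]; apply: pol_dZ => //=; rewrite distrC.
        by move=> w; rewrite [dZ s' _ _]dZC; ring.
      + rewrite (Ex_ext _ (g := fun w => dZ u' t w * (dZ (t + a) s' w * (dZ (t + a) s w * dZ u t w)))).
          apply: zero => //.
          by apply: polM; [|apply: polM]; apply: pol_dZ => //=; rewrite distrC.
        by move=> w; ring.
  apply: (@le_trans _ _ (((3 * g) * (3 * g)) * ((4 / N ^+ 2) ^+ 2 * (2 * (N * (2 * m1)) ^+ 2)))).
    rewrite ler_wpM2l ?mulr_ge0//; apply: (le_trans (sum_pair2 M he)).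
    rewrite ler_wpM2l ?sqr_ge0// ler_wpM2l// lerXn2r ?nnegrE ?mulr_ge0//.
    by rewrite ler_wpM2l// dbl_le.
  by rewrite /B le_eqVlt; apply/orP; left; apply/eqP; field.
have := Ex_avg (c := fun=> N^-1) mf B0 (fun i _ => fB i).
rewrite sumr_const card_ord normfV (gtr0_norm N0) -[_^-1 *+ n]mulr_natl mulfV// expr1n mulr1.
by [].
Qed.

End NearAndMean.

(** The constant 32 * 121 * 27 of the near pairs, times 1000 to absorb all other contributions. *)
Definition tr_hat_cst (R : realType) : R := 32 * (121 * (27 * 1000)).

(** Here z and z' stand for (m/N)^2 g^2 and (m/N)^2 q, and the s_i for the other terms of the error
    bound; in these variables the comparison is linear. *)
Lemma assembly_arith (R : realType) (z z' s1 s3 s4 s5 s6 u7 u8 : R) :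
  0 <= z -> 0 <= z' -> 0 <= s1 -> 0 <= s3 -> 0 <= s4 -> 0 <= s5 -> 0 <= s6 ->
  u7 <= 576 * z + 46 * s4 + 49 * s5 ->
  u8 <= 484 * (16 * (576 * z + 4 * s4 + 49 * s5 + 14 * s6) + 192 * s3) ->
  2 * (2 * (2 * (48 * s1 + 48 * s1) + 2 * (288 * (40 * z + 16 * z') + 32 * (121 * (27 * s3))))
     + 2 * (2 * (9 * (128 * z) + 9 * (128 * z)) + 2 * (8 * u7 + u8)))
  <= tr_hat_cst R * (s1 + (z + z') + s3 + s4 + s5 + s6).
Proof. by rewrite /tr_hat_cst; lra. Qed.

Lemma assembly_bound (R : realType) (g q L k N m be ga : R) (U : R -> R) :
  0 <= g -> 0 <= q -> 0 <= L -> 0 <= k -> 0 < N -> 1 <= m -> 100 * m <= N ->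
  be = 24 * (m * g / N) -> ga = 7 * L ->
  (forall al, U al = be * be + 2 * (al * ga) + 2 * (be * ga) + ga * ga) ->
  2 * (2 * (2 * (48 * (q * m / N) + 48 * (q * m / N))
       + 2 * ((40 * g ^+ 2 + 16 * q) * (288 * (m ^+ 2 / N ^+ 2))
              + 32 * (121 * (27 * (k * g ^+ 2 * m ^+ 3 / N ^+ 3)))))
     + 2 * (2 * (9 * (128 * (g ^+ 2 * m ^+ 2 / N ^+ 2)) + 9 * (128 * (g ^+ 2 * m ^+ 2 / N ^+ 2)))
       + 2 * (8 * U (3 * g) + (16 * U (k * g) + 8 * (k * g * be)) * (22 * (m / N)) ^+ 2)))
  <= tr_hat_cst R * (q * m / N + m ^+ 2 * (g ^+ 2 + q) / N ^+ 2 + k * g ^+ 2 * m ^+ 3 / N ^+ 3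
             + g * L + L ^+ 2 + k * g * L * m ^+ 2 / N ^+ 2).
Proof.
move=> g0 q0 L0 k0 N0 m1 mN be_def ga_def UE.
have Nn := lt0r_neq0 N0.
pose r := m / N.
have r0 : 0 <= r by rewrite divr_ge0// ?(ltW N0)//; lra.
have r1 : r <= 1 / 100 by rewrite ler_pdivrMr//; lra.
have rr : 0 <= r ^+ 2 by exact: sqr_ge0.
have r2 : r ^+ 2 <= 1 by nra.
clear m1 mN.
have pm A : 0 <= A -> A * r ^+ 2 <= A by move=> A0; apply: ler_piMr.
have -> : q * m / N = q * r by rewrite mulrA.
have -> : m ^+ 2 / N ^+ 2 = r ^+ 2 by rewrite /r; field.
have -> : k * g ^+ 2 * m ^+ 3 / N ^+ 3 = k * g ^+ 2 * r ^+ 3 by rewrite /r; field.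
have -> : k * g * L * m ^+ 2 / N ^+ 2 = k * g * L * r ^+ 2 by rewrite /r; field.
have -> : g ^+ 2 * m ^+ 2 / N ^+ 2 = r ^+ 2 * g ^+ 2 by rewrite /r; field.
have -> : m ^+ 2 * (g ^+ 2 + q) / N ^+ 2 = r ^+ 2 * g ^+ 2 + r ^+ 2 * q by rewrite /r; field.
rewrite -/r.
have eb : be = 24 * (r * g) by rewrite be_def /r; field.
have -> : (40 * g ^+ 2 + 16 * q) * (288 * r ^+ 2) =
  288 * (40 * (r ^+ 2 * g ^+ 2) + 16 * (r ^+ 2 * q)) by ring.
pose s1 := q * r; pose s3 := k * g ^+ 2 * r ^+ 3; pose s4 := g * L; pose s5 := L ^+ 2.
pose s6 := k * g * L * r ^+ 2.
have t2a : 0 <= r ^+ 2 * g ^+ 2 by rewrite mulr_ge0// sqr_ge0.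
have t4 : 0 <= s4 by rewrite mulr_ge0.
have t5 : 0 <= s5 by rewrite sqr_ge0.
have bg0 : 0 <= be * ga by rewrite eb ga_def; apply: mulr_ge0; apply: mulr_ge0 => //; exact: mulr_ge0.
have u1 : be * be = 576 * (r ^+ 2 * g ^+ 2) by rewrite eb; ring.
have u2 : be * ga <= 2 * s4.
  have -> : be * ga = 168 * r * s4 by rewrite eb ga_def /s4; ring.
  by apply: ler_wpM2r => //; clear -r1; lra.
have u3 : 3 * g * ga = 21 * s4 by rewrite ga_def /s4; ring.
have u4 : ga * ga = 49 * s5 by rewrite ga_def /s5; ring.
have v1 : k * g * ga * r ^+ 2 = 7 * s6 by rewrite /s6 ga_def; ring.
have v2 : k * g * be * r ^+ 2 = 24 * s3 by rewrite /s3 eb; ring.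
apply: assembly_arith => //; rewrite -?/s1 -?/s3 -?/s4 -?/s5 -?/s6.
- by rewrite mulr_ge0.
- by rewrite mulr_ge0.
- by apply: mulr_ge0; [apply: mulr_ge0 => //; exact: sqr_ge0|exact: exprn_ge0].
- by apply: mulr_ge0 => //; apply: mulr_ge0 => //; exact: mulr_ge0.
- rewrite UE u1 u3 u4; clear -u2; lra.
- have -> : (16 * U (k * g) + 8 * (k * g * be)) * (22 * r) ^+ 2 =
    484 * (16 * ((be * be + 2 * (be * ga) + ga * ga) * r ^+ 2 + 2 * (k * g * ga * r ^+ 2))
      + 8 * (k * g * be * r ^+ 2)) by rewrite !UE; ring.
  rewrite v1 v2 u1 u4.
  have : (576 * (r ^+ 2 * g ^+ 2) + 2 * (be * ga) + 49 * s5) * r ^+ 2 <=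
     576 * (r ^+ 2 * g ^+ 2) + 4 * s4 + 49 * s5.
    apply: (le_trans (pm _ _)); first by clear -t2a bg0 t5; lra.
    by clear -u2; lra.
  by move=> h; clear -h; lra.
Qed.

(** * The mean square error of a trace estimator *)

Section Assembly.
Context (R : realType) (d : measure_display) (T : measurableType d).
Variable P : probability T R.
Local Notation Ex := (Expect P).
Local Notation mom := (mom P).
Variables (p : nat) (X : int -> T -> 'cV[R]_p) (M : nat) (mu : 'cV[R]_p).
Variable Gamma : int -> 'M[R]_p.
Hypothesis hX : gaussian_mdep_process P X M mu Gamma.
Local Notation Z := (centred X mu).
Implicit Types (J K : set int).
Variable n : nat.
Hypothesis hn : (100 * M.+1 <= n)%N.
Variables (g q L : R).
Hypothesis hg : forall h, `|h| <= M%:Z -> \sum_i \sum_j Gamma h i j ^+ 2 <= g.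
Hypothesis hL : dotv mu (Gamma 0 *m mu) <= L.
Local Notation tm := (@obs_at n).
Local Notation m1 := (M.+1%:R : R).
Local Notation N := (n%:R : R).
Local Notation p1 := (p.+1%:R : R).
Hypothesis hq : forall h1 h2 h3 h4 : int,
  `|h1| <= M%:Z -> `|h2| <= M%:Z -> `|h3| <= M%:Z -> `|h4| <= M%:Z ->
  `|\tr (Gamma h1 *m Gamma h2 *m Gamma h3 *m Gamma h4)| <= q.
Local Notation A0 := (main_factor X mu).
Local Notation A1 := (mean_factor X M mu n).
Local Notation A2 := (mu_factor X M mu n).
Local Notation quad := (Zquad X mu).
Local Notation dot4_cst := (dot4_cst R).
Local Notation II := ('I_n * 'I_n)%type.

Lemma Ex_sqD (f h : T -> R) u v : mom f -> mom h ->
  Ex (fun w => f w ^+ 2) <= u -> Ex (fun w => h w ^+ 2) <= v ->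
  Ex (fun w => (f w + h w) ^+ 2) <= 2 * (u + v).
Proof.
move=> mf mh fu hv.
apply: (@le_trans _ _ (Ex (fun w => 2 * (f w ^+ 2 + h w ^+ 2)))).
  apply: Ex_le; first by apply: momX; exact: momD.
    by apply: momZ; apply: momD; exact: momX.
  by move=> w; have := sqr_ge0 (f w - h w); nra.
rewrite ExZ; last by apply: momD; exact: momX.
by rewrite ExD; [lra|exact: momX|exact: momX].
Qed.

Lemma Ex_sqN (f : T -> R) u :
  Ex (fun w => f w ^+ 2) <= u -> Ex (fun w => (- f w) ^+ 2) <= u.
Proof. by apply: le_trans; rewrite (Ex_ext _ (g := fun w => f w ^+ 2))// => w; rewrite sqrrN. Qed.

Variables (a b : int).
Hypotheses (ha : `|a| <= M%:Z) (hb : `|b| <= M%:Z).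
Let tau := \tr (Gamma a *m Gamma b).

Let a0 (x : II) := A0 a (tm x.1) (tm x.2).
Let b0 (x : II) := A0 b (tm x.2) (tm x.1).
Let a1 (x : II) := A1 a b (tm x.1) (tm x.2).
Let b1 (x : II) := A1 b a (tm x.2) (tm x.1).
Let a2 (x : II) := A2 a b (tm x.1) (tm x.2).
Let b2 (x : II) := A2 b a (tm x.2) (tm x.1).

Let ma0 x : mom (a0 x). Proof. exact: (mom_dZ hX). Qed.
Let mb0 x : mom (b0 x). Proof. exact: (mom_dZ hX). Qed.
Let ma1 x : mom (a1 x). Proof. exact: (mom_A1 hX). Qed.
Let mb1 x : mom (b1 x). Proof. exact: (mom_A1 hX). Qed.
Let ma2 x : mom (a2 x). Proof. exact: (mom_A2 hX). Qed.
Let mb2 x : mom (b2 x). Proof. exact: (mom_A2 hX). Qed.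

(** [RF] collects the products bounded without cancellation: those with a factor from mu, and the
    product of the two mean corrections. The products of a main factor with a mean correction are
    treated by [mean_part] for far pairs, and are added to [RF] in [RN] only for near pairs. *)
Let RF x w := ((a1 x w * b1 x w + a0 x w * b2 x w) + (a2 x w * b0 x w + - (a1 x w * b2 x w)))
  + (- (a2 x w * b1 x w) + a2 x w * b2 x w).
Let RN x w := RF x w + (- (a0 x w * b1 x w) + - (a1 x w * b0 x w)).

Let mRF x : mom (RF x).
Proof. by do ![apply: momD|apply: momN|apply: momM] => //. Qed.
Let mRN x : mom (RN x).
Proof. by do ![apply: momD|apply: momN|apply: momM] => //. Qed.

Let be := 24 * (m1 * g / N).
Let ga := 7 * L.

Let be0 : 0 <= be.
Proof. by have g0 := g_ge0 hg; rewrite /be mulr_ge0// divr_ge0// mulr_ge0. Qed.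
Let ga0 : 0 <= ga.
Proof. by have L0 := L_ge0 hX hL; rewrite /ga mulr_ge0. Qed.

Let RF_bound al x : 0 <= al -> Ex (fun w => a0 x w ^+ 4) <= al ^+ 2 ->
  Ex (fun w => b0 x w ^+ 4) <= al ^+ 2 ->
  Ex (fun w => RF x w ^+ 2) <= 8 * (be * be + 2 * (al * ga) + 2 * (be * ga) + ga * ga).
Proof.
move=> al0 ha0 hb0.
have ha1 : Ex (fun w => a1 x w ^+ 4) <= be ^+ 2 by exact: (A1_bound hX hn hg).
have hb1 : Ex (fun w => b1 x w ^+ 4) <= be ^+ 2 by exact: (A1_bound hX hn hg).
have ha2 : Ex (fun w => a2 x w ^+ 4) <= ga ^+ 2 by exact: (A2_bound hX hn hL).
have hb2 : Ex (fun w => b2 x w ^+ 4) <= ga ^+ 2 by exact: (A2_bound hX hn hL).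
have p11 : Ex (fun w => (a1 x w * b1 x w) ^+ 2) <= be * be by exact: (Ex_sqM (ma1 x) (mb1 x) be0 be0 ha1 hb1).
have p02 : Ex (fun w => (a0 x w * b2 x w) ^+ 2) <= al * ga by exact: (Ex_sqM (ma0 x) (mb2 x) al0 ga0 ha0 hb2).
have p20 : Ex (fun w => (a2 x w * b0 x w) ^+ 2) <= ga * al by exact: (Ex_sqM (ma2 x) (mb0 x) ga0 al0 ha2 hb0).
have p12 : Ex (fun w => (- (a1 x w * b2 x w)) ^+ 2) <= be * ga
  by apply: Ex_sqN; exact: (Ex_sqM (ma1 x) (mb2 x) be0 ga0 ha1 hb2).
have p21 : Ex (fun w => (- (a2 x w * b1 x w)) ^+ 2) <= ga * be
  by apply: Ex_sqN; exact: (Ex_sqM (ma2 x) (mb1 x) ga0 be0 ha2 hb1).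
have p22 : Ex (fun w => (a2 x w * b2 x w) ^+ 2) <= ga * ga by exact: (Ex_sqM (ma2 x) (mb2 x) ga0 ga0 ha2 hb2).
have M11 := momM (ma1 x) (mb1 x). have M02 := momM (ma0 x) (mb2 x).
have M20 := momM (ma2 x) (mb0 x). have M12 := momN (momM (ma1 x) (mb2 x)).
have M21 := momN (momM (ma2 x) (mb1 x)). have M22 := momM (ma2 x) (mb2 x).
have := Ex_sqD (momD (momD M11 M02) (momD M20 M12)) (momD M21 M22)
  (Ex_sqD (momD M11 M02) (momD M20 M12) (Ex_sqD M11 M02 p11 p02) (Ex_sqD M20 M12 p20 p12))
  (Ex_sqD M21 M22 p21 p22).
rewrite -/(RF x) => h; apply: (le_trans h).
have := mulr_ge0 al0 ga0; have := mulr_ge0 be0 ga0; have := mulr_ge0 be0 be0.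
have := mulr_ge0 ga0 ga0; rewrite (mulrC ga al) (mulrC ga be).
move: (be * be) (al * ga) (be * ga) (ga * ga) => *; lra.
Qed.

Let RN_bound al x : 0 <= al -> Ex (fun w => a0 x w ^+ 4) <= al ^+ 2 ->
  Ex (fun w => b0 x w ^+ 4) <= al ^+ 2 ->
  Ex (fun w => RN x w ^+ 2) <= 16 * (be * be + 2 * (al * ga) + 2 * (be * ga) + ga * ga)
     + 8 * (al * be).
Proof.
move=> al0 ha0 hb0.
have ha1 : Ex (fun w => a1 x w ^+ 4) <= be ^+ 2 by exact: (A1_bound hX hn hg).
have hb1 : Ex (fun w => b1 x w ^+ 4) <= be ^+ 2 by exact: (A1_bound hX hn hg).
have p01 : Ex (fun w => (- (a0 x w * b1 x w)) ^+ 2) <= al * be by apply: Ex_sqN; exact: Ex_sqM.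
have p10 : Ex (fun w => (- (a1 x w * b0 x w)) ^+ 2) <= be * al by apply: Ex_sqN; exact: Ex_sqM.
have M01 := momN (momM (ma0 x) (mb1 x)). have M10 := momN (momM (ma1 x) (mb0 x)).
have := Ex_sqD (mRF x) (momD M01 M10) (RF_bound al0 ha0 hb0) (Ex_sqD M01 M10 p01 p10).
rewrite -/(RN x) => h; apply: (le_trans h).
rewrite (mulrC be al); move: (be * be) (al * ga) (be * ga) (ga * ga) (al * be) => *; lra.
Qed.

Let cA (x : II) : R := (card_A n M a b)%:R^-1 * (in_A n M a b (tm x.1) (tm x.2))%:R.
Let nr (x : II) := nearb (5 * M.+1) (tm x.1) (tm x.2).
Let cF (x : II) : R := cA x * (~~ nr x)%:R.
Let cN (x : II) : R := cA x * (nr x)%:R.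

Let cA0 x : 0 <= cA x. Proof. by rewrite mulr_ge0 ?invr_ge0. Qed.
Let cF0 x : 0 <= cF x. Proof. by rewrite mulr_ge0. Qed.
Let cN0 x : 0 <= cN x. Proof. by rewrite mulr_ge0. Qed.

Let cA_le x : cA x <= 2 / N ^+ 2.
Proof.
apply: le_trans (card_Ainv R hn ha hb); rewrite /cA.
by case: (in_A _ _ _ _ _ _); rewrite ?mulr1 ?mulr0 ?invr_ge0.
Qed.

Let cF_le x : `|cF x| <= 2 / N ^+ 2.
Proof.
rewrite ger0_norm//; apply: le_trans (cA_le x); rewrite /cF.
by case: (nr x); rewrite ?mulr1 ?mulr0.
Qed.

Let cN_le x : `|cN x| <= 2 / N ^+ 2 * (nr x)%:R.
Proof. by rewrite ger0_norm// /cN ler_wpM2r. Qed.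

Let cA_sum : \sum_x cA x = 1.
Proof. by rewrite /cA -mulr_sumr -card_AE mulVf// gt_eqF// card_A_gt0. Qed.

Let cF_sum : \sum_x `|cF x| <= 1.
Proof.
rewrite -cA_sum; apply: ler_sum => x _; rewrite ger0_norm// /cF.
by case: (nr x); rewrite ?mulr1 ?mulr0.
Qed.

Let cN_sum : \sum_x `|cN x| <= 22 * (m1 / N).
Proof.
have N0 := N_gt0 R hn.
apply: (le_trans (ler_sum _ (fun x _ => cN_le x))).
rewrite -mulr_sumr.
have : \sum_(x : II) (nr x)%:R <= N * (11 * m1).
  rewrite -(pair_big xpredT xpredT (fun i j => (nearb (5 * M.+1) (tm i) (tm j))%:R))/=.
  apply: (@le_trans _ _ (\sum_(i < n) (11 * m1))).
    apply: ler_sum => i _; apply: (le_trans (@count_near_r n R (5 * M.+1) (tm i))).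
    by rewrite -natrM ler_nat; clear; lia.
  by rewrite sumr_const card_ord -[leLHS]mulr_natl.
move=> h; apply: (@le_trans _ _ (2 / N ^+ 2 * (N * (11 * m1)))).
  by rewrite ler_wpM2l// divr_ge0// sqr_ge0.
by rewrite le_eqVlt; apply/orP; left; apply/eqP; field; rewrite gt_eqF.
Qed.

Let cF_nz x : cF x != 0 -> ~~ nr x /\ in_A n M a b (tm x.1) (tm x.2).
Proof.
rewrite /cF /cA; case: (nr x); rewrite ?mulr0 ?eqxx//=; case: (in_A _ _ _ _ _ _) => //.
by rewrite mulr0 mul0r eqxx.
Qed.

Let cN_nz x : cN x != 0 -> in_A n M a b (tm x.1) (tm x.2).
Proof.
by rewrite /cN /cA; case: (in_A _ _ _ _ _ _) => //; rewrite mulr0 mul0r eqxx.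
Qed.

(** On far pairs: the two projections [E1] and [E2], the degenerate remainder [E3], the mixed
    products [E5] and [E6], and the rest [E7]. On near pairs: the centred main product [E4] and
    everything else [E8]. *)
Let E1 w := \sum_x cF x * (quad a (Gamma b) (tm x.1) w - tau).
Let E2 w := \sum_x cF x * (quad b (Gamma a) (tm x.2) w - tau).
Let E3 w := \sum_x cF x * degenerate_term X mu Gamma a b (tm x.1) (tm x.2) w.
Let E4 w := \sum_x cN x * (a0 x w * b0 x w - tau).
Let E5 w := \sum_x cF x * (a0 x w * b1 x w).
Let E6 w := \sum_x cF x * (b0 x w * a1 x w).
Let E7 w := \sum_x cF x * RF x w.
Let E8 w := \sum_x cN x * RN x w.

Let decomp w : tr_hat n M (fun t => X t w) a b - tau =
  ((E1 w + E2 w) + (E3 w + E4 w)) + ((- E5 w + - E6 w) + (E7 w + E8 w)).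
Proof.
rewrite (tr_hatE X mu hn).
have e1 : tau = \sum_x cA x * tau by rewrite -mulr_suml cA_sum mul1r.
have n5 : - E5 w = \sum_x - (cF x * (a0 x w * b1 x w)) by rewrite sumrN.
have n6 : - E6 w = \sum_x - (cF x * (b0 x w * a1 x w)) by rewrite sumrN.
rewrite [in LHS]e1 n5 n6 -sumrB /E1 /E2 /E3 /E4 /E7 /E8 -!big_split.
apply: eq_bigr => x _; rewrite /= -/(cA x) /cF /cN /degenerate_term /RN /RF.
rewrite /tr_hat_term -!/(a0 x w) -!/(b0 x w) -!/(a1 x w) -!/(b1 x w) -!/(a2 x w) -!/(b2 x w).
rewrite -/tau -[dotZ _ _ (tm x.1 + a) _ w]/(a0 x w) -[dotZ _ _ (tm x.2 + b) _ w]/(b0 x w).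
move: (quad _ _ _ _) (quad _ _ _ _) (a0 x w) (b0 x w) (a1 x w) (b1 x w) (a2 x w) (b2 x w).
by case: (nr x) => /= *; ring.
Qed.

(** In order: the projections; the degenerate remainder and the mean corrections; the near pairs;
    the two contributions of mu; and mu on near pairs, where main factors may involve dependent
    vectors. *)
Definition tr_hat_err : R := q * m1 / N + m1 ^+ 2 * (g ^+ 2 + q) / N ^+ 2
  + dot4_cst * p1 * g ^+ 2 * m1 ^+ 3 / N ^+ 3 + g * L + L ^+ 2 + dot4_cst * p1 * g * L * m1 ^+ 2 / N ^+ 2.

Let momE1 : mom E1.
Proof. by apply: mom_sum => x _; apply: momZ; apply: momB; [exact: (mom_quad hX)|exact: mom_cst]. Qed.
Let momE2 : mom E2.
Proof. by apply: mom_sum => x _; apply: momZ; apply: momB; [exact: (mom_quad hX)|exact: mom_cst]. Qed.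
Let momE3 : mom E3.
Proof. by apply: mom_sum => x _; apply: momZ; exact: (mom_degenerate hX). Qed.
Let momE4 : mom E4.
Proof. by apply: mom_sum => x _; apply: momZ; apply: momB; [exact: momM|exact: mom_cst]. Qed.
Let momE5 : mom E5. Proof. by apply: mom_sum => x _; apply: momZ; exact: momM. Qed.
Let momE6 : mom E6. Proof. by apply: mom_sum => x _; apply: momZ; exact: momM. Qed.
Let momE7 : mom E7. Proof. by apply: mom_sum => x _; exact: momZ. Qed.
Let momE8 : mom E8. Proof. by apply: mom_sum => x _; exact: momZ. Qed.

Lemma mom_tr_hat : mom (fun w => tr_hat n M (fun t => X t w) a b).
Proof.
apply: (mom_ext (f := fun w => (((E1 w + E2 w) + (E3 w + E4 w)) + ((- E5 w + - E6 w) + (E7 w + E8 w))) + tau)).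
  by move=> w; rewrite -decomp subrK.
by apply: momD; [do ![apply: momD|apply: momN] => //|exact: mom_cst].
Qed.

(** [E2] and [E6] are [E1] and [E5] with (t,a) and (s,b) exchanged, so their bounds follow by
    transposing the weights. *)
Let swap (x : II) : II := (x.2, x.1).

Let sum_swap (F : II -> R) : \sum_x F x = \sum_x F (swap x).
Proof.
rewrite (reindex swap)//; exists swap; by case.
Qed.

Let bE2 : Ex (fun w => E2 w ^+ 2) <= 48 * (q * m1 / N).
Proof.
have := lin_part hX hn hL hq hb ha (c := fun x => cF (swap x)) (fun x => cF_le _).
rewrite (Ex_ext _ (g := fun w => E2 w ^+ 2))// => w; congr (_ ^+ 2).
by rewrite /E2 sum_swap; apply: eq_bigr => x _ /=; rewrite /tau mxtrace_mulC.
Qed.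

Let bE6 : Ex (fun w => E6 w ^+ 2) <= 9 * (128 * (g ^+ 2 * m1 ^+ 2 / N ^+ 2)).
Proof.
have := mean_part hX hn hg hb ha (c := fun x => cF (swap x)) (fun x => cF_le _).
rewrite (Ex_ext _ (g := fun w => E6 w ^+ 2)).
  by apply => x /cF_nz[+ _]; rewrite /nr /swap /= nearbC.
by move=> w; congr (_ ^+ 2); rewrite /E6 sum_swap.
Qed.

Let far_al x : cF x != 0 -> Ex (fun w => a0 x w ^+ 4) <= (3 * g) ^+ 2 /\
  Ex (fun w => b0 x w ^+ 4) <= (3 * g) ^+ 2.
Proof.
move=> /cF_nz[+ _]; rewrite /nr /nearb -ltNge /a0 /b0 => h.
have [h1 h2] : M%:Z < `|tm x.1 + a - tm x.2| /\ M%:Z < `|tm x.2 + b - tm x.1|.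
  move: (tm x.1) (tm x.2) h => t s h; clear -ha hb h; split; lia.
by split; exact: (dZ_far hX hg).
Qed.

Lemma tr_hat_var :
  Ex (fun w => (tr_hat n M (fun t => X t w) a b - tau) ^+ 2)
    <= tr_hat_cst R * tr_hat_err.
Proof.
rewrite /tr_hat_err; have g0 := g_ge0 hg; have L0 := L_ge0 hX hL; have N0 := N_gt0 R hn.
have q0 := q_ge0 hq; have K3 := dot4_cst_ge3 R; have m1' := m1_ge1 R M; have mN := m1_le R hn.
have p1' := p1_ge1 R p.
have Nn : N != 0 by rewrite gt_eqF.
rewrite (Ex_ext _ (g := fun w => (((E1 w + E2 w) + (E3 w + E4 w)) +
   ((- E5 w + - E6 w) + (E7 w + E8 w))) ^+ 2)); last by move=> w; rewrite decomp.
have B1 : Ex (fun w => E1 w ^+ 2) <= 48 * (q * m1 / N) by exact: (lin_part hX hn hL hq).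
have B3 : Ex (fun w => E3 w ^+ 2) <= (40 * g ^+ 2 + 16 * q) * (288 * (m1 ^+ 2 / N ^+ 2)).
  by apply: (deg_part hX hn hg hL hq) => // x /cF_nz[].
have B4 : Ex (fun w => E4 w ^+ 2) <= 32 * (121 * (27 * (dot4_cst * p1 * g ^+ 2 * m1 ^+ 3 / N ^+ 3))).
  exact: (near_part hX hn hg hL ha hb cN_le cN_nz).
have B5 : Ex (fun w => (- E5 w) ^+ 2) <= 9 * (128 * (g ^+ 2 * m1 ^+ 2 / N ^+ 2)).
  apply: Ex_sqN; apply: (mean_part hX hn hg ha hb cF_le).
  by move=> x /cF_nz[].
have B6 : Ex (fun w => (- E6 w) ^+ 2) <= 9 * (128 * (g ^+ 2 * m1 ^+ 2 / N ^+ 2)).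
  exact: Ex_sqN.
pose U al := be * be + 2 * (al * ga) + 2 * (be * ga) + ga * ga.
have U0 al : 0 <= al -> 0 <= U al.
  by move=> al0; rewrite /U !addr_ge0// ?mulr_ge0// mulr_ge0.
have al0 : 0 <= 3 * g by rewrite mulr_ge0.
have al1 : 0 <= dot4_cst * p1 * g by rewrite !mulr_ge0//; lra.
have B7 : Ex (fun w => E7 w ^+ 2) <= 8 * U (3 * g).
  apply: (@le_trans _ _ (8 * U (3 * g) * (\sum_x `|cF x|) ^+ 2)).
    apply: Ex_avg => //; first by rewrite mulr_ge0// U0.
    by move=> x /far_al[h1 h2]; exact: RF_bound.
  rewrite ler_piMr//; first by rewrite mulr_ge0// U0.
  by rewrite exprn_ile1// sumr_ge0.
have B8 : Ex (fun w => E8 w ^+ 2) <= (16 * U (dot4_cst * p1 * g) + 8 * (dot4_cst * p1 * g * be)) * (22 * (m1 / N)) ^+ 2.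
  have V0 : 0 <= 16 * U (dot4_cst * p1 * g) + 8 * (dot4_cst * p1 * g * be).
    by rewrite addr_ge0// mulr_ge0 ?U0// mulr_ge0.
  apply: (@le_trans _ _ ((16 * U (dot4_cst * p1 * g) + 8 * (dot4_cst * p1 * g * be)) * (\sum_x `|cN x|) ^+ 2)).
    apply: Ex_avg => //.
    by move=> x _; apply: RN_bound => //; exact: (dZ_dep hX hg).
  apply: ler_wpM2l => //; apply: lerXn2r => //; rewrite nnegrE ?sumr_ge0//.
have MM : mom (fun w => - E5 w) by exact: momN.
have MM' : mom (fun w => - E6 w) by exact: momN.
(* The eight pieces are combined by a balanced tree of depth three, each level costing a factor
   2. *)
have := Ex_sqD (momD (momD momE1 momE2) (momD momE3 momE4)) (momD (momD MM MM') (momD momE7 momE8))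
  (Ex_sqD (momD momE1 momE2) (momD momE3 momE4) (Ex_sqD momE1 momE2 B1 bE2) (Ex_sqD momE3 momE4 B3 B4))
  (Ex_sqD (momD MM MM') (momD momE7 momE8) (Ex_sqD MM MM' B5 B6) (Ex_sqD momE7 momE8 B7 B8)).
move=> h; apply: (le_trans h); apply: (@assembly_bound _ _ _ _ _ _ _ be ga U) => //.
by rewrite mulr_ge0//; apply: le_trans K3.
Qed.

End Assembly.

(** * The coefficients of the quadratic form *)

Section Coefficients.
Variables (R : realType) (n M : nat).
Hypothesis hn : (100 * M.+1 <= n)%N.
Local Notation tm := (@obs_at n).
Local Notation m1 := (M.+1%:R : R).
Local Notation N := (n%:R : R).
Local Notation Th := (Theta R n M).

Let N0 : 0 < N. Proof. exact: N_gt0 hn. Qed.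
Let Nn : N != 0. Proof. by rewrite gt_eqF. Qed.

Lemma count_eq (x : int) : \sum_(s < n) (tm s == x)%:R <= 1 :> R.
Proof.
apply: le_trans (@count_near n R 0 x); apply: ler_sum => s _; rewrite ler_nat /nearb.
by case: eqP => // ->; rewrite subrr normr0.
Qed.

Let E : 'M[R]_M.+1 := 1%:M - Th.

(** The diagonal correction is h/n. The other two corrections enter with opposite signs: the product
    term is at most 2/n, and each row t of the double sum is at most 4, since [|t - s| = k] has at
    most two solutions s. *)
Lemma Theta_dev h k : `|E h k| <= (h == k)%:R * (m1 / N) + 4 / N.
Proof.
have hN : (h%:R : R) <= m1 by rewrite ler_nat ltnW// ltn_ord.
have kN : (k%:R : R) <= m1 by rewrite ler_nat ltnW// ltn_ord.
have mN := m1_le R hn; have m1' := m1_ge1 R M.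
rewrite /E !mxE.
set A := \sum_(_ <= t < _) _; set B := _ * ((2 - _) / _).
have A0 : 0 <= A by apply: sumr_ge0 => t _; apply: sumr_ge0 => s _; exact: addr_ge0.
have AN : A <= N * 4.
  have row (t : int) : \sum_(1 <= s < n.+1) ((`|t - s%:Z| == k%:Z)%:R : R) <= 2.
    rewrite sum_obs; apply: (@le_trans _ _ (\sum_(s < n) ((tm s == t - k%:Z)%:R + (tm s == t + k%:Z)%:R))).
      apply: ler_sum => s _; rewrite -natrD ler_nat -/(tm s).
      case: (altP eqP) => // e.
      have [h1|h1] : tm s = t - k%:Z \/ tm s = t + k%:Z by move: (tm s) e => v e; clear -e; lia.
        by rewrite h1 eqxx.
      by rewrite h1 eqxx addn1.
    rewrite big_split/=; have := count_eq (t - k%:Z); have := count_eq (t + k%:Z); lra.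
  apply: (@le_trans _ _ (\sum_(1 <= t < (n - h).+1) (4 : R))).
    apply: ler_sum => t _; rewrite big_split/=.
    have := row t; have := row (t%:Z + h%:Z); lra.
  rewrite sumr_const_nat -[leLHS]mulr_natl ler_wpM2r// ler_nat; lia.
have hh : 0 <= h%:R / N <= 1 by rewrite divr_ge0//= ler_pdivrMr// mul1r; lra.
have kk : 0 <= k%:R / N <= 1 by rewrite divr_ge0//= ler_pdivrMr// mul1r; lra.
have B0 : 0 <= B <= 2 / N.
  rewrite /B; move: hh kk => /andP[h1 h2] /andP[k1 k2].
  have d0 : 0 <= (2 - (k == 0 :> nat)%:R : R) / N <= 2 / N.
    rewrite divr_ge0 ?(ltW N0)//=; last by case: (_ == _) => /=; lra.
    by rewrite ler_wpM2r ?invr_ge0 ?(ltW N0)//; case: (_ == _) => /=; lra.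
  move: d0 => /andP[d0 d1].
  have u : 0 <= (1 - h%:R / N) * (1 - k%:R / N) <= 1 by apply/andP; split; nra.
  move: u => /andP[u0 u1]; rewrite mulr_ge0//=.
  by apply: le_trans d1; rewrite ler_piMl.
have A2 : 0 <= (N ^+ 2)^-1 * A <= 4 / N.
  rewrite mulr_ge0 ?invr_ge0 ?sqr_ge0//=.
  have -> : 4 / N = (N ^+ 2)^-1 * (N * 4) by field.
  by rewrite ler_wpM2l// invr_ge0 sqr_ge0.
have hm : h%:R / N <= m1 / N by rewrite ler_wpM2r// invr_ge0 ltW.
have e4 : 4 / N = 2 * (2 / N) by field.
move: B0 A2 hh => /andP[B0 B2] /andP[A1 A2] /andP[h0 h1].
have d0 : 0 <= ((h == k)%:R : R) by [].
have d1 : ((h == k)%:R : R) <= 1 by case: (_ == _).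
rewrite ler_norml; apply/andP; split; last by nra.
by nra.
Qed.

Lemma Theta_dev_col k : \sum_h `|E h k| <= 5 * (m1 / N).
Proof.
apply: (le_trans (ler_sum _ (fun h _ => Theta_dev h k))).
rewrite big_split/= -mulr_suml sumr_const card_ord -[4 / N *+ _]mulr_natl.
have -> : \sum_h ((h == k)%:R : R) = 1.
  by rewrite (bigD1 k)//= eqxx big1 ?addr0// => i /negbTE ->.
by rewrite le_eqVlt; apply/orP; left; apply/eqP; ring.
Qed.

(* Neumann series in the form of an a priori bound: Theta = 1 - E and the column
   sums of E are at most 1/20. *)
Lemma perturb_bound (v w : 'rV[R]_M.+1) W : v = w + v *m E ->
  (forall k, `|w 0 k| <= W) -> forall k, `|v 0 k| <= 2 * W.
Proof.
move=> e hw k.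
have [k0 _ H] := arg_maxP (fun k => `|v 0 k|) (isT : xpredT (ord0 : 'I_M.+1)).
apply: (le_trans (H k isT)).
have mN := m1_le R hn.
have col := Theta_dev_col k0.
have h1 : `|(v *m E) 0 k0| <= `|v 0 k0| * (5 * (m1 / N)).
  rewrite mxE; apply: (le_trans (ler_norm_sum _ _ _)).
  apply: le_trans (ler_wpM2l (normr_ge0 _) col).
  rewrite mulr_sumr; apply: ler_sum => h _; rewrite normrM ler_wpM2r//; exact: H.
have h2 : `|v 0 k0| <= `|w 0 k0| + `|(v *m E) 0 k0|.
  by rewrite [in leLHS]e mxE; exact: ler_normD.
have h3 : m1 / N <= 1 / 100 by rewrite ler_pdivrMr//; lra.
have := hw k0; have := normr_ge0 (v 0 k0); move: h1 h2 h3.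
by move: (m1 / N) => r; nra.
Qed.

(** A vector in the left kernel satisfies v = v E, and the a priori bound with w = 0 makes it
    vanish. *)
Lemma Theta_unit : Th \in unitmx.
Proof.
rewrite -row_free_unit; apply: inj_row_free => v hv.
have e : v = 0 + v *m E by rewrite add0r /E mulmxBr mulmx1 hv subr0.
have H := perturb_bound (W := 0) e (fun k => _).
apply/rowP => k; apply/eqP; rewrite mxE -normr_le0 -(mulr0 2); apply: H => {}k.
by rewrite mxE normr0.
Qed.

Definition trOmega_coef : 'rV[R]_M.+1 := (bvec R n M)^T *m invmx Th.

Let trOmega_coefE : trOmega_coef = (bvec R n M)^T + trOmega_coef *m E.
Proof.
by rewrite /E mulmxBr mulmx1 /trOmega_coef -mulmxA (mulVmx Theta_unit) mulmx1 addrC subrK.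
Qed.

Lemma bvec_le k : `|(bvec R n M)^T 0 k| <= 2.
Proof.
have hk : 0 <= (k%:R : R) / N <= 1.
  rewrite divr_ge0//= ler_pdivrMr// mul1r ler_nat.
  by apply: leq_trans hn; have := ltn_ord k; clear; lia.
rewrite !mxE; case: (_ == _); first by rewrite normr1; lra.
by move: hk => /andP[h0 h1]; rewrite ger0_norm; nra.
Qed.

Lemma trOmega_coef_le k : `|trOmega_coef 0 k| <= 4.
Proof.
have := perturb_bound trOmega_coefE bvec_le k.
by have -> : 2 * 2 = 4 :> R by ring.
Qed.

(** The difference is [trOmega_coef *m E], with entries of [trOmega_coef] at most 4 and column sums
    of [E] at most 5(M + 1)/n. *)
Lemma trOmega_coef_dev k : `|trOmega_coef 0 k - bvec R n M k 0| <= 20 * (m1 / N).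
Proof.
have -> : trOmega_coef 0 k - bvec R n M k 0 = (trOmega_coef *m E) 0 k.
  by rewrite [in LHS]trOmega_coefE mxE [(bvec R n M)^T 0 k]mxE addrC addrK.
rewrite mxE; apply: (le_trans (ler_norm_sum _ _ _)).
apply: (@le_trans _ _ (4 * \sum_h `|E h k|)).
  by rewrite mulr_sumr; apply: ler_sum => h _; rewrite normrM ler_wpM2r// trOmega_coef_le.
by have := Theta_dev_col k; lra.
Qed.

End Coefficients.

Lemma dotv_lin (R : realType) (p : nat) (I J : Type) (r : seq I) (r' : seq J)
  (a : I -> R) (b : J -> R) (x : I -> 'cV[R]_p) (y : J -> 'cV[R]_p) :
  dotv (\sum_(i <- r) a i *: x i) (\sum_(j <- r') b j *: y j) =
  \sum_(i <- r) \sum_(j <- r') a i * b j * dotv (x i) (y j).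
Proof.
rewrite /dotv [(\sum_(i <- r) _)^T]raddf_sum/= mulmx_suml summxE; apply: eq_bigr => i _.
rewrite mulmx_sumr summxE; apply: eq_bigr => j _.
by rewrite (linearZ _ (x i)) /= -scalemxAl -scalemxAr !mxE mulrA.
Qed.

Lemma prod_dev (R : realType) (w r y z : R) : 0 <= w -> 0 <= r -> 100 * r <= 1 ->
  `|y - w| <= w * (30 * r) -> `|z - w| <= w * (30 * r) ->
  `|y * z - w ^+ 2| <= w ^+ 2 * (90 * r).
Proof.
move=> w0 r0 r1 hy hz.
have -> : y * z - w ^+ 2 = (y - w) * (z - w) + w * (y - w) + w * (z - w) by ring.
have wr : w * (30 * r) <= w by rewrite ler_piMr//; lra.
have -> : w ^+ 2 * (90 * r) = w * (w * (30 * r)) + w * (w * (30 * r)) + w * (w * (30 * r)) by ring.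
apply: (le_trans (ler_normD _ _)); rewrite normrM (ger0_norm w0) lerD//; last exact: ler_wpM2l.
apply: (le_trans (ler_normD _ _)); rewrite !normrM (ger0_norm w0) lerD//; last exact: ler_wpM2l.
by apply: ler_pM => //; exact: le_trans wr.
Qed.

(** * Asymptotics of the coefficients pi and xi *)

Section PiXi.
Variables (R : realType) (n M : nat).
Hypothesis hn : (100 * M.+1 <= n)%N.
Local Notation tm := (@obs_at n).
Local Notation m1 := (M.+1%:R : R).
Local Notation N := (n%:R : R).
Local Notation trOmega_coef := (trOmega_coef R n M).

Let N0 : 0 < N. Proof. exact: N_gt0 hn. Qed.
Let Nn : N != 0. Proof. by rewrite gt_eqF. Qed.

(** [kap t u] is the coefficient of X_u in X_t minus the sample mean, and [S h u v] that of X_u'X_v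
    in n tr of the sample autocovariance at lag h. Symmetrizing [S] gives a coefficient matrix of
    the statistic, equal to [pi_n] by uniqueness. *)
Let kap (t u : int) : R := (t == u)%:R - N^-1.
Let S (h : nat) (u v : int) : R := \sum_(1 <= t < (n - h).+1) kap (t%:Z + h%:Z) u * kap t v.

Definition pi_explicit (u v : int) : R :=
  if obs_time n u && obs_time n v then
    (N ^+ 2)^-1 * (1 - \sum_(h < M.+1) trOmega_coef 0 h * ((S h u v + S h v u) / 2))
  else 0.

Let pick_obs (V : lmodType R) (x : int -> V) (t : int) : obs_time n t ->
  \sum_(1 <= u < n.+1) (t == u)%:R *: x u = x t.
Proof.
case: t => [t|t]; last by rewrite /obs_time; lia.
move=> ht; rewrite (big_rem t)/=; last by rewrite mem_index_iota; rewrite /obs_time in ht; lia.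
rewrite eqxx scale1r big_seq big1 ?addr0// => s.
rewrite mem_rem_uniq ?iota_uniq// inE => /andP[/= st _].
by rewrite eqz_nat eq_sym (negbTE st) scale0r.
Qed.

Let centred p (x : int -> 'cV[R]_p) (t : int) : obs_time n t ->
  x t - sample_mean n x = \sum_(1 <= u < n.+1) kap t u *: x u.
Proof.
move=> ht; rewrite -{1}(pick_obs x ht) /sample_mean scaler_sumr -sumrB.
by apply: eq_bigr => u _; rewrite -scalerBl.
Qed.

Let autocovE p (x : int -> 'cV[R]_p) (h : nat) : (h <= n)%N ->
  \tr (sample_autocov n x h) =
  N^-1 * \sum_(1 <= u < n.+1) \sum_(1 <= v < n.+1) S h u v * dotv (x u) (x v).
Proof.
move=> hN; rewrite /sample_autocov mxtraceZ raddf_sum; congr (_ * _) => /=.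
rewrite (eq_big_nat _ _ (F2 := fun t : nat => \sum_(1 <= u < n.+1) \sum_(1 <= v < n.+1)
   kap (t%:Z + h%:Z) u * kap t v * dotv (x u) (x v))).
  rewrite exchange_big/=; apply: eq_bigr => u _.
  rewrite exchange_big/=; apply: eq_bigr => v _.
  by rewrite /S mulr_suml.
move=> t ht; rewrite mxtrace_mulC trace_mx11 -[_ 0 0]/(dotv (x (t%:Z + h%:Z) - sample_mean n x) (x t%:Z - sample_mean n x)).
by rewrite !centred ?dotv_lin// /obs_time; lia.
Qed.

Lemma pi_explicit_coef : Mstat_coef n M pi_explicit.
Proof.
split.
- by move=> t s; rewrite /pi_explicit andbC; under eq_bigr do rewrite addrC.
- by move=> t s /negbTE h; rewrite /pi_explicit h.
move=> p x.
pose SS h := \sum_(1 <= u < n.+1) \sum_(1 <= v < n.+1) S h u v * dotv (x u) (x v).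
have sym h : SS h = \sum_(1 <= u < n.+1) \sum_(1 <= v < n.+1) ((S h u v + S h v u) / 2) * dotv (x u) (x v).
  have e1 : SS h = \sum_(1 <= u < n.+1) \sum_(1 <= v < n.+1) S h v u * dotv (x u) (x v).
    rewrite /SS exchange_big/=; apply: eq_bigr => u _; apply: eq_bigr => v _.
    by rewrite dotvC.
  have -> : SS h = (SS h + SS h) / 2 by field.
  rewrite {2}e1 /SS -big_split/= mulr_suml; apply: eq_bigr => u _.
  rewrite -big_split/= mulr_suml; apply: eq_bigr => v _; by field.
have eO : trOmega_hat n M x = N^-1 * \sum_(h < M.+1) trOmega_coef 0 h * SS h.
  rewrite /trOmega_hat -/trOmega_coef mxE mulr_sumr; apply: eq_bigr => h _.
  rewrite [gamma_hat _ _ _ _ _]mxE autocovE; first by rewrite mulrCA.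
  by apply: leq_trans hn; have := ltn_ord h; clear; lia.
have eM : dotv (sample_mean n x) (sample_mean n x) =
   \sum_(1 <= u < n.+1) \sum_(1 <= v < n.+1) (N ^+ 2)^-1 * dotv (x u) (x v).
  rewrite /sample_mean scaler_sumr dotv_lin; apply: eq_bigr => u _; apply: eq_bigr => v _.
  by rewrite -invfM -expr2.
have eS : \sum_(h < M.+1) trOmega_coef 0 h * SS h = \sum_(1 <= u < n.+1) \sum_(1 <= v < n.+1)
    (\sum_(h < M.+1) trOmega_coef 0 h * ((S h u v + S h v u) / 2)) * dotv (x u) (x v).
  under eq_bigr do rewrite sym mulr_sumr.
  rewrite exchange_big/=; apply: eq_bigr => u _.
  under eq_bigr do rewrite mulr_sumr.
  rewrite exchange_big/=; apply: eq_bigr => v _.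
  by rewrite mulr_suml; apply: eq_bigr => h _; rewrite mulrA.
rewrite /Mstat eO eM eS mulrA mulr_sumr -sumrB.
rewrite !big_nat; apply: eq_bigr => u hu; rewrite mulr_sumr -sumrB.
rewrite !big_nat; apply: eq_bigr => v hv.
have -> : pi_explicit u v = (N ^+ 2)^-1 * (1 - \sum_(h < M.+1) trOmega_coef 0 h * ((S h u v + S h v u) / 2)).
  by rewrite /pi_explicit ifT// /obs_time; lia.
by move: (\sum_(h < _) _) (dotv _ _) => y z; field.
Qed.

Lemma pi_nE u v : pi_n R n M u v = pi_explicit u v.
Proof. exact: Mstat_coef_unique (pi_nP R n M) pi_explicit_coef u v. Qed.

(** The product of the two indicators sums to the indicator of u - v = h; the two sums involving the
    mean once are at most 1/n each, and the one involving it twice is at most 1/n with the opposite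
    sign. *)
Let S_dev h (u v : int) : (h <= n)%N -> obs_time n u -> obs_time n v ->
  `|S h u v - (u - v == h%:Z)%:R| <= 2 / N.
Proof.
move=> hN hu hv.
have SE : S h u v = \sum_(1 <= t < (n - h).+1) ((t%:Z + h%:Z == u)%:R * (t%:Z == v)%:R : R)
   - N^-1 * \sum_(1 <= t < (n - h).+1) ((t%:Z + h%:Z == u)%:R)
   - N^-1 * \sum_(1 <= t < (n - h).+1) ((t%:Z == v)%:R) + (n - h)%:R / N ^+ 2.
  have -> : (n - h)%:R / N ^+ 2 = \sum_(1 <= t < (n - h).+1) (N ^+ 2)^-1.
    by rewrite sumr_const_nat subSS subn0 -[RHS]mulr_natl.
  rewrite !mulr_sumr -!sumrB -big_split; apply: eq_bigr => t _ /=.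
  by rewrite /kap; field.
have one (x y : int) : \sum_(1 <= t < (n - h).+1) ((t%:Z + x == y)%:R : R) <= 1.
  rewrite big_add1 big_mkord.
  apply: le_trans (@count_eq R (n - h) (y - x)).
  apply: ler_sum => t _; rewrite ler_nat -/(obs_at t).
  by move: (obs_at t) => z; have -> : (z + x == y) = (z == y - x) by rewrite eq_sym -subr_eq eq_sym.
have pos (F : nat -> bool) : 0 <= \sum_(1 <= t < (n - h).+1) ((F t)%:R : R).
  by apply: sumr_ge0.
have main : \sum_(1 <= t < (n - h).+1) ((t%:Z + h%:Z == u)%:R * (t%:Z == v)%:R : R) = (u - v == h%:Z)%:R.
  case: v hv {SE} => [v|v] hv; last by rewrite /obs_time in hv; lia.
  have [e|e] := eqVneq (u - v%:Z) h%:Z.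
    rewrite (big_rem v)/=; last by rewrite mem_index_iota; rewrite /obs_time in hv hu; lia.
    have -> : (v%:Z + h%:Z == u) by rewrite -e addrC subrK.
    rewrite eqxx mulr1 big_seq big1 ?addr0// => s.
    rewrite mem_rem_uniq ?iota_uniq// inE => /andP[/= st _].
    by rewrite eqz_nat (negbTE st) mulr0.
  rewrite big1// => t _; have [->|] := eqVneq (t%:Z) v%:Z; last by rewrite mulr0.
  by rewrite mulr1; case: eqP => // e'; move: e; rewrite -e' [v%:Z + _]addrC addrK eqxx.
have n0 : \sum_(1 <= t < (n - h).+1) ((t%:Z == v)%:R : R) <= 1.
  by have := one 0 v; under eq_bigr do rewrite addr0.
have := one h%:Z u; have := pos (fun t => t%:Z + h%:Z == u); have := pos (fun t => t%:Z == v).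
rewrite SE main; move: n0.
set a := \sum_(1 <= t < _) _; set b := \sum_(1 <= t < _) _ => a1 a0 b0 b1.
have c : 0 <= (n - h)%:R / N ^+ 2 <= N^-1.
  rewrite divr_ge0 ?sqr_ge0//= ler_pdivrMr ?exprn_gt0// expr2 mulKf// ler_nat; lia.
move: c => /andP[c0 c1].
have Ni : 0 <= N^-1 by rewrite invr_ge0 ltW.
have e2 : 2 / N = N^-1 + N^-1 by field.
rewrite e2 ler_norml; apply/andP; split; nra.
Qed.

(** Within the band |u - v| <= M the indicators weighted by b sum to 1 - |u - v|/n and cancel the
    leading 1; outside it they vanish. The relative errors are 8 from replacing [S] by indicators,
    20 from replacing [trOmega_coef] by b, and 1 from |u - v|/n. *)
Lemma pi_bound u v : obs_time n u -> obs_time n v ->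
  `|pi_n R n M u v - (N ^+ 2)^-1 * (~~ nearb M u v)%:R| <= 30 * (m1 / N ^+ 3).
Proof.
move=> hu hv; rewrite pi_nE /pi_explicit hu hv/=.
pose phi h : R := ((u - v == h%:Z)%:R + (v - u == h%:Z)%:R) / 2.
set nf := ((~~ nearb M u v)%:R : R).
have hM h : (h < M.+1)%N -> (h <= n)%N by move=> hh; apply: leq_trans hn; clear -hh; lia.
have mN := m1_le R hn; have m1' := m1_ge1 R M.
have phi0 h : 0 <= phi h by rewrite divr_ge0// addr_ge0.
have e1 : `|\sum_(h < M.+1) trOmega_coef 0 h * ((S h u v + S h v u) / 2) -
    \sum_(h < M.+1) trOmega_coef 0 h * phi h| <= 8 * (m1 / N).
  rewrite -sumrB; apply: (le_trans (ler_norm_sum _ _ _)).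
  apply: (@le_trans _ _ (\sum_(h < M.+1) 4 * (2 / N))); last first.
    rewrite sumr_const card_ord -[leLHS]mulr_natl.
    by rewrite le_eqVlt; apply/orP; left; apply/eqP; ring.
  apply: ler_sum => h _; rewrite -mulrBr normrM.
  apply: ler_pM => //; first exact: trOmega_coef_le.
  have d1 := S_dev (hM h (ltn_ord h)) hu hv; have d2 := S_dev (hM h (ltn_ord h)) hv hu.
  have -> : (S h u v + S h v u) / 2 - phi h =
     ((S h u v - (u - v == h%:Z)%:R) + (S h v u - (v - u == h%:Z)%:R)) / 2.
    by rewrite /phi; field.
  rewrite normrM normfV normr_nat ler_pdivrMr//.
  by apply: (le_trans (ler_normD _ _)); lra.
have phi_sum : \sum_(h < M.+1) phi h <= 1.
  have o (x : int) : \sum_(h < M.+1) ((x == h%:Z)%:R : R) <= 1.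
    apply: le_trans (@count_eq R M.+1 (x + 1)); apply: ler_sum => h _.
    rewrite ler_nat; have -> // : (x == h%:Z) = (obs_at h == x + 1).
    by apply/eqP/eqP; rewrite /obs_at; move: (nat_of_ord h) => j; clear; lia.
  rewrite /phi -mulr_suml big_split/= ler_pdivrMr// mul1r.
  by have := o (u - v); have := o (v - u); lra.
have e2 : `|\sum_(h < M.+1) trOmega_coef 0 h * phi h - \sum_(h < M.+1) bvec R n M h 0 * phi h| <= 20 * (m1 / N).
  rewrite -sumrB; apply: (le_trans (ler_norm_sum _ _ _)).
  apply: (@le_trans _ _ (\sum_(h < M.+1) 20 * (m1 / N) * phi h)).
    apply: ler_sum => h _; rewrite -mulrBl normrM (ger0_norm (phi0 h)).
    by apply: ler_wpM2r => //; exact: trOmega_coef_dev.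
  rewrite -mulr_sumr ler_piMr// mulr_ge0// divr_ge0// ltW//.
have e3 : `|\sum_(h < M.+1) bvec R n M h 0 * phi h - (1 - nf)| <= m1 / N.
  pose k := absz (u - v).
  have kE : k%:Z = `|u - v| by rewrite /k; clear; lia.
  have [kM|kM] := boolP (M%:Z < `|u - v|).
    have -> : nf = 1 by rewrite /nf /nearb -ltNge kM.
    rewrite big1 => [|h _]; first by rewrite subrr subr0 normr0 divr_ge0// ltW.
    have hh := ltn_ord h.
    rewrite /phi; have -> : (u - v == h%:Z) = false by apply/negbTE; clear -kM hh; lia.
    have -> : (v - u == h%:Z) = false by apply/negbTE; clear -kM hh; lia.
    by rewrite addr0 mul0r mulr0.
  have -> : nf = 0 by rewrite /nf /nearb -ltNge (negbTE kM).
  have kM1 : (k < M.+1)%N by clear -kM kE; lia.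
  rewrite (bigD1 (Ordinal kM1))//= big1 => [|h hk]; last first.
    have hk' : (h : nat) <> k by move=> e; move: hk; rewrite -val_eqE /= e eqxx.
    rewrite /phi; have -> : (u - v == h%:Z) = false by apply/negbTE; clear -kE hk'; lia.
    have -> : (v - u == h%:Z) = false by apply/negbTE; clear -kE hk'; lia.
    by rewrite addr0 mul0r mulr0.
  rewrite addr0 subr0 mxE /= /phi.
  have [k0|k0] := eqVneq k 0%N.
    have uv : u = v by clear -kE k0; lia.
    rewrite uv subrr k0 eqxx [X in `|X|](_ : _ = 0); last by rewrite /=; field.
    by rewrite normr0 divr_ge0// ltW.
  have -> : ((u - v == k%:Z)%:R + (v - u == k%:Z)%:R : R) = 1.
    have [h1|h1] := eqVneq (u - v) k%:Z.
      have -> : (v - u == k%:Z) = false by apply/negbTE; clear -h1 k0; lia.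
      by rewrite addr0.
    have -> : (v - u == k%:Z) by clear -h1 kE; lia.
    by rewrite add0r.
  have -> : 2 * (1 - k%:R / N) * (1 / 2) - 1 = - (k%:R / N) by field.
  rewrite normrN ger0_norm ?divr_ge0 ?(ltW N0)// ler_wpM2r ?invr_ge0 ?(ltW N0)//.
  by rewrite ler_nat ltnW.
have -> : 30 * (m1 / N ^+ 3) = (N ^+ 2)^-1 * (30 * (m1 / N)) by field.
rewrite -mulrBr normrM ger0_norm ?invr_ge0 ?sqr_ge0// ler_wpM2l ?invr_ge0 ?sqr_ge0//.
move: e1 e2 e3; set A := \sum_(h < _) _; set B := \sum_(h < _) _; set C := \sum_(h < _) _.
have r0 : 0 <= m1 / N by rewrite divr_ge0// ltW.
move: (m1 / N) r0 => r r0; rewrite !ler_norml => /andP[a1 a2] /andP[b1 b2] /andP[c1 c2].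
by apply/andP; split; lra.
Qed.

(** Both coefficients in a summand are n^-2 up to O(M/n^3) as soon as (i, j) belongs to A(k, -h), so
    the count of pairs outside A applies. The constant is 90 + 5 * 12. *)
Lemma xi_bound (h k : int) : `|h| <= M%:Z -> `|k| <= M%:Z ->
  `|xi R n M h k - (N ^+ 2)^-1| <= 150 * (m1 / N ^+ 3).
Proof.
move=> hh hk.
have mN := m1_le R hn; have m1' := m1_ge1 R M.
have hnh : `|- h| <= M%:Z by rewrite normrN.
have bad := bad_A_count R n hk hnh.
pose w := (N ^+ 2)^-1.
have w0 : 0 <= w by rewrite invr_ge0 sqr_ge0.
pose r := m1 / N.
have r0 : 0 <= r by rewrite divr_ge0// ltW.
have r1 : 100 * r <= 1 by rewrite /r mulrA ler_pdivrMr// mul1r.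
have pb u v : obs_time n u -> obs_time n v -> M%:Z < `|u - v| ->
   `|pi_n R n M u v - w| <= w * (30 * r).
  move=> hu hv huv; have := pi_bound hu hv; rewrite /nearb -ltNge huv mulr1.
  by have -> : 30 * (m1 / N ^+ 3) = w * (30 * r) by rewrite /w /r; field.
have pu u v : `|pi_n R n M u v| <= 2 * w.
  have [ob|nob] := boolP (obs_time n u && obs_time n v); last first.
    by have [_ z _] := pi_nP R n M; rewrite (z _ _ nob) normr0 mulr_ge0.
  move: ob => /andP[hu hv]; have := pi_bound hu hv.
  have -> : 30 * (m1 / N ^+ 3) = w * (30 * r) by rewrite /w /r; field.
  rewrite -/w; have : w * (30 * r) <= w by rewrite ler_piMr//; lra.
  move: (_ * (30 * r)) => W; case: (nearb _ _ _) => /=; last first.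
    by rewrite mulr1 !ler_norml => hW /andP[h1 h2]; apply/andP; split; lra.
  by rewrite mulr0 subr0 => hW h1; lra.
rewrite -/w; have -> : w = \sum_(x : 'I_n * 'I_n) w ^+ 2.
  rewrite sumr_const card_prod card_ord -[RHS]mulr_natl natrM /w.
  by field.
have -> : xi R n M h k = \sum_(x : 'I_n * 'I_n)
    pi_n R n M (tm x.1) (tm x.2) * pi_n R n M (tm x.2 - h) (tm x.1 + k).
  rewrite /xi sum_obs.
  rewrite -(pair_big xpredT xpredT (fun i j => pi_n R n M (tm i) (tm j) *
      pi_n R n M (tm j - h) (tm i + k)))/=.
  by apply: eq_bigr => i _; rewrite sum_obs.
rewrite -sumrB; apply: (le_trans (ler_norm_sum _ _ _)).
apply: (@le_trans _ _ (\sum_(x : 'I_n * 'I_n) (w ^+ 2 * (90 * r) +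
    5 * w ^+ 2 * (~~ in_A n M k (- h) (tm x.1) (tm x.2))%:R))).
  apply: ler_sum => x _.
  have w2 : 0 <= w ^+ 2 * (90 * r) by rewrite mulr_ge0 ?sqr_ge0// mulr_ge0.
  have [hA|_] := boolP (in_A _ _ _ _ _ _).
    rewrite mulr0 addr0.
    move: hA; move: (tm x.1) (tm x.2) => i j; rewrite /in_A => /and5P[oi oj oik ojh /andP[f1 f2]].
    have b1 := pb _ _ oi oj f2.
    have f3 : M%:Z < `|j - h - (i + k)| by clear -f1; lia.
    have b2 := pb _ _ ojh oik f3.
    exact: prod_dev.
  rewrite mulr1; apply: le_trans (_ : 5 * w ^+ 2 <= _); last by rewrite lerDr.
  apply: (le_trans (ler_normB _ _)); rewrite normrM.
  have : `|pi_n R n M (tm x.1) (tm x.2)| * `|pi_n R n M (tm x.2 - h) (tm x.1 + k)| <= (2 * w) * (2 * w).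
    by apply: ler_pM.
  rewrite [`|w ^+ 2|]ger0_norm ?sqr_ge0//; move: (_ * `|_|) => u; nra.
rewrite big_split/= sumr_const card_prod card_ord -[_ *+ (n * n)]mulr_natl natrM -mulr_sumr.
apply: (@le_trans _ _ (N * N * (w ^+ 2 * (90 * r)) + 5 * w ^+ 2 * (12 * m1 * N))).
  by rewrite lerD2l ler_wpM2l// mulr_ge0// sqr_ge0.
by rewrite le_eqVlt; apply/orP; left; apply/eqP; rewrite /w /r; field.
Qed.

End PiXi.

(** * The variance of the statistic *)

Section Lagsum.
Variables (R : realType) (n M : nat).
Local Notation tm := (@obs_at n).

Lemma lagsumN (F : int -> R) : lagsum M F = lagsum M (fun h => F (- h)).
Proof.
rewrite /lagsum (reindex_inj rev_ord_inj)/=; apply: eq_bigr => i _; congr F.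
by have := ltn_ord i; move: (nat_of_ord i) => j /=; lia.
Qed.

Lemma sum_lag_eq (x : int) :
  \sum_(i < M.*2.+1) (x == i%:Z - M%:Z)%:R = ((`|x| <= M%:Z)%R : bool)%:R :> R.
Proof.
have [h|h] := boolP (`|x| <= M%:Z).
  have hi : (absz (x + M%:Z)%R < M.*2.+1)%N by rewrite -addnn; lia.
  rewrite (bigD1 (Ordinal hi))//= big1 => [|i].
    have -> : x == (absz (x + M%:Z)%R)%:Z - M%:Z by lia.
    by rewrite addr0.
  move=> ni; have ni' : (i : nat) <> absz (x + M%:Z)%R.
    by move=> e; move: ni; rewrite -val_eqE /= e eqxx.
  by have -> : (x == i%:Z - M%:Z) = false by lia.
rewrite big1// => i _; have := ltn_ord i; move: (nat_of_ord i) => j; rewrite -addnn => hi.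
by have -> : (x == j%:Z - M%:Z) = false by lia.
Qed.

Lemma sum_tm_eq (x : int) : \sum_(t < n) (tm t == x)%:R = (obs_time n x)%:R :> R.
Proof.
have [h|h] := boolP (obs_time n x).
  have hi : (absz (x - 1)%R < n)%N by rewrite /obs_time in h; lia.
  rewrite (bigD1 (Ordinal hi))//= big1 => [|i].
    have -> : tm (Ordinal hi) == x by rewrite /obs_at /=; rewrite /obs_time in h; lia.
    by rewrite addr0.
  move=> ni; have ni' : (i : nat) <> absz (x - 1)%R.
    by move=> e; move: ni; rewrite -val_eqE /= e eqxx.
  by have -> : (tm i == x) = false by rewrite /obs_at; rewrite /obs_time in h; lia.
rewrite big1// => i _; have := ltn_ord i => hi.
by have -> : (tm i == x) = false by rewrite /obs_at; rewrite /obs_time in h; lia.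
Qed.

(** A change of variables to lags; the two vanishing hypotheses make the truncations to {1, ..., n}
    and to lags within M agree. *)
Lemma sum_lag (F : int -> R) (j : int) :
  (forall t, ~~ obs_time n t -> F t = 0) -> (forall t, M%:Z < `|t - j| -> F t = 0) ->
  \sum_(t < n) F (tm t) = lagsum M (fun k => F (j + k)).
Proof.
move=> Fo Fm.
transitivity (\sum_(t < n) \sum_(i < M.*2.+1) (tm t - j == i%:Z - M%:Z)%:R * F (tm t)).
  apply: eq_bigr => t _; rewrite -mulr_suml sum_lag_eq.
  by case: leP => [_|/Fm ->]; rewrite ?mul1r ?mulr0.
rewrite exchange_big/= /lagsum; apply: eq_bigr => i _.
transitivity (\sum_(t < n) (tm t == j + (i%:Z - M%:Z))%:R * F (j + (i%:Z - M%:Z))).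
  apply: eq_bigr => t _; have [e|e] := eqVneq (tm t) (j + (i%:Z - M%:Z)).
    by rewrite e addrAC subrr add0r eqxx.
  by rewrite subr_eq addrC (negbTE e) !mul0r.
rewrite -mulr_suml sum_tm_eq; case: (boolP (obs_time _ _)) => [_|/Fo ->]; first by rewrite mul1r.
by rewrite mulr0.
Qed.

End Lagsum.

(** * The variance as a double sum over lags *)

Section VarM.
Context (R : realType) (d : measure_display) (T : measurableType d).
Variable P : probability T R.
Local Notation Ex := (Expect P).
Local Notation mom := (mom P).
Variables (p : nat) (X : int -> T -> 'cV[R]_p) (M : nat) (mu : 'cV[R]_p).
Variable Gamma : int -> 'M[R]_p.
Hypothesis hX : gaussian_mdep_process P X M mu Gamma.
Local Notation dZ := (dotZ X mu).
Variable n : nat.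
Local Notation tm := (@obs_at n).
Local Notation pin := (pi_n R n M).

(** Of the three pairings in Isserlis' formula, the one inside each scalar product is the product of
    the means and is removed by centring. *)
Lemma cov_dZ u v u' v' :
  Ex (fun w => (dZ u v w - Ex (dZ u v)) * (dZ u' v' w - Ex (dZ u' v'))) =
  \tr (Gamma (u - u') *m Gamma (v' - v)) + \tr (Gamma (u - v') *m Gamma (u' - v)).
Proof.
have md a b : mom (dZ a b) by exact: (mom_dZ hX).
have mm a b : mom (fun w => centred X mu a b w) by exact: (mom_Z hX).
have Ed a b : Ex (dZ a b) = \sum_i Gamma (b - a) i i.
  rewrite Ex_sum; last by move=> i _; exact: momM.
  by apply: eq_bigr => i _; rewrite (Ex_ZZ hX).
have -> : Ex (fun w => (dZ u v w - Ex (dZ u v)) * (dZ u' v' w - Ex (dZ u' v'))) =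
   Ex (fun w => dZ u v w * dZ u' v' w) - Ex (dZ u v) * Ex (dZ u' v').
  set a := Ex (dZ u v); set b := Ex (dZ u' v').
  rewrite (Ex_ext _ (g := fun w => dZ u v w * dZ u' v' w + ((- b) * dZ u v w + ((- a) * dZ u' v' w + a * b)))).
    have m1 : mom (fun w => (- a) * dZ u' v' w + a * b) by apply: momD; [exact: momZ|exact: mom_cst].
    have m2 : mom (fun w => (- b) * dZ u v w + ((- a) * dZ u' v' w + a * b)).
      by apply: momD => //; exact: momZ.
    rewrite ExD//; last exact: momM.
    rewrite ExD//; last exact: momZ.
    rewrite ExD; [|exact: momZ|exact: mom_cst].
    by rewrite Ex_cst !ExZ// -/a -/b; ring.
  by move=> w; ring.
rewrite (Ex_ext _ (g := fun w => \sum_i \sum_j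
   (centred X mu u i w * centred X mu v i w) * (centred X mu u' j w * centred X mu v' j w))); last first.
  by move=> w; rewrite /dotZ /dot mulr_suml; apply: eq_bigr => i _; rewrite mulr_sumr.
rewrite !Ed mulr_suml Ex_sum; last first.
  by move=> i _; apply: mom_sum => j _; apply: momM; exact: momM.
have tE (A B : 'M[R]_p) : \tr (A *m B) = \sum_i \sum_j A j i * B i j :> R.
  by rewrite trace2 exchange_big.
rewrite -sumrB !tE -big_split; apply: eq_bigr => i _ /=.
rewrite Ex_sum; last by move=> j _; apply: momM; exact: momM.
rewrite mulr_sumr -sumrB -big_split; apply: eq_bigr => j _ /=.
rewrite (Ex_Z4 hX) -(opprB u' u) -(opprB v' u) !(GammaN hX); ring.
Qed.

Lemma Mstat_centred w : Mstat n M (fun t => X t w - mu) =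
  \sum_(x : 'I_n * 'I_n) pin (tm x.1) (tm x.2) * dZ (tm x.1) (tm x.2) w.
Proof.
have [_ _ ->] := pi_nP R n M; rewrite sum_obs.
rewrite -(pair_big xpredT xpredT (fun i j => pin (tm i) (tm j) * dZ (tm i) (tm j) w))/=.
apply: eq_bigr => i _; rewrite sum_obs; apply: eq_bigr => j _.
by congr (_ * _); rewrite dotvE; apply: eq_bigr => k _; rewrite !subcolE.
Qed.

(** Symmetry of pi makes the two covariance traces contribute equally, whence the factor 2. The lags
    are restricted to [-M, M] because Gamma vanishes beyond, and the boundary is handled by pi
    vanishing outside {1, ..., n}^2. *)
Lemma varM_E : varM P X n M mu =
  2 * lagsum M (fun h => lagsum M (fun k => xi R n M h k * \tr (Gamma h *m Gamma k))).
Proof.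
pose f w := \sum_(x : 'I_n * 'I_n) pin (tm x.1) (tm x.2) * dZ (tm x.1) (tm x.2) w.
have md a b : mom (dZ a b) by exact: (mom_dZ hX).
have mf : mom f by apply: mom_sum => x _; exact: momZ.
pose c (x : 'I_n * 'I_n) w := dZ (tm x.1) (tm x.2) w - Ex (dZ (tm x.1) (tm x.2)).
have mc x : mom (c x) by apply: momB => //; exact: mom_cst.
have e1 : varM P X n M mu = Ex (fun w => (f w - Ex f) * (f w - Ex f)).
  rewrite /varM (_ : (fun w => Mstat n M (fun t => X t w - mu)) = f); last first.
    by apply/funext => w; exact: Mstat_centred.
  by rewrite /variance covariance.unlock expectation.unlock.
have e2 w : f w - Ex f = \sum_x pin (tm x.1) (tm x.2) * c x w.
  rewrite /f Ex_sum; last by move=> x _; exact: momZ.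
  by rewrite -sumrB; apply: eq_bigr => x _; rewrite ExZ// /c mulrBr.
have psym u v : pin u v = pin v u by have [h _ _] := pi_nP R n M; exact: h.
pose G u v u' v' := \tr (Gamma (u - u') *m Gamma (v' - v)).
have e3 : Ex (fun w => (f w - Ex f) * (f w - Ex f)) =
   \sum_(x : 'I_n * 'I_n) \sum_(y : 'I_n * 'I_n) (pin (tm x.1) (tm x.2) * pin (tm y.1) (tm y.2)) *
     (G (tm x.1) (tm x.2) (tm y.1) (tm y.2) + G (tm x.1) (tm x.2) (tm y.2) (tm y.1)).
  rewrite (Ex_ext _ (g := fun w => \sum_x \sum_y
     (pin (tm x.1) (tm x.2) * pin (tm y.1) (tm y.2)) * (c x w * c y w))); last first.
    move=> w; rewrite !e2 mulr_suml; apply: eq_bigr => x _; rewrite mulr_sumr.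
    by apply: eq_bigr => y _; rewrite mulrACA.
  have mm x y : mom (fun w => (pin (tm x.1) (tm x.2) * pin (tm y.1) (tm y.2)) * (c x w * c y w)).
    by apply: momZ; exact: momM.
  rewrite Ex_sum; last by move=> x _; exact: mom_sum.
  apply: eq_bigr => x _; rewrite Ex_sum//; apply: eq_bigr => y _.
  by rewrite ExZ; [rewrite cov_dZ|exact: momM].
rewrite e1 e3.
have -> : \sum_(x : 'I_n * 'I_n) \sum_(y : 'I_n * 'I_n) (pin (tm x.1) (tm x.2) * pin (tm y.1) (tm y.2)) *
     (G (tm x.1) (tm x.2) (tm y.1) (tm y.2) + G (tm x.1) (tm x.2) (tm y.2) (tm y.1)) =
   2 * \sum_(x : 'I_n * 'I_n) pin (tm x.1) (tm x.2) *
     \sum_(y : 'I_n * 'I_n) pin (tm y.1) (tm y.2) * G (tm x.1) (tm x.2) (tm y.1) (tm y.2).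
  rewrite mulr_sumr; apply: eq_bigr => x _.
  rewrite mulrCA mulr_sumr.
  under eq_bigr do rewrite mulrDr -!mulrA.
  rewrite big_split/= -!mulr_sumr -mulrDr; congr (_ * _).
  rewrite mulr_natl mulr2n; congr (_ + _).
  rewrite (reindex (fun y : 'I_n * 'I_n => (y.2, y.1)))/=; last first.
    by exists (fun y => (y.2, y.1)); case.
  by apply: eq_bigr => y _; rewrite psym.
congr (2 * _).
have inner (i j : int) : \sum_(y : 'I_n * 'I_n) pin (tm y.1) (tm y.2) * G j i (tm y.1) (tm y.2) =
   lagsum M (fun h => lagsum M (fun k => pin (j - h) (i + k) * \tr (Gamma h *m Gamma k))).
  have [_ po _] := pi_nP R n M.
  pose H t s := pin t s * G j i t s.
  rewrite -(pair_big xpredT xpredT (fun t s => H (tm t) (tm s)))/=.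
  pose H2 t := lagsum M (fun k => H t (i + k)).
  have far0 h : M%:Z < `|h| -> Gamma h = 0 by exact: (Gamma_far hX).
  transitivity (\sum_(t < n) H2 (tm t)).
    apply: eq_bigr => t _; apply: sum_lag => s hs.
      by rewrite /H po ?mul0r// (negbTE hs) andbF.
    by rewrite /H /G (far0 _ hs) mulmx0 mxtrace0 mulr0.
  rewrite (sum_lag (M := M) (F := H2) (j := j)).
  - rewrite lagsumN; apply: eq_bigr => h _; apply: eq_bigr => k _.
    move: (h%:Z - M%:Z) (k%:Z - M%:Z) => h' k'; rewrite /H /G.
    have -> : j - (j - h') = h' by ring.
    by have -> : i + k' - i = k' by ring.
  - move=> t ht; rewrite /H2 /lagsum big1// => k _.
    by rewrite /H po ?mul0r// (negbTE ht).
  - move=> t ht; rewrite /H2 /lagsum big1// => k _.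
    by rewrite /H /G (far0 (j - t)) ?mul0mx ?mxtrace0 ?mulr0// distrC.
rewrite -(pair_big xpredT xpredT (fun i j => pin (tm i) (tm j) *
   \sum_(y : 'I_n * 'I_n) pin (tm y.1) (tm y.2) * G (tm i) (tm j) (tm y.1) (tm y.2)))/=.
rewrite exchange_big/=.
transitivity (\sum_(i < n) \sum_(j < n) \sum_(a < M.*2.+1) \sum_(b < M.*2.+1)
  pin (tm i) (tm j) * (pin (tm j - (a%:Z - M%:Z)) (tm i + (b%:Z - M%:Z)) *
     \tr (Gamma (a%:Z - M%:Z) *m Gamma (b%:Z - M%:Z)))).
  apply: eq_bigr => i _; apply: eq_bigr => j _.
  rewrite inner psym /lagsum mulr_sumr; apply: eq_bigr => a _.
  by rewrite mulr_sumr.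
under eq_bigr do rewrite exchange_big/=.
rewrite exchange_big/=; apply: eq_bigr => a _.
under eq_bigr do rewrite exchange_big/=.
rewrite exchange_big/=; apply: eq_bigr => b _.
rewrite /xi sum_obs mulr_suml; apply: eq_bigr => i _.
rewrite sum_obs mulr_suml; apply: eq_bigr => j _.
by rewrite mulrA.
Qed.

End VarM.

(** * Consequences of the trace and mean conditions *)

Section PsdSqrt.
Variables (R : realType) (p : nat).
Implicit Types (A S : 'M[R]_p) (u v : 'cV[R]_p).

Let psd A := A^T = A /\ forall v, 0 <= dotv v (A *m v).

Lemma dotvDl u v w : dotv (u + v) w = dotv u w + dotv v w.
Proof. by rewrite /dotv linearD/= mulmxDl mxE. Qed.

Lemma dotvZl c u w : dotv (c *: u) w = c * dotv u w.
Proof. by rewrite /dotv linearZ/= -scalemxAl mxE. Qed.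

Lemma dotv_eq0 u : dotv u u = 0 -> u = 0.
Proof.
rewrite dotvE => h; apply/colP => i; rewrite mxE.
have h2 : forall j : 'I_p, true -> 0 <= u j 0 * u j 0 by move=> j _; rewrite -expr2 sqr_ge0.
have /eqP : u i 0 * u i 0 = 0 by exact: (psumr_eq0P h2 h).
by rewrite mulf_eq0 orbb => /eqP.
Qed.

Lemma dotv_symm A u v : A^T = A -> dotv u (A *m v) = dotv (A *m u) v.
Proof. by move=> hA; rewrite /dotv trmx_mul hA mulmxA. Qed.

(** With v = A u, the form at u + t v is 2 t |v|^2 + t^2 v'Av, which is negative for small negative
    t unless v = 0; the proof takes t = -|v|^2 / (v'Av + 1). *)
Lemma psd_ker A u : psd A -> dotv u (A *m u) = 0 -> A *m u = 0.
Proof.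
move=> [sA pA] h0; apply: dotv_eq0; set v := A *m u.
have q t : 0 <= 2 * t * dotv v v + t ^+ 2 * dotv v (A *m v).
  have := pA (u + t *: v); rewrite mulmxDr dotvDl -scalemxAr.
  rewrite dotvZl !(dotvC _ (_ + _)) !dotvDl !dotvZl -/v.
  rewrite (dotvC v u) [X in X + _ + _]h0 (dotvC (A *m v)) (dotv_symm u _ sA) -/v (dotvC (A *m v)).
  move=> h; apply: (le_trans h); rewrite le_eqVlt; apply/orP; left; apply/eqP; ring.
have vv : 0 <= dotv v v by rewrite dotvE; apply: sumr_ge0 => i _; rewrite -expr2 sqr_ge0.
have va := pA v.
move: vv va q; move: (dotv v v) (dotv v (A *m v)) => x y x0 y0 q.
apply/eqP; rewrite eq_le x0 andbT leNgt; apply/negP => xp.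
have y1 : 0 < y + 1 by lra.
have := q (- x / (y + 1)).
have -> : 2 * (- x / (y + 1)) * x + (- x / (y + 1)) ^+ 2 * y =
  (x / (y + 1)) ^+ 2 * (- (y + 2)) by field; rewrite gt_eqF.
have : 0 < (x / (y + 1)) ^+ 2 by rewrite exprn_gt0// divr_gt0.
nra.
Qed.

Lemma mxtraceB A B : \tr (A - B) = \tr A - \tr B.
Proof. by rewrite mxtraceD -scaleN1r mxtraceZ mulN1r. Qed.

Lemma tr_sandwich A D : D^T = D -> \tr (D *m A *m D) = \sum_i dotv (col i D) (A *m col i D).
Proof.
move=> sD; apply: eq_bigr => i _; rewrite /dotv mulmxA tr_col sD -row_mul.
by move: (D *m A) => B; rewrite !mxE; apply: eq_bigr => j _; rewrite !mxE.
Qed.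

(** The j-th entry of A times its own j-th column is the squared norm of that column. *)
Lemma symcol_eq0 A j : A^T = A -> A *m col j A = 0 -> col j A = 0.
Proof.
move=> sA Aj; apply: dotv_eq0; have -> : dotv (col j A) (col j A) = (A *m col j A) j 0.
  by rewrite dotvE mxE; apply: eq_bigr => k _; rewrite !mxE -{1}sA mxE.
by rewrite Aj mxE.
Qed.

(* With D = S - A, tr(DSD) + tr(DAD) = tr((SA - AS)(S - A)) = 0, and both traces are
   nonnegative. *)
Lemma psd_sqrt_unique A S : psd A -> is_psd_sqrt (A *m A) S -> S = A.
Proof.
move=> [sA pA] [sS pS SS]; set D := S - A.
have sD : D^T = D by rewrite /D linearB/= sS sA.
have e0 : \tr (D *m S *m D) + \tr (D *m A *m D) = 0.
  have -> : \tr (D *m S *m D) + \tr (D *m A *m D) = \tr ((S *m A - A *m S) *m (S - A)).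
    rewrite -mxtraceD -mulmxDl; congr (\tr (_ *m _)).
    by rewrite /D !mulmxBl SS addrC addrA subrK.
  rewrite mulmxBl !mulmxBr 3!mxtraceB.
  rewrite [\tr (S *m A *m S)]mxtrace_mulC mulmxA SS.
  rewrite -[A *m S *m S]mulmxA SS [\tr (A *m S *m A)]mxtrace_mulC mulmxA.
  rewrite -[S *m A *m A]mulmxA [\tr (S *m (A *m A))]mxtrace_mulC mulmxA.
  by ring.
have p1 i : 0 <= dotv (col i D) (S *m col i D) by [].
have p2 i : 0 <= dotv (col i D) (A *m col i D) by [].
move: e0; rewrite !tr_sandwich// -big_split/= => e0.
have z : forall i : 'I_p, true -> 0 <= dotv (col i D) (S *m col i D) + dotv (col i D) (A *m col i D).
  by move=> i _; rewrite addr_ge0.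
(* Each nonnegative summand of the two traces vanishes, so S and A, and with them D, annihilate
   every column of D. *)
have Di i : D *m col i D = 0.
  have h : dotv (col i D) (S *m col i D) + dotv (col i D) (A *m col i D) = 0 by exact: (psumr_eq0P z e0).
  have -> : D *m col i D = S *m col i D - A *m col i D by rewrite -mulmxBl.
  have hS : S *m col i D = 0.
    apply: (@psd_ker S (col i D)); first by split.
    by apply/eqP; rewrite eq_le p1 andbT; have := p2 i; lra.
  have hA : A *m col i D = 0.
    apply: (@psd_ker A (col i D)); first by split.
    by apply/eqP; rewrite eq_le p2 andbT; have := p1 i; lra.
  by rewrite hS hA subr0.
apply/eqP; rewrite -subr_eq0 -/D; apply/eqP/matrixP => i j.
have hj : col j D = 0 by exact: symcol_eq0.
have e : (col j D) i 0 = D i j by rewrite mxE.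
by rewrite -e hj !mxE.
Qed.

End PsdSqrt.

(** Cauchy-Schwarz on the diagonal of BB', whose squares are then bounded by the sum of all squared
    entries. *)
Lemma trace_sq_le (R : realType) (p : nat) (B : 'M[R]_p) :
  \tr (B *m B^T) ^+ 2 <= p%:R * \tr (B *m B^T *m B *m B^T).
Proof.
set A := B *m B^T; rewrite -mulmxA -/A.
have sA i j : A i j = A j i by rewrite /A !mxE; apply: eq_bigr => k _; rewrite !mxE mulrC.
have -> : p%:R = \sum_(i < p) 1 ^+ 2 :> R.
  by rewrite (eq_bigr (fun=> 1)) ?sumr_const ?card_ord// => i _; rewrite expr1n.
apply: (le_trans (_ : _ <= (\sum_(i < p) 1 ^+ 2) * \sum_i A i i ^+ 2)).
  by rewrite (_ : \tr A = \sum_i 1 * A i i) ?sum_CS//; apply: eq_bigr => i _; rewrite mul1r.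
apply: ler_wpM2l; first by apply: sumr_ge0 => i _; exact: sqr_ge0.
rewrite trace2; apply: ler_sum => i _; rewrite (bigD1 i)//= expr2 lerDl.
by apply: sumr_ge0 => j _; rewrite (sA j i) -expr2 sqr_ge0.
Qed.

Section Bounds.
Context (R : realType) (d : measure_display) (T : measurableType d).
Variable P : probability T R.
Local Notation Ex := (Expect P).
Local Notation mom := (mom P).
Variables (p : nat) (X : int -> T -> 'cV[R]_p) (M : nat) (mu : 'cV[R]_p).
Variable Gamma : int -> 'M[R]_p.
Hypothesis hX : gaussian_mdep_process P X M mu Gamma.

Lemma GammaNT h : Gamma (- h) = (Gamma h)^T.
Proof. by apply/matrixP => i j; rewrite mxE (GammaN hX). Qed.

Lemma Gamma0_psd v : 0 <= dotv v (Gamma 0 *m v).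
Proof.
have mZ i : mom (fun w => centred X mu 0 i w) by exact: (mom_Z hX).
have -> : dotv v (Gamma 0 *m v) = Ex (fun w => (\sum_i v i 0 * centred X mu 0 i w) ^+ 2).
  rewrite (Ex_ext _ (g := fun w => \sum_i \sum_j (v i 0 * v j 0) * (centred X mu 0 i w * centred X mu 0 j w))).
    rewrite Ex_sum => [|i _]; last by apply: mom_sum => j _; apply: momZ; exact: momM.
    rewrite dotvE; apply: eq_bigr => i _; rewrite mxE mulr_sumr.
    rewrite Ex_sum => [|j _]; last by apply: momZ; exact: momM.
    by apply: eq_bigr => j _; rewrite ExZ ?(Ex_ZZ hX) ?subrr; [ring|exact: momM].
  move=> w; rewrite expr2 mulr_suml; apply: eq_bigr => i _.
  by rewrite mulr_sumr; apply: eq_bigr => j _; rewrite mulrACA.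
by apply: Ex_ge0 => w; exact: sqr_ge0.
Qed.

Lemma Gamma0_sqrt S : is_psd_sqrt (Gamma 0 *m Gamma (- 0)) S -> S = Gamma 0.
Proof.
rewrite oppr0; apply: psd_sqrt_unique; split; last exact: Gamma0_psd.
by rewrite -GammaNT oppr0.
Qed.

Lemma Gamma_frob (q g : R) : 0 <= g -> p%:R * q <= g ^+ 2 ->
  (forall h1 h2 h3 h4 : int, `|h1| <= M%:Z -> `|h2| <= M%:Z -> `|h3| <= M%:Z -> `|h4| <= M%:Z ->
   `|\tr (Gamma h1 *m Gamma h2 *m Gamma h3 *m Gamma h4)| <= q) ->
  forall h, `|h| <= M%:Z -> \sum_i \sum_j Gamma h i j ^+ 2 <= g.
Proof.
move=> g0 pq hq h hh; have hN : `|- h| <= M%:Z by rewrite normrN.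
have -> : \sum_i \sum_j Gamma h i j ^+ 2 = \tr (Gamma h *m (Gamma h)^T).
  by rewrite trace2; apply: eq_bigr => i _; apply: eq_bigr => j _; rewrite mxE expr2.
apply: sqr_le_le => //; apply: (le_trans (trace_sq_le _)); apply: le_trans pq.
apply: ler_wpM2l => //; apply: (le_trans (ler_norm _)).
by rewrite -GammaNT; exact: hq.
Qed.

End Bounds.

(** * Ratio consistency *)

Lemma lagsum_abs_le (R : realType) (M : nat) (F : int -> R) (B : R) :
  (forall h : int, `|h| <= M%:Z -> `|F h| <= B) -> `|lagsum M F| <= 2 * M.+1%:R * B.
Proof.
move=> FB; have B0 : 0 <= B by apply: le_trans (FB 0 _) => //; rewrite normr0.
rewrite /lagsum; apply: (le_trans (ler_norm_sum _ _ _)).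
apply: (le_trans (_ : _ <= \sum_(i < M.*2.+1) B)).
  apply: ler_sum => i _; apply: FB; have := ltn_ord i; move: (nat_of_ord i) => j.
  by rewrite -addnn; clear; lia.
rewrite sumr_const card_ord -[leLHS]mulr_natl; apply: ler_wpM2r => //.
by rewrite -natrM ler_nat -addnn; clear; lia.
Qed.

(** The weight m^4 comes from the square of the sum of |xi| over lag pairs. With s of order sqrt(n),
    the terms without L reduce to m^8 <= s^2 = C N and p <= C N; those with g L also use m^4 s <= C
    N. Everything is then a multiple of r^2 t^2, the square of the target up to r^2. *)
Lemma weighted_err_le (R : realFieldType) (m N s r t C K p1 g L q : R) :
  1 <= C -> 1 <= N -> s ^+ 2 = C * N -> 0 <= s -> 0 <= p1 -> p1 <= s ^+ 2 -> 1 <= m -> m ^+ 4 <= s ->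
  0 <= r -> r <= 1 -> 0 <= t -> 3 <= K ->
  g = s * r * t -> L = r ^+ 2 * t / N -> q = r ^+ 2 * t ^+ 2 ->
  m ^+ 4 * (q * m / N + m ^+ 2 * (g ^+ 2 + q) / N ^+ 2 + K * p1 * g ^+ 2 * m ^+ 3 / N ^+ 3
   + g * L + L ^+ 2 + K * p1 * g * L * m ^+ 2 / N ^+ 2) <= 4 * K * C ^+ 3 * (r ^+ 2 * t ^+ 2).
Proof.
move=> C1 N1 sE s0 p0 ps m1 ms r0 r1 t0 K3 gE LE qE.
have N0 : 0 < N by lra.
have C0 : 0 <= C by lra.
have m0 : 0 <= m by lra.
have mk k : (k <= 8)%N -> m ^+ k / N <= C.
  move=> k8; rewrite ler_pdivrMr// -sE.
  apply: (le_trans (_ : _ <= m ^+ 8)); first by rewrite ler_weXn2l.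
  by rewrite (_ : 8 = 4 * 2)%N// exprM ler_sqr// nnegrE exprn_ge0.
have sN : s ^+ 2 / N = C by rewrite sE; field; rewrite gt_eqF.
have pN : p1 / N <= C by rewrite -sN ler_wpM2r// invr_ge0 ltW.
have msN : m ^+ 4 * s / N <= C.
  rewrite -sN expr2; apply: ler_wpM2r; first by rewrite invr_ge0 ltW.
  by rewrite ler_wpM2r.
have iN : 0 <= N^-1 <= 1 by rewrite invr_ge0 ltW//= invf_le1.
have q0 : 0 <= q by rewrite qE mulr_ge0// sqr_ge0.
have e1 : m ^+ 4 * (q * m / N) = q * (m ^+ 5 / N) by ring.
have e2 : m ^+ 4 * (m ^+ 2 * (g ^+ 2 + q) / N ^+ 2) = q * (m ^+ 6 / N * (s ^+ 2 / N + N^-1)).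
  by rewrite gE qE; field; rewrite gt_eqF.
have e3 : m ^+ 4 * (K * p1 * g ^+ 2 * m ^+ 3 / N ^+ 3) = q * (K * (p1 / N * (s ^+ 2 / N) * (m ^+ 7 / N))).
  by rewrite gE qE; field; rewrite gt_eqF.
have e4 : m ^+ 4 * (g * L) = q * (r * (m ^+ 4 * s / N)).
  by rewrite gE qE LE; field; rewrite gt_eqF.
have e5 : m ^+ 4 * L ^+ 2 = q * (r ^+ 2 * N^-1 * (m ^+ 4 / N)).
  by rewrite qE LE; field; rewrite gt_eqF.
have e6 : m ^+ 4 * (K * p1 * g * L * m ^+ 2 / N ^+ 2) =
    q * (K * (r * (p1 / N * (m ^+ 4 * s / N) * (m ^+ 2 / N)))).
  by rewrite gE qE LE; field; rewrite gt_eqF.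
rewrite 5!(mulrDr (m ^+ 4)) e1 e2 e3 e4 e5 e6 -!(mulrDr q) -qE [leRHS]mulrC.
apply: ler_wpM2l => //.
have pos k : 0 <= m ^+ k / N by rewrite divr_ge0 ?exprn_ge0// ltW.
have pos2 : 0 <= m ^+ 4 * s / N by rewrite divr_ge0 ?mulr_ge0 ?exprn_ge0// ltW.
have pos3 : 0 <= p1 / N by rewrite divr_ge0// ltW.
have h1 := mk 5%N isT.
have h2 : m ^+ 6 / N * (s ^+ 2 / N + N^-1) <= C * (2 * C).
  by apply: ler_pM => //; [rewrite sN; lra|exact: mk|rewrite sN; lra].
have h3 : p1 / N * (s ^+ 2 / N) * (m ^+ 7 / N) <= C * C * C.
  by rewrite sN; apply: ler_pM => //; [rewrite mulr_ge0|rewrite ler_wpM2r|exact: mk].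
have h4 : r * (m ^+ 4 * s / N) <= 1 * C by apply: ler_pM.
have h5 : r ^+ 2 * N^-1 * (m ^+ 4 / N) <= 1 * 1 * C.
  apply: ler_pM => //; last exact: mk; first by rewrite mulr_ge0 ?sqr_ge0//; lra.
  by apply: ler_pM; rewrite ?sqr_ge0 ?exprn_ile1//; lra.
have h6 : r * (p1 / N * (m ^+ 4 * s / N) * (m ^+ 2 / N)) <= 1 * (C * C * C).
  apply: ler_pM => //; first by apply: mulr_ge0; [exact: mulr_ge0|exact: pos].
  apply: ler_pM; [by rewrite mulr_ge0|exact: pos|by apply: ler_pM|exact: mk].
have k3 : K * (p1 / N * (s ^+ 2 / N) * (m ^+ 7 / N)) <= K * (C * C * C) by rewrite ler_wpM2l//; lra.
have k6 : K * (r * (p1 / N * (m ^+ 4 * s / N) * (m ^+ 2 / N))) <= K * (1 * (C * C * C)).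
  by rewrite ler_wpM2l//; lra.
have c2 : C <= C * C by rewrite ler_peMl.
have c3 : C * C <= C * C * C by rewrite ler_peMr// mulr_ge0.
have c4 : 3 * (C * C * C) <= K * (C * C * C) by apply: ler_wpM2r => //; do 2 apply: mulr_ge0 => //.
have -> : 4 * K * C ^+ 3 = 4 * (K * (C * C * C)) by ring.
lra.
Qed.

Lemma one_sub_prod (R : realFieldType) (x u v : R) :
  0 <= 1 - u -> 1 - u <= x -> 0 <= 1 - v -> 1 - v <= x -> x <= 1 -> `|1 - u * v| <= 2 * x.
Proof. by move=> *; rewrite ler_norml; nra. Qed.

Lemma half_dev (R : realFieldType) (x y : R) : `|y / 2 - x| <= 1 / 2 * x -> x <= y.
Proof. by rewrite ler_norml => /andP[+ _]; lra. Qed.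

Lemma tr_hat_cst_ge0 (R : realType) : 0 <= tr_hat_cst R.
Proof. by rewrite /tr_hat_cst; do 3 (apply: mulr_ge0; first exact: ler0n); exact: ler0n. Qed.

Lemma scale_half (R : realFieldType) (k x C r y : R) :
  x <= C -> 0 <= r -> 0 <= y -> 0 <= k -> k * (C * r) <= 1 / 2 -> k * (x * r) * y <= 1 / 2 * y.
Proof.
move=> xC r0 y0 k0 h; apply: ler_wpM2r => //; apply: le_trans h.
by apply: ler_wpM2l => //; apply: ler_wpM2r.
Qed.

(** * Explicit bounds at a fixed sample size *)

Section Quantitative.
Context (R : realType) (d : measure_display) (T : measurableType d).
Variable P : probability T R.
Local Notation Ex := (Expect P).
Local Notation mom := (mom P).
Variables (p : nat) (X : int -> T -> 'cV[R]_p) (M : nat) (mu : 'cV[R]_p).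
Variable Gamma : int -> 'M[R]_p.
Hypothesis hX : gaussian_mdep_process P X M mu Gamma.
Variable n : nat.
Hypothesis hn : (100 * M.+1 <= n)%N.
Local Notation m1 := (M.+1%:R : R).
Local Notation N := (n%:R : R).
Local Notation p1 := (p.+1%:R : R).
Local Notation xi := (xi R n M).
Local Notation V := (varM P X n M mu).
Let t : R := \tr (Omega n M Gamma *m Omega n M Gamma).
Variables (C s r : R).
Hypothesis C1 : 1 <= C.
Hypothesis s0 : 0 <= s.
Hypothesis sE : s ^+ 2 = C * N.
Hypothesis ps : p1 <= s ^+ 2.
Hypothesis ms : m1 ^+ 4 <= s.
Hypothesis r0 : 0 < r.
Hypothesis r1 : r <= 1.
Hypothesis rC : 608 * (C * r) <= 1 / 2.
Hypothesis t0 : 0 < t.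
Hypothesis hL : dotv mu (Gamma 0 *m mu) <= r ^+ 2 * t / N.
Hypothesis hq : forall h1 h2 h3 h4 : int,
  `|h1| <= M%:Z -> `|h2| <= M%:Z -> `|h3| <= M%:Z -> `|h4| <= M%:Z ->
   `|\tr (Gamma h1 *m Gamma h2 *m Gamma h3 *m Gamma h4)| <= r ^+ 2 * t ^+ 2.
(** Chosen so that g^2 = s^2 r^2 t^2 dominates p times the bound on the fourth-order traces. *)
Let g := s * r * t.

Let N1 : 1 <= N.
Proof. by rewrite ler1n; move: hn; clear; lia. Qed.

Let m1_1 : 1 <= m1.
Proof. by rewrite ler1n. Qed.

Let Ng0 : 0 < N.
Proof. exact: lt_le_trans N1. Qed.

Let mN : 100 * m1 <= N.
Proof. by rewrite -natrM ler_nat. Qed.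

Let g0 : 0 <= g.
Proof. by rewrite !mulr_ge0// ltW. Qed.

Let hg h : `|h| <= M%:Z -> \sum_i \sum_j Gamma h i j ^+ 2 <= g.
Proof.
apply: (Gamma_frob hX g0 _ hq).
have -> : g ^+ 2 = s ^+ 2 * (r ^+ 2 * t ^+ 2) by rewrite /g; ring.
apply: ler_wpM2r; first by rewrite mulr_ge0 ?sqr_ge0.
by apply: le_trans ps; rewrite ler_nat.
Qed.

Let trg a b : `|a| <= M%:Z -> `|b| <= M%:Z -> `|\tr (Gamma a *m Gamma b)| <= g.
Proof.
move=> ha hb; apply: sqr_le_le => //.
by rewrite -normrX ger0_norm ?sqr_ge0//; exact: (trace2_le hg).
Qed.

Let wt (h : int) : R := 1 - `|h|%:~R / N.

Lemma trOmega2E : t = lagsum M (fun h => lagsum M (fun k => wt h * wt k * \tr (Gamma h *m Gamma k))).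
Proof.
rewrite /t /Omega {1}/lagsum mulmx_suml raddf_sum/=; apply: eq_bigr => i _.
rewrite /lagsum mulmx_sumr raddf_sum/=; apply: eq_bigr => j _.
by rewrite -scalemxAl -scalemxAr !mxtraceZ mulrA.
Qed.

Let wt_bd h : `|h| <= M%:Z -> 0 <= 1 - wt h <= m1 / N.
Proof.
move=> hh; have -> : 1 - wt h = `|h|%:~R / N by rewrite /wt; ring.
rewrite divr_ge0 ?ler0z ?ler0n//= ler_wpM2r ?invr_ge0 ?ler0n//.
rewrite (_ : m1 = (M.+1%:Z)%:~R)// ler_int; move: hh; clear; lia.
Qed.

Let coef_bd h k : `|h| <= M%:Z -> `|k| <= M%:Z ->
  `|xi h k - wt h * wt k / N ^+ 2| <= 152 * (m1 / N ^+ 3).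
Proof.
move=> hh hk; have h1 := xi_bound R hn hh hk.
have /andP[a0 a1] := wt_bd hh; have /andP[b0 b1] := wt_bd hk.
have x1 : m1 / N <= 1 by rewrite ler_pdivrMr// mul1r; have := mN; have := m1_1; lra.
have h2 : `|1 - wt h * wt k| <= 2 * (m1 / N).
  exact: one_sub_prod.
have e : xi h k - wt h * wt k / N ^+ 2 = (xi h k - N ^- 2) + (1 - wt h * wt k) / N ^+ 2.
  by field; rewrite gt_eqF.
rewrite e; apply: (le_trans (ler_normD _ _)).
have -> : 152 * (m1 / N ^+ 3) = 150 * (m1 / N ^+ 3) + 2 * (m1 / N) / N ^+ 2.
  by field; rewrite gt_eqF.
apply: lerD => //; rewrite normrM [X in _ * X]ger0_norm ?invr_ge0 ?sqr_ge0//.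
by rewrite ler_wpM2r// invr_ge0 sqr_ge0.
Qed.

(** Half the variance and t/n^2 are lag sums of the same traces, with coefficients differing by at
    most 152(M + 1)/n^3. Although the traces are only bounded by g = s r t, the extra 1/n makes the
    total error at most half of t/n^2. *)
Lemma varM_lower : t / N ^+ 2 <= V.
Proof.
have Vh : V / 2 = lagsum M (fun h => lagsum M (fun k => xi h k * \tr (Gamma h *m Gamma k))).
  by rewrite (varM_E hX n); field.
have tE : t / N ^+ 2 = lagsum M (fun h => lagsum M (fun k =>
    wt h * wt k / N ^+ 2 * \tr (Gamma h *m Gamma k))).
  rewrite trOmega2E /lagsum mulr_suml; apply: eq_bigr => i _.
  by rewrite mulr_suml; apply: eq_bigr => j _; rewrite mulrAC.
have D : `|V / 2 - t / N ^+ 2| <= 2 * m1 * (2 * m1 * (152 * (m1 / N ^+ 3) * g)).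
  rewrite Vh tE /lagsum -sumrB.
  apply: (@lagsum_abs_le _ _ (fun h => lagsum M (fun k => xi h k * \tr (Gamma h *m Gamma k)) -
     lagsum M (fun k => wt h * wt k / N ^+ 2 * \tr (Gamma h *m Gamma k)))) => h hh.
  rewrite /lagsum -sumrB.
  apply: (@lagsum_abs_le _ _ (fun k => xi h k * \tr (Gamma h *m Gamma k) -
     wt h * wt k / N ^+ 2 * \tr (Gamma h *m Gamma k))) => k hk.
  rewrite -mulrBl normrM; apply: ler_pM => //; first exact: coef_bd.
  exact: trg.
have m3 : m1 ^+ 3 * s / N <= C.
  rewrite ler_pdivrMr// -sE expr2; apply: ler_wpM2r => //; apply: le_trans ms.
  by rewrite ler_weXn2l.
(* Here 608 = 2 * 2 * 152, which explains the smallness required of r. *)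
have E : 2 * m1 * (2 * m1 * (152 * (m1 / N ^+ 3) * g)) = 608 * ((m1 ^+ 3 * s / N) * r) * (t / N ^+ 2).
  by rewrite /g; field; rewrite gt_eqF.
have tN : 0 <= t / N ^+ 2 by rewrite divr_ge0 ?sqr_ge0// ltW.
have : 608 * ((m1 ^+ 3 * s / N) * r) * (t / N ^+ 2) <= 1 / 2 * (t / N ^+ 2).
  exact: (scale_half m3 (ltW r0) tN (ler0n _ _) rC).
rewrite -E => h; have {}D := le_trans D h.
exact: half_dev D.
Qed.

(** The 576 is 4 * 12^2: the 4 is the squared factor 2 before the lag sums, and 12(M + 1)^2/n^2
    bounds the sum of |xi|. *)
Definition ratio_err_cst : R := 576 * (tr_hat_cst R * (4 * dot4_cst R * C ^+ 3)).

Lemma mom_varM_hat : mom (fun w => varM_hat n M (fun u => X u w)).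
Proof.
apply: momZ; apply: mom_sum => i _; apply: mom_sum => j _; apply: momZ.
have hM (k : 'I_(M.*2.+1)) : `|k%:Z - M%:Z| <= M%:Z.
  by have := ltn_ord k; move: (nat_of_ord k) => l; rewrite -addnn; clear; lia.
exact: (mom_tr_hat hX).
Qed.

(** No cancellation between lags is used: the mean square error is bounded by the squared sum of
    |xi| times the uniform mean square error of the trace estimators. *)
Lemma varM_hat_err :
  Ex (fun w => (varM_hat n M (fun u => X u w) - V) ^+ 2) <= ratio_err_cst * r ^+ 2 * (t / N ^+ 2) ^+ 2.
Proof.
have xi3 h k : `|h| <= M%:Z -> `|k| <= M%:Z -> `|xi h k| <= 3 / N ^+ 2.
  move=> hh hk; have h1 := xi_bound R hn hh hk.
  have e : xi h k = (xi h k - N ^- 2) + N ^- 2 by ring.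
  rewrite e; apply: (le_trans (ler_normD _ _)).
  rewrite [X in _ + X]ger0_norm ?invr_ge0 ?sqr_ge0//.
  apply: (le_trans (lerD h1 (lexx _))).
  have -> : 150 * (m1 / N ^+ 3) + N ^- 2 = (150 * m1 / N + 1) / N ^+ 2 by field; rewrite gt_eqF.
  apply: ler_wpM2r; first by rewrite invr_ge0 sqr_ge0.
  have : 150 * m1 / N <= 2; last by lra.
  by rewrite ler_pdivrMr//; have := mN; have := m1_1; lra.
pose lg (i : 'I_(M.*2.+1)) : int := i%:Z - M%:Z.
have lgM i : `|lg i| <= M%:Z.
  have := ltn_ord i; rewrite /lg; move: (nat_of_ord i) => j; rewrite -addnn; clear; lia.
pose F (x : 'I_(M.*2.+1) * 'I_(M.*2.+1)) w :=
  tr_hat n M (fun u => X u w) (lg x.1) (lg x.2) - \tr (Gamma (lg x.1) *m Gamma (lg x.2)).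
pose c (x : 'I_(M.*2.+1) * 'I_(M.*2.+1)) := xi (lg x.1) (lg x.2).
have mF x : mom (F x) by apply: momB; [exact: (mom_tr_hat hX)|exact: mom_cst].
have vE w : varM_hat n M (fun u => X u w) - V = 2 * \sum_x c x * F x w.
  rewrite (varM_E hX n) -mulrBr /lagsum -sumrB; congr (2 * _).
  rewrite -(pair_big xpredT xpredT (fun i j => c (i, j) * F (i, j) w))/=.
  apply: eq_bigr => i _; rewrite -sumrB; apply: eq_bigr => j _.
  by rewrite -mulrBr.
pose S := tr_hat_err p M n g (r ^+ 2 * t ^+ 2) (r ^+ 2 * t / N).
have FB x : Ex (fun w => F x w ^+ 2) <= tr_hat_cst R * S by exact: (tr_hat_var hX hn hg hL hq).
have S0 : 0 <= tr_hat_cst R * S.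
  apply: le_trans (FB (ord0, ord0)); apply: Ex_ge0 => w; exact: sqr_ge0.
have cs : \sum_x `|c x| <= 2 * m1 * (2 * m1 * (3 / N ^+ 2)).
  rewrite -(pair_big xpredT xpredT (fun i j => `|c (i, j)|))/=.
  have := @lagsum_abs_le R M (fun h => lagsum M (fun k => `|xi h k|)) (2 * m1 * (3 / N ^+ 2)).
  rewrite ger0_norm; last by apply: sumr_ge0 => i _; exact: sumr_ge0.
  apply => h hh; apply: lagsum_abs_le => k hk; rewrite normr_id; exact: xi3.
rewrite (Ex_ext _ (g := fun w => 4 * (\sum_x c x * F x w) ^+ 2)); last first.
  by move=> w; rewrite vE exprMn; congr (_ * _); ring.
rewrite ExZ; last by apply: momX; apply: mom_sum => x _; exact: momZ.
have h1 := Ex_avg mF S0 (fun x _ => FB x) (c := c).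
have h2 : tr_hat_cst R * S * (\sum_x `|c x|) ^+ 2 <= tr_hat_cst R * S * (2 * m1 * (2 * m1 * (3 / N ^+ 2))) ^+ 2.
  have c0 : 0 <= \sum_x `|c x| by apply: sumr_ge0.
  apply: ler_wpM2l; first exact: S0.
  by rewrite ler_sqr ?nnegrE ?cs// (le_trans c0 cs).
have h3 : 4 * Ex (fun w => (\sum_x c x * F x w) ^+ 2) <=
    4 * (tr_hat_cst R * S * (2 * m1 * (2 * m1 * (3 / N ^+ 2))) ^+ 2).
  by apply: ler_wpM2l => //; exact: le_trans h2.
apply: (le_trans h3).
have h4 : m1 ^+ 4 * S <= 4 * dot4_cst R * C ^+ 3 * (r ^+ 2 * t ^+ 2).
  rewrite /S /tr_hat_err; exact: (weighted_err_le C1 N1 sE s0 _ ps m1_1 ms (ltW r0) r1 (ltW t0) (dot4_cst_ge3 R)).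
clear h1 h2 h3 S0 FB; rewrite /ratio_err_cst; move: (tr_hat_cst R) (dot4_cst R) S (tr_hat_cst_ge0 R) h4 => c0 K S' c00 h4.
have E : 4 * (c0 * S' * (2 * m1 * (2 * m1 * (3 / N ^+ 2))) ^+ 2) =
  576 / N ^+ 4 * (c0 * (m1 ^+ 4 * S')) by field; rewrite gt_eqF.
have E2 : 576 * (c0 * (4 * K * C ^+ 3)) * r ^+ 2 * (t / N ^+ 2) ^+ 2 =
  576 / N ^+ 4 * (c0 * (4 * K * C ^+ 3 * (r ^+ 2 * t ^+ 2))).
  by field; rewrite gt_eqF.
rewrite E E2; apply: ler_wpM2l; last exact: ler_wpM2l.
by apply: divr_ge0; [exact: ler0n|rewrite exprn_ge0// ltW].
Qed.

End Quantitative.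

Lemma measurable_tail (R : realType) (d : measure_display) (T : measurableType d)
    (P : probability T R) (f : T -> R) (e : R) : mom P f -> measurable [set w | e < `|f w|].
Proof.
move=> mf; rewrite -[X in measurable X]setTI.
rewrite (_ : [set w | _] = [set w | (e%:E < (`|f w|)%:E)%E]); last first.
  by apply/seteqP; split=> w /=; rewrite lte_fin.
apply: emeasurable_fun_o_infty => //; apply/measurable_EFinP.
by apply: measurableT_comp => //; exact: (mom_meas mf).
Qed.

Lemma chebyshev_Ex (R : realType) (d : measure_display) (T : measurableType d)
    (P : probability T R) (f : T -> R) (e : R) : mom P f -> 0 < e ->
  fine (P [set w | e < `|f w|]) <= Expect P (fun w => f w ^+ 2) / e ^+ 2.
Proof.
move=> mf e0; have mf2 : mom P (fun w => f w ^+ 2) by exact: momX.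
have mE : measurable_fun [set: T] (fun w => (f w ^+ 2)%:E).
  by apply/measurable_EFinP; exact: (mom_meas mf2).
have e2 : 0 < e ^+ 2 by exact: exprn_gt0.
have := @le_integral_abse _ _ _ P _ measurableT _ (e ^+ 2) mE e2.
have mB : measurable [set x | (e ^+ 2)%:E <= `|(f x ^+ 2)%:E|]%E.
  rewrite -[X in measurable X]setTI; apply: emeasurable_fun_c_infty => //.
  exact: measurableT_comp.
have mA := measurable_tail e mf.
rewrite setTI.
have AB : (P [set w | (e < `|f w|)%R] <= P [set x | (e ^+ 2)%:E <= `|(f x ^+ 2)%:E|])%E.
  apply: le_measure; rewrite ?inE// => w /= h.
  rewrite lee_fin ger0_norm ?sqr_ge0// -[leRHS]real_normK ?num_real//.
  by rewrite ler_sqr ?nnegrE ?ltW// (lt_trans e0).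
have -> : (\int[P]_x `|(f x ^+ 2)%:E|)%E = (Expect P (fun w => f w ^+ 2))%:E.
  rewrite /Expect /Rintegral fineK.
    by apply: eq_integral => w _; rewrite abse_EFin ger0_norm ?sqr_ge0.
  exact: (integrable_fin_num _ (mom_int mf2)).
move=> h; rewrite ler_pdivlMr// mulrC -lee_fin EFinM fineK ?fin_num_measure//.
apply: le_trans h; apply: lee_wpmul2l; first by rewrite lee_fin ltW.
exact: AB.
Qed.

Lemma bigO_nat_ex (R : realType) (f : nat -> R) (h : nat -> R) :
  f =O_\oo h -> exists2 k : R, 0 < k & \forall n \near \oo, `|f n| <= k * `|h n|.
Proof. by move=> /eqOP /pinfty_ex_gt0. Qed.

(** For n >= 1 also n^(1/8) >= 1, which absorbs the passage from M to M + 1. *)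
Lemma rate_bound (R : realType) (k : R) (M n : nat) : 0 < k -> (0 < n)%N ->
  M%:R <= k * (n%:R `^ (8%:R^-1)) -> M.+1%:R ^+ 8 <= (k + 1) ^+ 8 * n%:R :> R.
Proof.
move=> k0 n0 h; set y := n%:R `^ (8%:R^-1) in h.
have y8 : y ^+ 8 = n%:R.
  by rewrite /y -powR_mulrn ?powR_ge0// -powRrM mulVf ?pnatr_eq0// powRr1.
have y0 : 0 <= y by exact: powR_ge0.
have y1 : 1 <= y.
  rewrite leNgt; apply/negP => y1; have : y ^+ 8 < 1 by rewrite exprn_ilt1.
  by rewrite y8 ltNge ler1n n0.
rewrite -y8 -exprMn lerXn2r ?nnegrE//; first by rewrite mulr_ge0// addr_ge0// ltW.
by rewrite -natr1; lra.
Qed.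

Lemma ratio_err_cst_ge0 (R : realType) (C : R) : 1 <= C -> 0 <= ratio_err_cst C.
Proof.
move=> C1; have K3 := dot4_cst_ge3 R; rewrite /ratio_err_cst; apply: mulr_ge0; first exact: ler0n.
apply: mulr_ge0; first exact: tr_hat_cst_ge0.
by apply: mulr_ge0; [apply: mulr_ge0 => //; lra|apply: exprn_ge0; lra].
Qed.

Lemma exists_small (R : realFieldType) (a b K dl : R) : 1 <= b -> 0 <= a -> 0 <= K -> 0 < dl ->
  exists r : R, [/\ 0 < r, r <= 1, a * (b * r) <= 1 / 2 & K * r <= dl].
Proof.
move=> b1 a0 K0 dl0; pose D := 1 + 2 * (a * b) + K / dl.
have ab : 0 <= a * b by rewrite mulr_ge0//; lra.
have Kd : 0 <= K / dl by rewrite divr_ge0// ltW.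
have D1 : 1 <= D by rewrite /D; lra.
have D0 : 0 < D by lra.
exists D^-1; split; first by rewrite invr_gt0.
- by rewrite invf_le1.
- by rewrite mulrA ler_pdivrMr// /D; lra.
- by rewrite ler_pdivrMr// mulrC -ler_pdivrMr// /D; lra.
Qed.

(** The lower bound t/n^2 for the variance turns the absolute mean square error into a relative one
    of order r^2, uniformly in n. *)
Lemma ratio_deviation_prob (R : realType) (d : measure_display) (T : measurableType d) (P : probability T R)
  (p : nat) (X : int -> T -> 'cV[R]_p) (M : nat) (mu : 'cV[R]_p) (Gamma : int -> 'M[R]_p) (n : nat)
  (t C r e : R) :
  gaussian_mdep_process P X M mu Gamma -> t = \tr (Omega n M Gamma *m Omega n M Gamma) ->
  1 <= C -> p.+1%:R <= C * n%:R -> M.+1%:R ^+ 8 <= C * n%:R -> 100 ^+ 2 * C <= n%:R ->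
  0 < r -> r <= 1 -> 608 * (C * r) <= 1 / 2 -> 0 < t ->
  dotv mu (Gamma 0 *m mu) <= r ^+ 2 * (n%:R^-1 * t) ->
  (forall h1 h2 h3 h4 : int, `|h1| <= M%:Z -> `|h2| <= M%:Z -> `|h3| <= M%:Z -> `|h4| <= M%:Z ->
   `|\tr (Gamma h1 *m Gamma h2 *m Gamma h3 *m Gamma h4)| <= r ^+ 2 * t ^+ 2) -> 0 < e ->
  P [set w | e < `|varM_hat n M (fun u => X u w) / varM P X n M mu - 1|] \is a fin_num /\
  fine (P [set w | e < `|varM_hat n M (fun u => X u w) / varM P X n M mu - 1|])
   <= ratio_err_cst C * r ^+ 2 / e ^+ 2.
Proof.
move=> hX tE C1 pC MC nC r0 r1 rC t0 hL hq e0.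
set N : R := n%:R in nC pC MC hL *; set m1 : R := M.+1%:R in MC *.
have N0 : 0 < N by apply: lt_le_trans nC; rewrite mulr_gt0 ?exprn_gt0//; lra.
have CN : 0 <= C * N by rewrite mulr_ge0// ?ltW//; lra.
have m11 : 1 <= m1 by rewrite ler1n.
(* From (M + 1)^2 <= (M + 1)^8 <= C n and 100^2 C <= n it follows that (100(M + 1))^2 <= n^2. *)
have hn : (100 * M.+1 <= n)%N.
  rewrite -(ler_nat R) natrM -/m1 -/N; apply: sqr_le_le; first exact: ltW.
  have m2 : m1 ^+ 2 <= C * N by apply: le_trans MC; rewrite ler_weXn2l.
  rewrite exprMn; apply: (le_trans (ler_wpM2l _ m2)); first exact: sqr_ge0.
  by rewrite mulrA expr2 ler_wpM2r// ltW.
pose s := Num.sqrt (C * N).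
have s0 : 0 <= s by exact: sqrtr_ge0.
have sE : s ^+ 2 = C * N by exact: sqr_sqrtr.
have ps : p.+1%:R <= s ^+ 2 by rewrite sE.
have ms : m1 ^+ 4 <= s by apply: sqr_le_le => //; rewrite sE -exprM.
rewrite tE in t0 hL hq *; rewrite mulrCA mulrA [_ * r ^+ 2]mulrC in hL.
set t' := \tr _ in t0 hL hq *.
have hL' : dotv mu (Gamma 0 *m mu) <= r ^+ 2 * t' / N.
  by apply: (le_trans hL); rewrite le_eqVlt; apply/orP; left; apply/eqP; rewrite /N; ring.
have vl := varM_lower hX hn s0 sE ps ms r0 rC t0 hq.
have ve := varM_hat_err hX hn C1 s0 sE ps ms r0 r1 t0 hL' hq.
rewrite -/t' -/N in vl ve.
have tN : 0 < t' / N ^+ 2 by rewrite divr_gt0 ?exprn_gt0.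
have mv := mom_varM_hat hX hn.
set V := varM P X n M mu in vl ve mv *.
have V0 : 0 < V by exact: lt_le_trans vl.
pose f w := V^-1 * (varM_hat n M (fun u => X u w) - V).
have mf : mom P f by apply: momZ; apply: momB => //; exact: mom_cst.
rewrite (_ : [set w | _] = [set w | e < `|f w|]); last first.
  apply/seteqP; split=> w /=; have -> : f w = varM_hat n M (fun u => X u w) / V - 1 by rewrite /f; field; rewrite gt_eqF.
    by [].
  by [].
split; first by apply: fin_num_measure; exact: (measurable_tail e mf).
apply: (le_trans (chebyshev_Ex mf e0)); apply: ler_wpM2r; first by rewrite invr_ge0 sqr_ge0.
rewrite (Ex_ext _ (g := fun w => V^-1 ^+ 2 * (varM_hat n M (fun u => X u w) - V) ^+ 2)); last first.
  by move=> w; rewrite /f exprMn.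
rewrite ExZ; last by apply: momX; apply: momB => //; exact: mom_cst.
have K0 := ratio_err_cst_ge0 C1.
apply: (le_trans (ler_wpM2l (sqr_ge0 _) ve)).
rewrite mulrCA ler_piMr//; first by rewrite mulr_ge0 ?sqr_ge0.
have /andP[q0 q1] : 0 <= V^-1 * (t' / N ^+ 2) <= 1.
  apply/andP; split; last by rewrite ler_pdivrMl// mulr1.
  by apply: mulr_ge0; [rewrite invr_ge0 ltW|exact: ltW].
by rewrite -exprMn exprn_ile1.
Qed.

Theorem theorem3p2 (R : realType)
    (d : nat -> measure_display) (T : forall n, measurableType (d n))
    (P : forall n, probability (T n) R)
    (p M : nat -> nat)
    (X : forall n, int -> T n -> 'cV[R]_(p n))
    (mu : forall n, 'cV[R]_(p n))
    (Gamma : forall n, int -> 'M[R]_(p n))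
    (sqrtGG : forall n, int -> 'M[R]_(p n))
    (hX : forall n, gaussian_mdep_process (P n) (X n) (M n) (mu n) (Gamma n))
    (hsqrt : forall n a,
       is_psd_sqrt (Gamma n a *m Gamma n (- a)) (sqrtGG n a))
    (hOmega : \forall n \near \oo,
       0 < \tr (Omega n (M n) (Gamma n) *m Omega n (M n) (Gamma n)))
    (hVar : \forall n \near \oo, 0 < varM (P n) (X n) n (M n) (mu n))
    (h_i : (fun n => (p n)%:R : R) =O_\oo (fun n => n%:R : R))
    (h_ii : (fun n => (M n)%:R : R) =O_\oo (fun n => n%:R `^ (8%:R^-1) : R))
    (h_iii : forall e : R, 0 < e -> \forall n \near \oo,
       forall a b c f : int,
         `|a| <= (M n)%:Z -> `|b| <= (M n)%:Z ->
         `|c| <= (M n)%:Z -> `|f| <= (M n)%:Z ->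
       `|\tr (Gamma n a *m Gamma n b *m Gamma n c *m Gamma n f)|
       <= e * (\tr (Omega n (M n) (Gamma n) *m Omega n (M n) (Gamma n))) ^+ 2)
    (h_iv : forall e : R, 0 < e -> \forall n \near \oo,
       forall a : int, `|a| <= (M n)%:Z ->
       `|dotv (mu n) (sqrtGG n a *m mu n)|
       <= e * (n%:R^-1 *
               \tr (Omega n (M n) (Gamma n) *m Omega n (M n) (Gamma n)))) :
  cvg_in_probability_cst P
    (fun n w => varM_hat n (M n) (fun t => X n t w)
                / varM (P n) (X n) n (M n) (mu n))
    1.
Proof.
move=> e e0.
pose Q n := P n [set w | e < `|varM_hat n (M n) (fun t => X n t w)
                               / varM (P n) (X n) n (M n) (mu n) - 1|].
suff H dl : 0 < dl -> \forall n \near \oo, Q n \is a fin_num /\ fine (Q n) <= dl.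
  apply/fine_cvgP; split; first by apply: filterS (H 1 ltr01) => n [].
  apply/cvgrPdist_le => dl /H; apply: filterS => n [_ h].
  by rewrite sub0r normrN ger0_norm ?fine_ge0.
move=> dl0.
have [k1 k10 hk1] := bigO_nat_ex h_i.
have [k2 k20 hk2] := bigO_nat_ex h_ii.
(* C n dominates both p + 1 and (M + 1)^8; the summand 1 pays for the step from p to p + 1. *)
pose C := k1 + 1 + (k2 + 1) ^+ 8.
have k8 : 0 <= (k2 + 1) ^+ 8 by rewrite exprn_ge0// addr_ge0// ltW.
have C1 : 1 <= C by rewrite /C; lra.
have K0 := ratio_err_cst_ge0 C1.
have de : 0 < dl * e ^+ 2 by rewrite mulr_gt0 ?exprn_gt0.
(* The level r is fixed before n, and (iii) and (iv) are applied with r^2. Since r <= 1, the bound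
   on the constant times r also covers r^2. *)
have [r [r0 r1 rC rK]] : exists r : R, [/\ 0 < r, r <= 1, 608 * (C * r) <= 1 / 2 &
    ratio_err_cst C * r <= dl * e ^+ 2].
  by apply: exists_small; [exact: C1|exact: ler0n|exact: K0|exact: de].
have r20 : 0 < r ^+ 2 by rewrite exprn_gt0.
near=> n.
have n0 : (0 < n)%N by near: n; exact: nbhs_infty_gt.
have n1 : 1 <= n%:R :> R by rewrite ler1n.
have Mn : (M n).+1%:R ^+ 8 <= (k2 + 1) ^+ 8 * n%:R :> R.
  apply: rate_bound => //.
  have h : `|(M n)%:R : R| <= k2 * `|n%:R `^ (8%:R^-1)| by near: n; exact: hk2.
  by rewrite !ger0_norm ?powR_ge0 in h.
have pn : (p n)%:R <= k1 * n%:R :> R.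
  have h : `|(p n)%:R : R| <= k1 * `|n%:R : R| by near: n; exact: hk1.
  by rewrite !ger0_norm in h.
have tn : 0 < \tr (Omega n (M n) (Gamma n) *m Omega n (M n) (Gamma n)).
  by near: n; exact: hOmega.
have qn : forall a b c f : int, `|a| <= (M n)%:Z -> `|b| <= (M n)%:Z ->
    `|c| <= (M n)%:Z -> `|f| <= (M n)%:Z ->
    `|\tr (Gamma n a *m Gamma n b *m Gamma n c *m Gamma n f)|
    <= r ^+ 2 * (\tr (Omega n (M n) (Gamma n) *m Omega n (M n) (Gamma n))) ^+ 2.
  by near: n; exact: h_iii.
have Ln : forall a : int, `|a| <= (M n)%:Z -> `|dotv (mu n) (sqrtGG n a *m mu n)|
    <= r ^+ 2 * (n%:R^-1 * \tr (Omega n (M n) (Gamma n) *m Omega n (M n) (Gamma n))).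
  by near: n; exact: h_iv.
have nC : 100 ^+ 2 * C <= n%:R by near: n; exact: nbhs_infty_ger.
have G0 := Gamma0_sqrt (hX n) (hsqrt n 0).
have L0 : dotv (mu n) (Gamma n 0 *m mu n)
    <= r ^+ 2 * (n%:R^-1 * \tr (Omega n (M n) (Gamma n) *m Omega n (M n) (Gamma n))).
  by apply: le_trans (ler_norm _) _; rewrite -G0; apply: Ln; rewrite normr0.
have k80 : 0 <= (k2 + 1) ^+ 8 * n%:R by rewrite mulr_ge0.
have k1n : 0 <= (k1 + 1) * n%:R by rewrite mulr_ge0// addr_ge0// ltW.
have CE : C * n%:R = (k1 + 1) * n%:R + (k2 + 1) ^+ 8 * n%:R by rewrite /C mulrDl.
have p1n : (p n).+1%:R <= C * n%:R :> R by rewrite CE -natr1; lra.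
have MCn : (M n).+1%:R ^+ 8 <= C * n%:R :> R by rewrite CE; lra.
have [Qf Qle] := ratio_deviation_prob (hX n) erefl C1 p1n MCn nC r0 r1 rC tn L0 qn e0.
split; first exact: Qf.
apply: (le_trans Qle).
rewrite ler_pdivrMr ?exprn_gt0//; apply: le_trans rK; apply: ler_wpM2l => //.
by rewrite expr2 ler_piMl// ltW.
Unshelve. all: by end_near.
Qed.
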